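(* Let $\bar u$ be the solution of $$\bar a\bar u_{xx}+\omega^2\bar u=b(x),\quad x\in(0,L),\qquad \bar u(0)=\bar u(L)=0,$$ for some $b\in C_b^2(0,L)$, and let $\bar{\mathbf u}=(\bar u(X_1),\dots,\bar u(X_{M_x}))^T$. Let $\mathbf v_h$ be the fixed point of the WaveHoltz heterogeneous multiscale method (WHMM) for the vector $\mathbf b=(b(X_1),\dots,b(X_{M_x}))^T$. Assume that $H$ is an integer multiple of $\varepsilon$, that $\eta=\tau$, that $0<\delta\le\omega$ and $\omega\ge1$, that $H\omega\le\sqrt{\bar a}$, and that $\frac{|\bar a-\alpha|}{\bar a}\le\frac12$. (i) There is a constant $C_{\rm abs}$ depending only on $a$ and $q$ such that $$\|\bar{\mathbf u}-\mathbf v_h\|_H\le C_{\rm abs}\left[\frac{(\varepsilon/\eta)^q+H^2\omega^2}{\delta^2}\right]\|b\|_{H^2_\kappa}.$$ (ii) Suppose in addition that $$\min\bigl(H^2\omega^3,\ \omega(\varepsilon/\eta)^q\bigr)\le\delta .$$ If $b\in C_b^2(0,L)\cap C_0([0,L])$ (and $b\neq0$), there exists a constant $C_{\rm rel}>0$ that depends on $a$ and $q$, but is independent of $\omega$ and $b$, and there exists $\omega_0$ depending on $b$, such that $$\frac{\|\bar{\mathbf u}-\mathbf v_h\|_H}{\|\bar{\mathbf u}\|_H}\le C_{\rm rel}\,\frac{\omega(\varepsilon/\eta)^q+H^2\omega^3}{\delta}\qquad\text{for all }\omega\ge\omega_0 .$$ (iii) Suppose, in addition to the hypotheses preceding (i)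 and the extra inequality of (ii), that $b(x)=g((2x/L-1)\omega)$ where $g\in C^3(\mathbb R)$ (with $g\ne0$) and $\operatorname{supp} g\subset(-1,1)$, and that $$H\omega\le\sqrt{\bar a}\,\sqrt{\frac{5}{\mathcal D_g+1}},$$ where $\mathcal D_g$ is the $g$-dependent inverse stability constant defined in the context. Then the relative error estimate in (ii) holds with $\omega_0=1$; in this case $C_{\rm rel}$ remains independent of $\omega$, but may depend on $g$, as well as on $a$ and $q$.
   Context: **Function spaces and norms.** $C_b^2(0,L)$ is the space of twice continuously differentiable functions with bounded derivatives; $C_0([0,L])$ is the space of continuous functions vanishing at $x=0$ and $x=L$. Functions are real. $\|\cdot\|_{L^2}=\|\cdot\|_{L^2(0,L)}$. With $\kappa=\omega/\sqrt{\bar a}$, $\|f\|_{H^2_\kappa}^2=\|f\|_{L^2}^2+\kappa^{-4}\|f_{xx}\|_{L^2}^2$. For grid vectors, $\|\mathbf f\|_H=\bigl(\sum_{j=1}^{M_x}H f_j^2\bigr)^{1/2}$. **Coefficients and grid.** $L>0$ is fixed. $a:\mathbb R\to\mathbb R$ is a fixed 1-periodic function with $0<\inf a\le\sup a<\infty$; $\varepsilon>0$ and $a_\varepsilon(x)=a(x/\varepsilon)$. The homogenized coefficient is the constant $\bar a=\bigl(\int_0^1 a(y)^{-1}\,dy\bigr)^{-1}$. For an integer $M_x\ge1$ put $H=L/(M_x+1)$ and $X_j=jH$, $j=0,\dots,M_x+1$. $D^2\in\mathbb R^{M_x\times M_x}$ is the standard three-point finite difference Laplacian with homogeneous Dirichlet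 conditions: $(D^2\mathbf f)_j=(f_{j+1}-2f_j+f_{j-1})/H^2$ with $f_0=f_{M_x+1}=0$. **Averaging kernel.** $\mathcal K:[-1,1]\to\mathbb R$ is a fixed kernel in the class $\mathbb K^{p,q}$, i.e. $\mathcal K$ has $q$ continuous derivatives, $\int_{-1}^1\mathcal K=1$, $\int_{-1}^1\mathcal K(x)x^k\,dx=0$ for $k=1,\dots,p$, and $\mathcal K^{(\ell)}(\pm1)=0$ for $\ell=0,\dots,q$. Constants said to depend on $q$ depend on it via $\mathcal K$. **HMM coefficient $\alpha$.** Let $\eta,\tau>0$ and let $H$ be an integer multiple of $\varepsilon$. The micro-problem is solved exactly: $w$ is the solution of $w_{tt}=(a_\varepsilon(X_{j+1/2}+x)w_x)_x$, $w(x,0)=x$, $w_t(x,0)=0$, where $X_{j+1/2}=X_j+H/2$ (considered for $x\in\mathbb R$; by finite speed of propagation only a bounded interval around $[-\eta,\eta]$ matters for $|t|\le\tau$). Then $$\alpha=\frac1{\eta\tau}\int_{-\tau}^{\tau}\int_{-\eta}^{\eta}\mathcal K(x/\eta)\,\mathcal K(t/\tau)\,a_\varepsilon(X_{j+1/2}+x)\,w_x(x,t)\,dx\,dt,$$ which is independent of $j$ since $H$ is an integer multiple of $\varepsilon$. **WHMM fixed point.** Let $\omega>0$, $M_t$ a positive integer such that the time step $\Delta t=\frac{2\pi}{\omega M_t}$ is stable, and $\theta=\frac{\sin(\omega\Delta t/2)}{\omega/2}$. For $\mathbf v,\mathbf b\in\mathbb R^{M_x}$ set $\mathbf w^0=\mathbf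 v$, $\mathbf w^1=\mathbf w^0+\frac12\theta^2(\alpha D^2\mathbf w^0-\mathbf b)$, $\mathbf w^{n+1}-2\mathbf w^n+\mathbf w^{n-1}=\theta^2(\alpha D^2\mathbf w^n-\mathbf b\cos(n\omega\Delta t))$, and $$\Pi_h\mathbf v=\frac{2}{M_t}\sum_{n=0}^{M_t-1}\Bigl(\cos\frac{2\pi n}{M_t}-\rho_0\Bigr)\mathbf w^n,\qquad \rho_0=\tfrac14-\tfrac14\tan^2\tfrac{\omega\Delta t}{2}.$$ The fixed point of WHMM for $\mathbf b$ is the vector $\mathbf v_h$ satisfying $\mathbf v_h=\Pi_h\mathbf v_h$ and $\alpha D^2\mathbf v_h+\omega^2\mathbf v_h=\mathbf b$ (the second relation determines it uniquely when $\alpha D^2+\omega^2I$ is invertible). **Eigenvalue gaps.** Let $-\lambda_j^2$ ($\lambda_j>0$, $j=1,\dots,M_x$) be the eigenvalues of $D^2$, and $$\delta_a=\min_j|\omega-\sqrt{\bar a}\lambda_j|,\quad \delta_\alpha=\min_j|\omega-\sqrt{\alpha}\lambda_j|,\quad \delta_0=\min_{k\in\mathbb N}\bigl|\omega-\sqrt{\bar a}\tfrac{\pi k}{L}\bigr|,\quad \delta=\min\{\delta_a,\delta_\alpha,\delta_0\},$$ where $\mathbb N=\{1,2,\dots\}$. **Inverse stability constant.** For $g$ as in (iii), $\mathcal D_g$ denotes a real number, depending on $g$ (with $L$ and $a$ fixed) but independent of $\omega$, such that for $b(x)=g((2x/L-1)\omega)$ and $\bar u$ the corresponding solution of $\bar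 a\bar u_{xx}+\omega^2\bar u=b$, $\bar u(0)=\bar u(L)=0$, one has $\|b\|_{H^2_\kappa}\le\mathcal D_g\,\omega^2\|\bar u\|_{L^2}$ for all $\omega\ge1$ with $0<\delta\le\omega$ (such a number exists). *)

(* Defs.v *)
From HB Require Import structures.
From mathcomp Require Import all_boot all_order all_algebra.
From mathcomp Require Import all_classical all_reals all_analysis.

Set Implicit Arguments.
Unset Strict Implicit.
Unset Printing Implicit Defensive.

Import Order.TTheory GRing.Theory Num.Theory.
Import numFieldNormedType.Exports.

Local Open Scope ring_scope.
Local Open Scope classical_set_scope.

Section FunctionSpaces.
Variable R : realType.
Implicit Types (f g b u : R -> R) (L omega : R).

(* Functions on (0, L) or [0, L] are total functions on R of which only the
   values on that interval matter. *)

Definition Cb2 L f : Prop :=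
  [/\ forall x : R, 0 < x < L -> derivable f x 1,
      forall x : R, 0 < x < L -> derivable f^`() x 1,
      forall x : R, 0 < x < L -> {for x, continuous f^`(2)} &
      exists M, forall x : R, 0 < x < L -> `|f^`() x| <= M /\ `|f^`(2) x| <= M].

Definition C0 L f : Prop :=
  [/\ {within `[0, L], continuous f}, f 0 = 0 & f L = 0].

Definition C3 g : Prop :=
  (forall l, (l < 3)%N -> forall x, derivable g^`(l) x 1) /\
  continuous g^`(3).

Definition normL2 L f : R :=
  Num.sqrt (\int[lebesgue_measure]_(x in `]0, L[) (f x ^+ 2)).

Definition normH2 (kappa : R) L f : R :=
  Num.sqrt (normL2 L f ^+ 2 + kappa ^- 4 * normL2 L f^`(2) ^+ 2).

End FunctionSpaces.

Section Coefficients.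
Variable R : realType.
Implicit Types (a K phi : R -> R).

(* Measurability is what makes the integral defining [abar] meaningful.  In
   the library [inf A = 0] when A has no lower bound, so [0 < inf (range a)]
   implies that a is bounded below. *)
Definition admissible_coef a : Prop :=
  [/\ measurable_fun setT a, forall y, a (y + 1) = a y,
      0 < inf (range a) & has_ubound (range a)].

Definition abar a : R :=
  (\int[lebesgue_measure]_(y in `[0, 1]) (a y)^-1)^-1.

Definition a_eps a (eps : R) : R -> R := fun x => a (x / eps).

(* The class K^{p,q}.  The derivatives of a function on [-1, 1] at the
   endpoints are one-sided; "K^(l) is continuous on [-1, 1] and vanishes at
   the endpoints" is expressed by one-sided limits from the interior. *)
Definition kernel_class (p q : nat) K : Prop :=
  [/\ forall (l : nat) (x : R), (l < q)%N -> -1 < x < 1 -> derivable K^`(l) x 1,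
      forall x : R, -1 < x < 1 -> {for x, continuous K^`(q)},
      forall l, (l <= q)%N ->
        K^`(l) x @[x --> (-1)^'+] --> 0 /\ K^`(l) x @[x --> 1^'-] --> 0,
      \int[lebesgue_measure]_(x in `[-1, 1]) K x = 1 &
      forall k, (1 <= k <= p)%N ->
        \int[lebesgue_measure]_(x in `[-1, 1]) (K x * x ^+ k) = 0].

Definition C1c phi : Prop :=
  [/\ forall x, derivable phi x 1, continuous phi^`() &
      compact (closure [set x | phi x != 0])].

(* [w] is the weak solution, with spatial derivative [wx], of
     w_tt = (A w_x)_x on R x R,  w(x, 0) = x,  w_t(x, 0) = 0:
   w is in C(R; H^1_loc) and, for every test function phi,
     d^2/dt^2 int w phi = - int A w_x phi'.
   No classical solution exists for discontinuous coefficients A. *)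
Record micro_solution (A : R -> R) (w wx : R -> R -> R) : Prop :=
  MicroSolution {
    micro_meas : forall t, measurable_fun setT (wx ^~ t);
    micro_L2loc : forall t, locally_integrable setT (fun x => wx x t ^+ 2);
    micro_deriv : forall t x y, x <= y ->
      w y t - w x t = \int[lebesgue_measure]_(s in `[x, y]) wx s t;
    micro_cont : forall r t0 : R, 0 < r ->
      \int[lebesgue_measure]_(x in `[- r, r]) ((wx x t - wx x t0) ^+ 2)
        @[t --> t0] --> 0;
    micro_wave : forall phi, C1c phi ->
      let m := fun t => \int[lebesgue_measure]_x (w x t * phi x) in
      [/\ forall t, derivable m t 1, forall t, derivable m^`() t 1 &
          forall t, m^`(2) t =
            - \int[lebesgue_measure]_x (A x * wx x t * derive1 phi x)];
    micro_init : forall x, w x 0 = x;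
    micro_init_t : forall phi, C1c phi ->
      (fun t => \int[lebesgue_measure]_x (w x t * phi x))^`() 0 = 0 }.

(* [alpha] is the HMM coefficient computed from the micro-problem centered at
   the point [Xc]. *)
Definition hmm_coef a K (eps eta tau Xc alpha : R) : Prop :=
  let A := fun x => a_eps a eps (Xc + x) in
  exists w wx : R -> R -> R, micro_solution A w wx /\
    alpha = (eta * tau)^-1 *
      \int[lebesgue_measure]_(t in `[- tau, tau])
        (\int[lebesgue_measure]_(x in `[- eta, eta])
          (K (x / eta) * K (t / tau) * A x * wx x t)).

End Coefficients.

Section Discretization.
Variables (R : realType) (L : R) (Mx : nat).

Definition Hstep : R := L / Mx.+1%:R.

Definition gridpt (j : nat) : R := j%:R * Hstep.

(* The components f_1, ..., f_Mx of a grid vector are indexed by 0, ..., Mx-1. *)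
Definition gridvec (f : R -> R) : 'cV[R]_Mx := \col_(i < Mx) f (gridpt i.+1).

Definition normH (v : 'cV[R]_Mx) : R :=
  Num.sqrt (\sum_(i < Mx) Hstep * v i 0 ^+ 2).

Definition D2 : 'M[R]_Mx :=
  \matrix_(i < Mx, j < Mx)
    (((j == i.+1 :> nat)%:R - 2 * (j == i)%:R + (i == j.+1 :> nat)%:R)
      / Hstep ^+ 2).

(* Minima are written as infima; the first set is finite and in the second
   one the elements tend to infinity, so that both are attained. *)
Definition gap_discrete (c omega : R) : R :=
  inf [set `|omega - Num.sqrt c * l| | l in
        [set l : R | 0 < l /\ eigenvalue D2 (- l ^+ 2)]].

Definition gap_continuous (c omega : R) : R :=
  inf [set `|omega - Num.sqrt c * (pi * k%:R / L)| | k in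
        [set k : nat | (0 < k)%N]].

Definition gap (ab alpha omega : R) : R :=
  Num.min (gap_discrete ab omega)
    (Num.min (gap_discrete alpha omega) (gap_continuous ab omega)).

Section TimeStepping.
Variables (alpha omega : R) (Mt : nat).

Definition dt : R := 2 * pi / (omega * Mt%:R).

Definition theta : R := sin (omega * dt / 2) / (omega / 2).

Definition rho0 : R := 4^-1 - 4^-1 * tan (omega * dt / 2) ^+ 2.

Fixpoint whmm_pair (v b : 'cV[R]_Mx) (n : nat) : 'cV[R]_Mx * 'cV[R]_Mx :=
  match n with
  | 0%N => (v, v + (2^-1 * theta ^+ 2) *: (alpha *: (D2 *m v) - b))
  | m.+1 =>
    let: (w0, w1) := whmm_pair v b m in
    (w1, 2 *: w1 - w0 + theta ^+ 2 *:
           (alpha *: (D2 *m w1) - cos (m.+1%:R * omega * dt) *: b))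
  end.

Definition whmm_iter v b n : 'cV[R]_Mx := (whmm_pair v b n).1.

Definition Pi_h (b v : 'cV[R]_Mx) : 'cV[R]_Mx :=
  (2 / Mt%:R) *: \sum_(0 <= n < Mt)
    (cos (2 * pi * n%:R / Mt%:R) - rho0) *: whmm_iter v b n.

Definition whmm_fixed_point (b v : 'cV[R]_Mx) : Prop :=
  v = Pi_h b v /\ alpha *: (D2 *m v) + omega ^+ 2 *: v = b.

(* Stability of the time stepping: the solutions of the homogeneous
   recurrence are bounded in terms of their two initial values. *)
Definition stable_step : Prop :=
  exists C : R, forall w : nat -> 'cV[R]_Mx,
    (forall n, w n.+2 - 2 *: w n.+1 + w n =
       theta ^+ 2 *: (alpha *: (D2 *m w n.+1))) ->
    forall n, normH (w n) <= C * (normH (w 0%N) + normH (w 1%N)).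

End TimeStepping.
End Discretization.

Section Setting.
Variable R : realType.
Implicit Types (a K b u g : R -> R) (L omega : R).

Definition helmholtz_solution (ab omega L : R) b u : Prop :=
  [/\ {within `[0, L], continuous u},
      forall x : R, 0 < x < L -> derivable u x 1,
      forall x : R, 0 < x < L -> derivable u^`() x 1,
      forall x : R, 0 < x < L -> ab * derive1n 2 u x + omega ^+ 2 * u x = b x &
      u 0 = 0 /\ u L = 0].

(* The standing assumptions shared by all parts of the theorem.  As alpha does
   not depend on the macroscopic midpoint X_{j+1/2} used to compute it, [j] is
   arbitrary. *)
Record whmm_setting a K L omega (Mx Mt j : nat) (eps eta tau alpha : R)
    b ubar (vh : 'cV[R]_Mx) : Prop := WhmmSetting {
  set_L : 0 < L;
  set_Mx : (1 <= Mx)%N;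
  set_eps : 0 < eps;
  set_eta : 0 < eta;
  set_tau : 0 < tau;
  set_Heps : exists k : nat, Hstep L Mx = k%:R * eps;
  set_j : (j <= Mx)%N;
  set_alpha : hmm_coef a K eps eta tau (gridpt L Mx j + Hstep L Mx / 2) alpha;
  set_Mt : (1 <= Mt)%N;
  set_stable : stable_step L Mx alpha omega Mt;
  set_b : Cb2 L b;
  set_ubar : helmholtz_solution (abar a) omega L b ubar;
  set_vh : whmm_fixed_point L alpha omega Mt (gridvec L Mx b) vh;
  set_etatau : eta = tau;
  set_gap : 0 < gap L Mx (abar a) alpha omega <= omega;
  set_omega : 1 <= omega;
  set_Homega : Hstep L Mx * omega <= Num.sqrt (abar a);
  set_close : `|abar a - alpha| / abar a <= 1 / 2 }.

Definition kappa a omega : R := omega / Num.sqrt (abar a).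

Definition scaled_source g L omega : R -> R :=
  fun x => g ((2 * x / L - 1) * omega).

(* [D] is an inverse stability constant for [g].  The gap involves the
   discretization (Mx, alpha), over which D is uniform as well. *)
Definition inverse_stability_const a L g (D : R) : Prop :=
  forall (omega : R) (Mx : nat) (alpha : R) (u : R -> R),
    1 <= omega -> (1 <= Mx)%N -> `|abar a - alpha| / abar a <= 1 / 2 ->
    0 < gap L Mx (abar a) alpha omega <= omega ->
    helmholtz_solution (abar a) omega L (scaled_source g L omega) u ->
    normH2 (kappa a omega) L (scaled_source g L omega)
      <= D * omega ^+ 2 * normL2 L u.

(* The quotient is the intended one only for a nonzero denominator (division
   by zero yields zero in the library), hence the first conjunct. *)
Definition relative_estimate a (q : nat) (C L omega : R) (Mx : nat)
    (eps eta alpha : R) ubar (vh : 'cV[R]_Mx) : Prop :=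
  0 < normH L (gridvec L Mx ubar) /\
  normH L (gridvec L Mx ubar - vh) / normH L (gridvec L Mx ubar)
    <= C * ((omega * (eps / eta) ^+ q + Hstep L Mx ^+ 2 * omega ^+ 3)
             / gap L Mx (abar a) alpha omega).

End Setting.

(* Main.v *)
(** Micro-problem: let [v] be the deviation of the exact micro-solution from
    the steady state [w_0' = abar a / A].  Paired with its conjugate potential,
    [v] becomes a first-order hyperbolic system in which the x-derivative of
    the n-th time integral is a (n-1)-st one.  Choosing all integration
    constants periodic with mean zero makes the n-th time integral of size
    eps^(n+1) at time zero, and an energy estimate with a weight supported in a
    backward cone keeps it so for |x|, |t| <= eta.  As [abar a - alpha] is the
    average of a second time derivative, q integrations by parts against
    K(t / tau) turn this into |abar a - alpha| <= C (eps / eta)^q.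

    Macro-problem: for e = ubar - v_h,
    alpha D2 e + omega^2 e =
      (alpha - abar a) D2 ubar + abar a (D2 ubar - ubar''),
    and the left side dominates omega delta |e| in the sine basis.  The right
    side is controlled by |b| and omega^2 |ubar|; the stability of the
    continuous problem bounds |ubar| by |b| / (omega delta), from the identity
    (u' sin k(x - c) - k u cos k(x - c))' = (u'' + k^2 u) sin k(x - c) with
    c = 0 and c = L.  For the relative estimates |b| <= C omega^2 |ubar|, which
    in (ii) follows by testing the equation with b'', and |ubar| is compared
    with its grid values through piecewise linear interpolation. *)

(* With a bounded measurable coefficient the deviation [v] has an x-derivative only in L2 and a time
   derivative only in the weak sense, so the energy identity cannot be applied to it directly. It is
   applied to time integrals, which are differentiable in time locally uniformly in x. As the
   coefficient is independent of time, difference quotients of solutions are solutions again, and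
   their energies bound the levels below. At the lowest level even the data at time zero are not
   known pointwise; there the second difference quotient of the potential is tested against itself.
   Passing from |ubar| to its grid values loses a multiple of H^2 |ubar''|, which is absorbed when
   H^2 |ubar''| <= 5 |ubar|. If the source norm is at most D omega^2 |ubar|, then abar |ubar''| <=
   (D + 1) omega^2 |ubar|, and absorption is possible when H omega <= sqrt(abar) sqrt(5 / (D + 1)):
   this is the extra condition of (iii). For (ii), D = 4 is reached at large omega, and the
   condition becomes H omega <= sqrt(abar). *)
Require Import Defs.
From HB Require Import structures.
From mathcomp Require Import all_boot all_order all_algebra.
From mathcomp Require Import all_classical all_reals all_analysis.
From mathcomp Require Import measurable_realfun ring lra.
Set Implicit Arguments.
Unset Strict Implicit.
Unset Printing Implicit Defensive.
Import Order.TTheory GRing.Theory Num.Theory.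
Import numFieldNormedType.Exports.
Local Open Scope ring_scope.
Local Open Scope classical_set_scope.

(** * Signed integrals and primitives *)

Section Integration.
Variable R : realType.
Implicit Types (f g F G : R -> R) (x y z c e d h l M B : R).
Notation mu := (@lebesgue_measure R).

(* [lint]: locally integrable; [lbm]: locally bounded and measurable; [sint]:
   the integral from x to y, with its sign, so that [sint_chasles] holds for
   endpoints in any order. *)
Definition lint f := forall x y, mu.-integrable `[x, y] (EFin \o f).

Definition sint f x y : R :=
  \int[mu]_(s in `[x, y]) f s - \int[mu]_(s in `[y, x]) f s.

Definition lbm f := measurable_fun setT f /\
  forall B, exists M, forall x, `|x| <= B -> `|f x| <= M.

Lemma bounded_in (A : set R) f M : (forall x, A x -> `|f x| <= M) ->
  [bounded f x | x in A].
Proof.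
move=> H; exists M; split; first exact: num_real.
by move=> N MN x Ax; apply: le_trans (H _ Ax) (ltW MN).
Qed.

Lemma itv_normr_le x y s : `[x, y] s -> `|s| <= `|x| + `|y|.
Proof.
move=> /= /[!in_itv]/= /andP[xs sy].
have := ler_norm x; have := ler_norm y; have := lerNnormlW (lexx `|x|).
have := lerNnormlW (lexx `|y|); rewrite ler_norml => *; apply/andP; split; lra.
Qed.

Lemma mu_itv_fin x y : (mu `[x, y] < +oo)%E.
Proof. by rewrite /= lebesgue_measure_itv /=; case: ifP => _ //; exact: ltry. Qed.

Lemma lbm_bounded f x y : lbm f -> [bounded f s | s in `[x, y]].
Proof.
by move=> [mf /(_ (`|x| + `|y|))[M HM]]; apply: (@bounded_in _ _ M) => s /itv_normr_le/HM.
Qed.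

Lemma lint_lbm f : lbm f -> lint f.
Proof.
move=> fb x y; apply: measurable_bounded_integrable => //.
- exact: mu_itv_fin.
- by apply: measurable_funTS; case: fb.
- exact: lbm_bounded.
Qed.

Lemma lint_mul f g : lbm f -> lint g -> lint (fun x => f x * g x).
Proof.
move=> fb ig x y; have mf : measurable_fun `[x, y] f.
  by apply: measurable_funTS; case: fb.
by have := @integrableMr _ _ _ mu _ _ f (EFin \o g) mf (lbm_bounded x y fb) (ig x y); apply.
Qed.

Lemma lintD f g : lint f -> lint g -> lint (fun x => f x + g x).
Proof.
move=> i1 i2 x y; have := integrableD _ (i1 x y) (i2 x y).
by apply => //.
Qed.

Lemma lintZ c f : lint f -> lint (fun x => c * f x).
Proof. by move=> i1 x y; have := @integrableZl _ _ _ mu _ _ c _ (i1 x y); apply. Qed.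

Lemma eq_lint f g : f =1 g -> lint f -> lint g.
Proof. by move=> /funext ->. Qed.

Lemma lintN f : lint f -> lint (fun x => - f x).
Proof. by move=> /(lintZ (-1)); apply: eq_lint => x; rewrite mulN1r. Qed.

Lemma lintB f g : lint f -> lint g -> lint (fun x => f x - g x).
Proof. by move=> i1 /lintN; exact: lintD. Qed.

Lemma lint_abs f : lint f -> lint (fun x => `|f x|).
Proof.
move=> i1 x y.
by have /integrable_abse := i1 x y.
Qed.

Lemma lbmD f g : lbm f -> lbm g -> lbm (fun x => f x + g x).
Proof.
move=> [mf bf] [mg bg]; split; first exact: measurable_funD.
move=> B; have [M1 H1] := bf B; have [M2 H2] := bg B.
by exists (M1 + M2) => x xB; apply: le_trans (ler_normD _ _) _; apply: lerD; auto.
Qed.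

Lemma lbmM f g : lbm f -> lbm g -> lbm (fun x => f x * g x).
Proof.
move=> [mf bf] [mg bg]; split; first exact: measurable_funM.
move=> B; have [M1 H1] := bf B; have [M2 H2] := bg B.
by exists (M1 * M2) => x xB; rewrite normrM; apply: ler_pM; auto.
Qed.

Lemma lbm_cst c : lbm (fun=> c).
Proof. by split; [exact: measurable_cst | move=> B; exists `|c|]. Qed.

Lemma lbmN f : lbm f -> lbm (fun x => - f x).
Proof.
move=> [mf bf]; split; first exact: measurableT_comp.
by move=> B; have [M1 H1] := bf B; exists M1 => x /H1; rewrite normrN.
Qed.

Lemma lbmB f g : lbm f -> lbm g -> lbm (fun x => f x - g x).
Proof. by move=> i1 /lbmN; exact: lbmD. Qed.

Lemma lbm_continuous f : continuous f -> lbm f.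
Proof.
move=> cf; split; first exact: continuous_measurable_fun.
move=> B; have [B0|B0] := leP 0 B; last first.
  by exists 0 => x xB; have := le_lt_trans xB B0; rewrite ltNge normr_ge0.
have [||c _ Hc] := @EVT_max R (fun x => `|f x|) (- B) B; first lra.
  apply: continuous_subspaceT => x; apply: continuous_comp; first exact: cf.
  exact: norm_continuous.
by exists `|f c| => x xB; apply: Hc; rewrite in_itv/= -ler_norml.
Qed.

Lemma lbm_indic_itv (i : interval R) : lbm (\1_([set` i]) : R -> R).
Proof.
split; first exact: measurable_indic.
move=> B; exists 1 => x _; rewrite indicE.
by case: (_ \in _) => /=; rewrite ?normr0 ?normr1.
Qed.

Lemma lbmX f n : lbm f -> lbm (fun x => f x ^+ n).
Proof.
move=> fb; elim: n => [|n IH]; first exact: lbm_cst.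
have := lbmM fb IH; congr lbm; apply/funext => x; by rewrite exprS.
Qed.

Lemma sintxx f x : sint f x x = 0.
Proof. by rewrite /sint subrr. Qed.

Lemma sint_rev f x y : sint f y x = - sint f x y.
Proof. by rewrite /sint opprB. Qed.

Lemma sint_le f x y : x <= y -> sint f x y = \int[mu]_(s in `[x, y]) f s.
Proof.
move=> xy; rewrite /sint (_ : \int[mu]_(s in `[y, x]) f s = 0) ?subr0//.
move: xy; rewrite le_eqVlt => /orP[/eqP ->|xy].
  by rewrite set_itv1 Rintegral_set1.
by rewrite set_itv_ge ?Rintegral_set0// bnd_simp -ltNge.
Qed.

Lemma sint_le3 f x y z : lint f -> x <= y -> y <= z ->
  sint f x y + sint f y z = sint f x z.
Proof.
move=> fi xy yz; rewrite !sint_le //; last exact: le_trans yz.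
have := @Rintegral_itvB R f (BLeft x) (BRight z) y (fi x z).
rewrite !bnd_simp xy yz => /(_ isT isT) /eqP; rewrite subr_eq => /eqP ->.
rewrite Rintegral_itv_obnd_cbnd 1?addrC//.
by apply: integrableS (fi x z) => //; apply: subset_itvr; rewrite bnd_simp.
Qed.

Lemma sint_chasles f x y z : lint f -> sint f x y + sint f y z = sint f x z.
Proof.
move=> fi; have [xy|/ltW xy] := leP x y; have [yz|/ltW yz] := leP y z.
- exact: sint_le3.
- have [xz|/ltW xz] := leP x z.
    by rewrite -(sint_le3 fi xz yz) [sint f y z]sint_rev addrK.
  by rewrite [sint f y z]sint_rev -(sint_le3 fi xz xy) [sint f x z]sint_rev; ring.
- have [xz|/ltW xz] := leP x z.
    by rewrite -(sint_le3 fi xy xz) [sint f x y]sint_rev; ring.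
  by rewrite [sint f x z]sint_rev [sint f x y]sint_rev -(sint_le3 fi yz xz); ring.
- by rewrite [sint f x y]sint_rev [sint f y z]sint_rev [sint f x z]sint_rev
    -(sint_le3 fi yz xy); ring.
Qed.

Lemma sintD f g x y : lint f -> lint g ->
  sint (fun s => f s + g s) x y = sint f x y + sint g x y.
Proof. by move=> fi gi; rewrite /sint !RintegralD //; ring. Qed.

Lemma sintZ c f x y : lint f -> sint (fun s => c * f s) x y = c * sint f x y.
Proof. by move=> fi; rewrite /sint !RintegralZl //; ring. Qed.

Lemma sintN f x y : lint f -> sint (fun s => - f s) x y = - sint f x y.
Proof.
move=> fi; rewrite -mulN1r -sintZ //; congr sint; apply/funext => s.
by rewrite mulN1r.
Qed.

Lemma sintB f g x y : lint f -> lint g ->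
  sint (fun s => f s - g s) x y = sint f x y - sint g x y.
Proof. by move=> fi gi; rewrite sintD ?sintN //; exact: lintN. Qed.

Lemma sint_cst c x y : sint (fun=> c) x y = c * (y - x).
Proof.
wlog xy : x y / x <= y => [H|].
  by have [/H //|/ltW/H E] := leP x y; rewrite sint_rev E; ring.
rewrite sint_le // Rintegral_cst //=; congr (_ * _).
rewrite lebesgue_measure_itv /= lte_fin.
by case: ltgtP xy => //= -> _; rewrite subrr.
Qed.

Lemma le_sint f g x y : lint f -> lint g -> x <= y ->
  (forall s, x <= s <= y -> f s <= g s) -> sint f x y <= sint g x y.
Proof.
move=> fi gi xy H; rewrite !sint_le //; exact: le_Rintegral.
Qed.

Lemma sint_ge0 f x y : x <= y -> (forall s, x <= s <= y -> 0 <= f s) -> 0 <= sint f x y.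
Proof.
move=> xy H; rewrite sint_le //; apply: Rintegral_ge0 => s /= /[!in_itv]/=; exact: H.
Qed.

Lemma sint_abs f x y : lint f -> x <= y ->
  `|sint f x y| <= sint (fun s => `|f s|) x y.
Proof. by move=> fi xy; rewrite !sint_le //; exact: le_normr_Rintegral. Qed.

Lemma sint_bound f x y M : lint f ->
  (forall s, Num.min x y <= s <= Num.max x y -> `|f s| <= M) ->
  `|sint f x y| <= M * `|y - x|.
Proof.
move=> fi; have W u v : u <= v -> (forall s, u <= s <= v -> `|f s| <= M) ->
    `|sint f u v| <= M * `|v - u|.
  move=> uv H; apply: le_trans (sint_abs fi uv) _.
  rewrite (ger0_norm (_ : 0 <= v - u)) ?subr_ge0 // -sint_cst.
  by apply: le_sint => //; [exact: lint_abs | exact/lint_lbm/lbm_cst].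
case: (leP x y) => [|/ltW] xy.
exact: (W _ _ xy).
by rewrite sint_rev normrN [`|y - x|]distrC; exact: W.
Qed.

Lemma eq_sint f g x y : (forall s, Num.min x y <= s <= Num.max x y -> f s = g s) ->
  sint f x y = sint g x y.
Proof.
move=> H; rewrite /sint; congr (_ - _); apply: eq_Rintegral => s /[!inE]/=.
  move=> /[!in_itv]/= /andP[xs sy]; apply: H; have xy := le_trans xs sy.
  by rewrite min_l // max_r // xs.
move=> /[!in_itv]/= /andP[xs sy]; apply: H; have xy := le_trans xs sy.
by rewrite min_r // max_l // xs.
Qed.

Lemma sint_sub f x y x' y' : lint f -> (forall s, 0 <= f s) ->
  x' <= x -> x <= y -> y <= y' -> sint f x y <= sint f x' y'.
Proof.
move=> fi f0 x'x xy yy'.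
rewrite -(sint_chasles x' x y' fi) -(sint_chasles x y y' fi).
have := @sint_ge0 f x' x x'x (fun s _ => f0 s).
have := @sint_ge0 f y y' yy' (fun s _ => f0 s); lra.
Qed.

Lemma is_derive_eps F y l :
  (forall e, 0 < e -> exists2 d, 0 < d & forall h, `|h| < d ->
     `|F (y + h) - F y - h * l| <= e * `|h|) -> is_derive y 1 F l.
Proof.
move=> H; suff /cvgrPdist_le E : forall e, 0 < e -> \forall h \near 0^',
    `|l - h^-1 *: ((F \o shift y) (h *: 1) - F y)| <= e.
  have cv : h^-1 *: ((F \o shift y) (h *: 1) - F y) @[h --> 0^'] --> l by exact: E.
  apply: DeriveDef; last exact: cvg_lim cv.
  by apply/cvg_ex; exists l.
move=> e /H[d d0 Hd]; near=> h.
have h0 : h != 0 by near: h; exact: nbhs_dnbhs_neq.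
have hd : `|h| < d.
  by near: h; apply: dnbhs0_lt.
have -> : l - h^-1 *: ((F \o shift y) (h *: 1) - F y) =
    - (h^-1 * (F (y + h) - F y - h * l)).
  rewrite /= [h *: 1]mulr1 [h + y]addrC /GRing.scale/=; field; exact: h0.
rewrite normrN normrM normfV mulrC ler_pdivrMr ?normr_gt0 //; exact: Hd.
Unshelve. all: by end_near. Qed.

Lemma is_derive_epsP F y l : is_derive y 1 F l ->
  forall e, 0 < e -> exists2 d, 0 < d & forall h, `|h| < d ->
     `|F (y + h) - F y - h * l| <= e * `|h|.
Proof.
move=> [dF dl] e e0.
have /cvgrPdist_le/(_ e e0) : h^-1 *: ((F \o shift y) (h *: 1) - F y) @[h --> 0^'] --> l.
  by rewrite -dl; exact: dF.
move=> [d /= d0 Hd]; exists d => // h hd.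
have [->|h0] := eqVneq h 0; first by rewrite addr0 subrr mul0r subr0 normr0 mulr0.
have := Hd h; rewrite /ball_ /= sub0r normrN => /(_ hd h0).
have -> : l - h^-1 *: (F (h *: 1 + y) - F y) =
    - (h^-1 * (F (y + h) - F y - h * l)).
  rewrite [h *: 1]mulr1 [h + y]addrC /GRing.scale/=; field; exact: h0.
by rewrite normrN normrM normfV mulrC ler_pdivrMr ?normr_gt0.
Qed.

Lemma cont_epsP f x : {for x, continuous f} <->
  forall e, 0 < e -> exists2 d, 0 < d & forall y, `|y - x| < d -> `|f y - f x| <= e.
Proof.
split => [/cvgrPdist_le H e /H [d /= d0 Hd]|H].
  by exists d => // y yx; rewrite distrC; apply: Hd; rewrite /ball_/= distrC.
apply/cvgrPdist_le => e /H[d d0 Hd]; exists d => //= y; rewrite /ball_ /= => yx.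
by rewrite distrC; apply: Hd; rewrite distrC.
Qed.

Lemma is_derive_cont F x l : is_derive x 1 F l -> {for x, continuous F}.
Proof. by move=> [dF _]; apply: differentiable_continuous; exact/derivable1_diffP. Qed.

Lemma sint_is_derive f x y : lint f -> {for y, continuous f} ->
  is_derive y 1 (sint f x) (f y).
Proof.
move=> fi /cont_epsP cf; apply: is_derive_eps => e /cf[d d0 Hd].
exists d => // h hd.
rewrite -(@sint_chasles f x y (y + h)) // [_ + sint f y _]addrC addrK.
have -> : h * f y = sint (fun=> f y) y (y + h) by rewrite sint_cst; ring.
rewrite -sintB //; last exact/lint_lbm/lbm_cst.
have := @sint_bound (fun s => f s - f y) y (y + h) e.
rewrite [y + h]addrC addrK; apply.
  by apply: lintB => //; exact/lint_lbm/lbm_cst.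
move=> s; have [yh|hy] := leP y (h + y) => /andP[s1 s2]; apply: Hd; apply: le_lt_trans hd.
  have h0 : 0 <= h by lra.
  by rewrite !ger0_norm; lra.
have h0 : h < 0 by lra.
by rewrite (ltr0_norm h0) ler0_norm; lra.
Qed.

(* Unlike a derivative, this is meaningful for a merely measurable [f]. *)
Definition prim F f := forall x y, F y - F x = sint f x y.

Lemma FTC_all F f : continuous f -> (forall x, is_derive x 1 F (f x)) -> prim F f.
Proof.
move=> cf dF x y; have fi := lint_lbm (lbm_continuous cf).
have D z : is_derive z 1 (fun z => F z - sint f x z) 0.
  have := is_deriveB (dF z) (sint_is_derive x fi (cf z)); rewrite subrr; exact.
have := is_derive_0_is_cst x y D; rewrite sintxx subr0 => ->; ring.
Qed.

(** Cutting [a, b] into N equal pieces bounds the total increment by M (b - a)^2 / N for every N.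
    This replaces differentiation where the integrand is only measurable. *)
Lemma quad_const (Psi : R -> R) a b M : a <= b ->
  (forall x y, a <= x -> x <= y -> y <= b -> `|Psi y - Psi x| <= M * (y - x) ^+ 2) ->
  Psi b = Psi a.
Proof.
move=> ab H; apply/eqP; rewrite -subr_eq0 -normr_le0; apply/ler_addgt0Pr => e e0.
rewrite add0r.
pose N := (Num.truncn (`|M| * (b - a) ^+ 2 / e)).+1.
have N0 : 0 < N%:R :> R by rewrite ltr0n.
have HN : `|M| * (b - a) ^+ 2 / e < N%:R by exact: truncnS_gt.
pose h := (b - a) / N%:R.
have h0 : 0 <= h by rewrite divr_ge0 ?subr_ge0 // ltW.
have Hk k : (k <= N)%N -> `|Psi (a + k%:R * h) - Psi a| <= k%:R * (M * h ^+ 2).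
  elim: k => [_|k IH kN]; first by rewrite !mul0r addr0 subrr normr0.
  have -> : Psi (a + k.+1%:R * h) - Psi a =
    (Psi (a + k.+1%:R * h) - Psi (a + k%:R * h)) + (Psi (a + k%:R * h) - Psi a) by ring.
  apply: le_trans (ler_normD _ _) _.
  rewrite -[k.+1%:R in leRHS]natr1 mulrDl mul1r [leRHS]addrC; apply: lerD; last exact/IH/ltnW.
  have kh : 0 <= k%:R * h by rewrite mulr_ge0.
  have kNh : k.+1%:R * h <= N%:R * h by rewrite ler_wpM2r // ler_nat.
  have E : N%:R * h = b - a by rewrite /h mulrC divfK // gt_eqF.
  have E2 : k.+1%:R * h = k%:R * h + h by rewrite -natr1 mulrDl mul1r.
  have := @H (a + k%:R * h) (a + k.+1%:R * h).
  have -> : a + k.+1%:R * h - (a + k%:R * h) = h by rewrite E2; ring.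
  by apply; lra.
have := Hk N (leqnn N).
have -> : a + N%:R * h = b by rewrite /h mulrC divfK ?gt_eqF //; ring.
move=> /le_trans; apply.
have -> : N%:R * (M * h ^+ 2) = M * (b - a) ^+ 2 / N%:R.
  by rewrite /h; field; rewrite gt_eqF.
rewrite ler_pdivrMr //; move: HN; rewrite ltr_pdivrMr // [N%:R * e]mulrC => /ltW.
apply: le_trans; rewrite ler_wpM2r ?sqr_ge0 //; exact: ler_norm.
Qed.

Lemma prim_lip F f B : prim F f -> lbm f -> exists2 M, 0 <= M &
  forall x y, `|x| <= B -> `|y| <= B -> `|F y - F x| <= M * `|y - x|.
Proof.
move=> pF fb; have [_ /(_ B)[M HM]] := fb; exists `|M| => // x y.
rewrite (ler_norml x) (ler_norml y) => xB yB.
rewrite pF; apply: sint_bound; first exact: lint_lbm.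
move=> s sxy; apply: le_trans (ler_norm M); apply: HM; rewrite ler_norml.
by move: xB yB sxy; case: (leP x y) => _ /andP[? ?] /andP[? ?] /andP[? ?]; apply/andP; split; lra.
Qed.

Lemma prim_cont F f : prim F f -> lbm f -> continuous F.
Proof.
move=> pF fb x; apply/cont_epsP => e e0.
have [M M0 HM] := prim_lip (`|x| + 1) pF fb.
have M1 : 0 < M + 1 by lra.
exists (Num.min 1 (e / (M + 1))); first by rewrite lt_min ltr01 divr_gt0.
move=> y; rewrite lt_min => /andP[y1 y2].
have yB : `|y| <= `|x| + 1.
  rewrite -(subrK x y); apply: le_trans (ler_normD _ _) _; lra.
apply: le_trans (HM x y _ yB) _; first lra.
apply: le_trans (_ : (M + 1) * `|y - x| <= _).
  by rewrite ler_wpM2r //; lra.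
by rewrite mulrC -ler_pdivlMr ?ltW //; lra.
Qed.

Lemma prim_lbm F f : prim F f -> lbm f -> lbm F.
Proof. by move=> pF fb; apply: lbm_continuous; exact: prim_cont pF fb. Qed.

Lemma prim_mul F f G g : prim F f -> prim G g -> lbm f -> lbm g ->
  prim (fun x => F x * G x) (fun x => f x * G x + F x * g x).
Proof.
move=> pF pG fb gb x y.
have Fb := prim_lbm pF fb; have Gb := prim_lbm pG gb.
have ib : lbm (fun x => f x * G x + F x * g x) by apply: lbmD; exact: lbmM.
have ii := lint_lbm ib.
suff W u v : u <= v -> F v * G v - F u * G u = sint (fun x => f x * G x + F x * g x) u v.
  have [/W //|/ltW/W E] := leP x y.
  by rewrite sint_rev -E opprB.
move=> uv; pose B := `|u| + `|v|.
have [M1 M10 H1] := prim_lip B pF fb; have [M2 M20 H2] := prim_lip B pG gb.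
have [_ /(_ B)[M3 H3]] := fb; have [_ /(_ B)[M4 H4]] := gb.
pose Psi z := sint (fun x => f x * G x + F x * g x) u z - F z * G z.
have inB s : u <= s -> s <= v -> `|s| <= B.
  by move=> us sv; apply: itv_normr_le; rewrite /= in_itv /= us.
suff : Psi v = Psi u.
  rewrite /Psi sintxx => /eqP; rewrite subr_eq => /eqP ->; ring.
apply: (@quad_const _ _ _ (M3 * M2 + M1 * M4)) => // a b ua ab bv.
(* Centred at the end values [G b] and [F a], both integrands are of size O(b - a) because [F] and
   [G] are locally Lipschitz; so the increment of [Psi] is quadratic in b - a. *)
have -> : Psi b - Psi a = sint (fun x => f x * (G x - G b)) a b +
    sint (fun x => (F x - F a) * g x) a b.
  rewrite /Psi -(@sint_chasles _ u a b) //.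
  have E1 : sint (fun x => f x * (G x - G b)) a b = sint (fun x => f x * G x) a b - G b * sint f a b.
    rewrite -sintZ -?sintB; try (by apply: lint_lbm; auto using lbmM).
      by apply: eq_sint => s _; ring.
    by apply: lintZ; exact: lint_lbm.
  have E2 : sint (fun x => (F x - F a) * g x) a b = sint (fun x => F x * g x) a b - F a * sint g a b.
    rewrite -sintZ -?sintB; try (by apply: lint_lbm; auto using lbmM).
      by apply: eq_sint => s _; ring.
    by apply: lintZ; exact: lint_lbm.
  rewrite E1 E2 -pF -pG (sintD a b); try (by apply: lint_lbm; exact: lbmM).
  ring.
apply: le_trans (ler_normD _ _) _; rewrite mulrDl.
have L1 : lint (fun x => f x * (G x - G b)).
  by apply/lint_lbm/lbmM => //; apply: lbmB => //; exact: lbm_cst.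
have L2 : lint (fun x => (F x - F a) * g x).
  by apply/lint_lbm/lbmM => //; apply: lbmB => //; exact: lbm_cst.
have ba : `|b - a| = b - a by rewrite ger0_norm ?subr_ge0.
apply: lerD.
  rewrite expr2 mulrA -[X in _ * X]ba; apply: sint_bound => // s.
  rewrite min_l // max_r // => /andP[as_ sb]; rewrite normrM -mulrA.
  apply: ler_pM => //; first by apply/H3/inB; [exact: le_trans as_|exact: le_trans bv].
  have sB := inB s (le_trans ua as_) (le_trans sb bv); have bB := inB b (le_trans ua ab) bv.
  apply: le_trans (H2 _ _ bB sB) _; rewrite ler_wpM2l // distrC ger0_norm ?subr_ge0 //.
  by rewrite lerD2l lerN2.
rewrite expr2 mulrA -[X in _ * X]ba; apply: sint_bound => // s.
rewrite min_l // max_r // => /andP[as_ sb]; rewrite normrM mulrAC.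
have sB := inB s (le_trans ua as_) (le_trans sb bv); have aB := inB a ua (le_trans ab bv).
apply: ler_pM => //; last exact: H4.
by apply: le_trans (H1 _ _ aB sB) _; rewrite ler_wpM2l // ger0_norm ?subr_ge0 // lerD2r.
Qed.

Lemma sint_CS f g x y : x <= y -> lint (fun s => f s ^+ 2) -> lint (fun s => g s ^+ 2) ->
  lint (fun s => f s * g s) ->
  sint (fun s => f s * g s) x y ^+ 2 <=
  sint (fun s => f s ^+ 2) x y * sint (fun s => g s ^+ 2) x y.
Proof.
move=> xy f2 g2 fg.
set b := sint _ x y; set a := sint _ x y; set c := sint _ x y.
have H l : 0 <= a - 2 * l * b + l ^+ 2 * c.
  have : 0 <= sint (fun s => (f s - l * g s) ^+ 2) x y.
    by apply: sint_ge0 => // s _; exact: sqr_ge0.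
  congr (_ <= _); rewrite /a /b /c -[2 * l * _]sintZ // -[l ^+ 2 * _]sintZ // -sintB //; last exact: lintZ.
  rewrite -sintD; [|by apply: lintB => //; exact: lintZ|exact: lintZ].
  by apply: eq_sint => s _; ring.
have c0 : 0 <= c by apply: sint_ge0 => // s _; exact: sqr_ge0.
(* When [c] vanishes the polynomial [H] is affine in l; a nonzero slope would make it equal to -1 at
   the chosen l. *)
have [c00|cn] := eqVneq c 0.
  have [b0|bn] := eqVneq b 0; first by rewrite b0 c00 mulr0 expr0n.
  have := H ((a + 1) / (2 * b)); rewrite c00 mulr0 addr0.
  have -> : a - 2 * ((a + 1) / (2 * b)) * b = -1 by field.
  lra.
have c1 : 0 < c by rewrite lt_def cn.
have := H (b / c).
have -> : a - 2 * (b / c) * b + (b / c) ^+ 2 * c = (a * c - b ^+ 2) / c by field.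
by rewrite pmulr_lge0 ?invr_gt0 // subr_ge0.
Qed.

Definition L2l f := measurable_fun setT f /\ lint (fun x => f x ^+ 2).

Lemma lint_le f g : measurable_fun setT f -> lint g -> (forall x, `|f x| <= g x) -> lint f.
Proof.
move=> mf gi fg x y; apply: (@le_integrable _ _ _ mu _ _ _ (EFin \o g)) => //.
  by apply/measurable_EFinP; exact: measurable_funTS.
move=> s _ /=; rewrite lee_fin; apply: le_trans (fg s) _; exact: ler_norm.
Qed.

Lemma L2l_lint f : L2l f -> lint f.
Proof.
move=> [mf f2]; apply: (lint_le mf (lintD f2 (lint_lbm (lbm_cst 1)))) => x.
rewrite -(real_normK (num_real (f x))); have := sqr_ge0 (`|f x| - 1); nra.
Qed.

Lemma L2l_mul f g : L2l f -> L2l g -> lint (fun x => f x * g x).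
Proof.
move=> [mf f2] [mg g2]; apply: (lint_le _ (lintD f2 g2)).
  exact: measurable_funM.
move=> x; rewrite normrM -(real_normK (num_real (f x))) -(real_normK (num_real (g x))).
have := sqr_ge0 (`|f x| - `|g x|); have := sqr_ge0 (`|f x|); have := sqr_ge0 (`|g x|); nra.
Qed.

Lemma L2l_lbm f : lbm f -> L2l f.
Proof. by move=> fb; split; [case: fb|exact/lint_lbm/lbmX]. Qed.

Lemma L2lM f g : lbm f -> L2l g -> L2l (fun x => f x * g x).
Proof.
move=> fb [mg g2]; split; first by apply: measurable_funM => //; case: fb.
by have := lint_mul (lbmX 2 fb) g2; apply: eq_lint => x; rewrite exprMn.
Qed.

Lemma L2lD f g : L2l f -> L2l g -> L2l (fun x => f x + g x).
Proof.
move=> fl gl; split; first by apply: measurable_funD; [case: fl|case: gl].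
have := lintD (lintD fl.2 gl.2) (lintZ 2 (L2l_mul fl gl)).
by apply: eq_lint => x; ring.
Qed.

Lemma L2lB f g : L2l f -> L2l g -> L2l (fun x => f x - g x).
Proof.
move=> fl gl; have := L2lD fl (L2lM (lbm_cst (-1)) gl).
by congr L2l; apply/funext => x; ring.
Qed.

Lemma L2l_CS f g x y : x <= y -> L2l f -> L2l g ->
  sint (fun s => f s * g s) x y ^+ 2 <=
  sint (fun s => f s ^+ 2) x y * sint (fun s => g s ^+ 2) x y.
Proof. by move=> xy fl gl; apply: sint_CS => //; [exact: fl.2|exact: gl.2|exact: L2l_mul]. Qed.

End Integration.

(** * Calculus in time, locally uniform in space *)

Section TimeCalculus.
Variable R : realType.
Implicit Types (f g : R -> R -> R) (x y t e d h B : R).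

(* Continuity and differentiability in time, locally uniformly in space. *)
Definition Ucont f := (forall t, continuous (f^~ t)) /\
  forall B t e, 0 < e -> exists2 d, 0 < d & forall x h, `|x| <= B -> `|h| < d ->
    `|f x (t + h) - f x t| <= e.

Definition Uder f g := forall B t e, 0 < e -> exists2 d, 0 < d &
  forall x h, `|x| <= B -> `|h| < d ->
    `|f x (t + h) - f x t - h * g x t| <= e * `|h|.

Lemma Ucont_lbm f t : Ucont f -> lbm (f^~ t).
Proof. by move=> [cf _]; exact: lbm_continuous. Qed.

Lemma Ucont_time f x : Ucont f -> continuous (f x).
Proof.
move=> [_ H] t; apply/cont_epsP => e /(H `|x| t)[d d0 Hd]; exists d => // s st.
by have := Hd x (s - t) (lexx _) st; rewrite subrKC.
Qed.

Lemma Uder_is_derive f g x t : Uder f g -> is_derive t 1 (f x) (g x t).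
Proof.
move=> H; apply: is_derive_eps => e /(H `|x| t)[d d0 Hd]; exists d => // h hd.
exact: Hd.
Qed.

Lemma Uder_Ucont f g : Uder f g -> (forall t, continuous (f^~ t)) ->
  (forall t, lbm (g^~ t)) -> Ucont f.
Proof.
move=> H cf gb; split => // B t e e0; have [d d0 Hd] := H B t 1 ltr01.
have [_ /(_ B)[M HM]] := gb t; have M0 : 0 < `|M| + 1 by have := normr_ge0 M; lra.
exists (Num.min d (e / (`|M| + 1))); first by rewrite lt_min d0 divr_gt0.
move=> x h xB; rewrite lt_min => /andP[hd he].
have := Hd x h xB hd; rewrite mul1r => E.
have -> : f x (t + h) - f x t = (f x (t + h) - f x t - h * g x t) + h * g x t by ring.
apply: le_trans (ler_normD _ _) _; rewrite normrM.
have gM : `|g x t| <= `|M| by apply: le_trans (HM x xB) (ler_norm _).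
have : `|h| * `|g x t| <= `|h| * `|M| by rewrite ler_wpM2l.
move: he; rewrite ltr_pdivlMr //; lra.
Qed.

Lemma UcontD f g : Ucont f -> Ucont g -> Ucont (fun x t => f x t + g x t).
Proof.
move=> [cf Hf] [cg Hg]; split; first by move=> t x; apply: cvgD; [exact: cf|exact: cg].
move=> B t e e0; have e2 : 0 < e / 2 by rewrite divr_gt0.
have [d1 d10 H1] := Hf B t _ e2; have [d2 d20 H2] := Hg B t _ e2.
exists (Num.min d1 d2); first by rewrite lt_min d10.
move=> x h xB; rewrite lt_min => /andP[h1 h2].
rewrite opprD addrACA; apply: le_trans (ler_normD _ _) _.
have := H1 x h xB h1; have := H2 x h xB h2; lra.
Qed.

Lemma UcontZ c f : Ucont f -> Ucont (fun x t => c * f x t).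
Proof.
move=> [cf Hf]; split; first by move=> t x; apply: cvgM; [exact: cvg_cst|exact: cf].
move=> B t e e0; have c0 : 0 < `|c| + 1 by have := normr_ge0 c; lra.
have [d d0 H1] := Hf B t _ (divr_gt0 e0 c0); exists d => // x h xB hd.
rewrite -mulrBr normrM; have := H1 x h xB hd; rewrite ler_pdivlMr //.
by have := normr_ge0 (f x (t + h) - f x t); nra.
Qed.

Lemma Ucont_shift s f : Ucont f -> Ucont (fun x t => f x (t + s)).
Proof.
move=> [cf Hf]; split => [t|B t e e0]; first exact: cf.
have [d d0 H1] := Hf B (t + s) e e0; exists d => // x h xB hd.
by rewrite [t + h + s]addrAC; exact: H1.
Qed.

Lemma Ucont_rev f : Ucont f -> Ucont (fun x t => f x (- t)).
Proof.
move=> [cf Hf]; split => [t|B t e e0]; first exact: cf.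
have [d d0 H1] := Hf B (- t) e e0; exists d => // x h xB hd.
by rewrite opprD; apply: H1; rewrite ?normrN.
Qed.

Lemma UderD f g f' g' : Uder f f' -> Uder g g' ->
  Uder (fun x t => f x t + g x t) (fun x t => f' x t + g' x t).
Proof.
move=> Hf Hg B t e e0; have e2 : 0 < e / 2 by rewrite divr_gt0.
have [d1 d10 H1] := Hf B t _ e2; have [d2 d20 H2] := Hg B t _ e2.
exists (Num.min d1 d2); first by rewrite lt_min d10.
move=> x h xB; rewrite lt_min => /andP[h1 h2].
have -> : f x (t + h) + g x (t + h) - (f x t + g x t) - h * (f' x t + g' x t) =
  (f x (t + h) - f x t - h * f' x t) + (g x (t + h) - g x t - h * g' x t) by ring.
apply: le_trans (ler_normD _ _) _.
have := H1 x h xB h1; have := H2 x h xB h2; lra.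
Qed.

Lemma UderZ c f f' : Uder f f' -> Uder (fun x t => c * f x t) (fun x t => c * f' x t).
Proof.
move=> Hf B t e e0; have c0 : 0 < `|c| + 1 by have := normr_ge0 c; lra.
have [d d0 H1] := Hf B t _ (divr_gt0 e0 c0); exists d => // x h xB hd.
have -> : c * f x (t + h) - c * f x t - h * (c * f' x t) =
  c * (f x (t + h) - f x t - h * f' x t) by ring.
rewrite normrM; have := H1 x h xB hd; rewrite mulrAC ler_pdivlMr //.
by have := normr_ge0 (f x (t + h) - f x t - h * f' x t); nra.
Qed.

Lemma Uder_shift s f f' : Uder f f' -> Uder (fun x t => f x (t + s)) (fun x t => f' x (t + s)).
Proof.
move=> Hf B t e e0; have [d d0 H1] := Hf B (t + s) e e0; exists d => // x h xB hd.
by rewrite [t + h + s]addrAC; exact: H1.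
Qed.

Lemma Uder_rev f f' : Uder f f' -> Uder (fun x t => f x (- t)) (fun x t => - f' x (- t)).
Proof.
move=> Hf B t e e0; have [d d0 H1] := Hf B (- t) e e0; exists d => // x h xB hd.
have := H1 x (- h) xB; rewrite normrN mulNr => /(_ hd).
by rewrite opprD mulrN.
Qed.

(** [al] and [be] are the first-order remainders of the two factors. Two terms are linear in them;
    the last one is the product of the two full increments, hence quadratic in [h]. *)
Lemma product_remainder (F G F' G' al be M e' h e : R) :
  `|F| <= M -> `|G| <= M -> `|F'| <= M -> `|G'| <= M -> 1 <= M -> e' <= 1 -> 4 * M * e' <= e ->
  `|h| * (2 * (M + 1) ^+ 2) <= e -> `|al| <= e' * `|h| -> `|be| <= e' * `|h| ->
  `|F * be + G * al + (h * F' + al) * (h * G' + be)| <= e * `|h|.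
Proof.
move=> bF bG bF' bG' M1 e'1 e'M eh all bel; have h0 := normr_ge0 h; have M0 : 0 <= M by lra.
have c (X x : R) : `|X| <= M -> `|x| <= e' * `|h| -> `|h * X + x| <= `|h| * (M + 1).
  move=> XM xe; apply: le_trans (ler_normD _ _) _; rewrite normrM mulrDr mulr1.
  by apply: lerD; [exact: ler_wpM2l|apply: le_trans xe _; exact: ler_piMl].
have d (X x : R) : `|X| <= M -> `|x| <= e' * `|h| -> `|X * x| <= e / 4 * `|h|.
  move=> XM xe; rewrite normrM; apply: le_trans (ler_pM _ _ XM xe) _ => //.
  by rewrite mulrA ler_wpM2r //; lra.
have c3 : `|(h * F' + al) * (h * G' + be)| <= e / 2 * `|h|.
  rewrite normrM; apply: le_trans (ler_pM _ _ (c _ _ bF' all) (c _ _ bG' bel)) _ => //.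
  have -> : `|h| * (M + 1) * (`|h| * (M + 1)) = (`|h| * (2 * (M + 1) ^+ 2)) / 2 * `|h| by field.
  by rewrite ler_wpM2r // ler_pM2r ?invr_gt0.
apply: le_trans (ler_normD _ _) _.
have := ler_normD (F * be) (G * al); have := d _ _ bF bel; have := d _ _ bG all.
by move: c3; lra.
Qed.

Lemma UderM f g f' g' :
  (forall t, lbm (f^~ t)) -> (forall t, lbm (g^~ t)) ->
  (forall t, lbm (f'^~ t)) -> (forall t, lbm (g'^~ t)) ->
  Uder f f' -> Uder g g' ->
  Uder (fun x t => f x t * g x t) (fun x t => f' x t * g x t + f x t * g' x t).
Proof.
move=> fb gb fb' gb' Hf Hg B t e e0.
have [_ /(_ B)[M1 HM1]] := fb t; have [_ /(_ B)[M2 HM2]] := gb t.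
have [_ /(_ B)[M3 HM3]] := fb' t; have [_ /(_ B)[M4 HM4]] := gb' t.
have [M M0 [m1 m2 m3 m4]] : exists2 M, 1 <= M & [/\ M1 <= M, M2 <= M, M3 <= M & M4 <= M].
  exists (`|M1| + `|M2| + `|M3| + `|M4| + 1).
    by have := normr_ge0 M1; have := normr_ge0 M2; have := normr_ge0 M3; have := normr_ge0 M4; lra.
  have := normr_ge0 M1; have := normr_ge0 M2; have := normr_ge0 M3; have := normr_ge0 M4.
  have := ler_norm M1; have := ler_norm M2; have := ler_norm M3; have := ler_norm M4.
  by move=> *; split; lra.
pose e' := Num.min 1 (e / (4 * M)).
have e'0 : 0 < e' by rewrite lt_min ltr01 divr_gt0 //; lra.
have e'1 : e' <= 1 by rewrite ge_min lexx.
have e'2 : 4 * M * e' <= e.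
  rewrite mulrC -ler_pdivlMr; last lra.
  by rewrite ge_min lexx orbT.
have [d1 d10 H1] := Hf B t _ e'0; have [d2 d20 H2] := Hg B t _ e'0.
have k0 : 0 < 2 * (M + 1) ^+ 2 by rewrite mulr_gt0 // exprn_gt0 //; lra.
exists (Num.min d1 (Num.min d2 (e / (2 * (M + 1) ^+ 2)))).
  by rewrite !lt_min d10 d20 divr_gt0.
move=> x h xB; rewrite !lt_min => /and3P[h1 h2 h3].
have := H1 x h xB h1; have := H2 x h xB h2.
have := le_trans (HM1 x xB) m1; have := le_trans (HM2 x xB) m2.
have := le_trans (HM3 x xB) m3; have := le_trans (HM4 x xB) m4.
set F := f x t; set G := g x t; set F' := f' x t; set G' := g' x t => bG' bF' bG bF.
set al := f x (t + h) - F - h * F'; set be := g x (t + h) - G - h * G' => bel all.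
have -> : f x (t + h) * g x (t + h) - F * G - h * (F' * G + F * G') =
   F * be + G * al + (h * F' + al) * (h * G' + be) by rewrite /al /be; ring.
apply: product_remainder bF bG bF' bG' M0 e'1 e'2 _ all bel.
by apply/ltW; rewrite -ltr_pdivlMr.
Qed.

(** Uniformity of the remainder on [a, b] lets it pass under the integral directly, against any
    bounded measurable weight, without dominated convergence. *)
Lemma sint_Uder (chi : R -> R) f g a b t : lbm chi ->
  (forall t, lbm (f^~ t)) -> (forall t, lbm (g^~ t)) -> Uder f g ->
  is_derive t 1 (fun t => sint (fun x => chi x * f x t) a b)
    (sint (fun x => chi x * g x t) a b).
Proof.
move=> cb fb gb Hf; pose B := `|a| + `|b|.
have [_ /(_ B)[M HM]] := cb; apply: is_derive_eps => e e0.
pose N := (`|M| + 1) * (`|b - a| + 1).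
have N0 : 0 < N.
  have := normr_ge0 M; have := normr_ge0 (b - a) => ? ?.
  by apply: mulr_gt0; lra.
have [d d0 Hd] := Hf B t _ (divr_gt0 e0 N0); exists d => // h hd.
have l1 s : lint (fun x => chi x * f x s) by apply/lint_lbm/lbmM.
have l2 s : lint (fun x => chi x * g x s) by apply/lint_lbm/lbmM.
rewrite -sintZ // -sintB // -sintB //; [|exact: lintB|exact: lintZ].
apply: (@le_trans _ _ ((`|M| + 1) * (e / N * `|h|) * `|b - a|)).
  apply: sint_bound; first by apply: lintB; [exact: lintB|exact: lintZ].
  move=> s sab; have sB : `|s| <= B.
    case: (leP a b) sab => ab sab; first by apply: itv_normr_le; rewrite /= in_itv.
    by rewrite /B addrC; apply: itv_normr_le; rewrite /= in_itv.
  have -> : chi s * f s (t + h) - chi s * f s t - h * (chi s * g s t) =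
    chi s * (f s (t + h) - f s t - h * g s t) by ring.
  rewrite normrM; apply: ler_pM => //; last exact: Hd.
  by apply: le_trans (HM s sB) _; have := ler_norm M; lra.
have -> : (`|M| + 1) * (e / N * `|h|) * `|b - a| = e * `|h| * (((`|M| + 1) * `|b - a|) / N) by ring.
rewrite ler_piMr //; first by rewrite mulr_ge0 // ltW.
have := normr_ge0 M => ?.
by rewrite ler_pdivrMr // mul1r /N ler_wpM2l //; lra.
Qed.

Lemma sint_Ucont (chi : R -> R) f a b : lbm chi -> Ucont f ->
  continuous (fun t => sint (fun x => chi x * f x t) a b).
Proof.
move=> cb fc t; have fb s := Ucont_lbm s fc; pose B := `|a| + `|b|.
have [_ /(_ B)[M HM]] := cb; apply/cont_epsP => e e0.
pose N := (`|M| + 1) * (`|b - a| + 1).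
have N0 : 0 < N.
  have := normr_ge0 M; have := normr_ge0 (b - a) => ? ?.
  by apply: mulr_gt0; lra.
have [d d0 Hd] := fc.2 B t _ (divr_gt0 e0 N0); exists d => // t' hd.
have l1 s : lint (fun x => chi x * f x s) by apply/lint_lbm/lbmM.
rewrite -sintB //.
apply: (@le_trans _ _ ((`|M| + 1) * (e / N) * `|b - a|)).
  apply: sint_bound; first exact: lintB.
  move=> s sab; have sB : `|s| <= B.
    case: (leP a b) sab => ab sab; first by apply: itv_normr_le; rewrite /= in_itv.
    by rewrite /B addrC; apply: itv_normr_le; rewrite /= in_itv.
  rewrite -mulrBr normrM; apply: ler_pM => //.
    by apply: le_trans (HM s sB) _; have := ler_norm M; lra.
  by have := Hd s (t' - t) sB hd; rewrite subrKC.
have -> : (`|M| + 1) * (e / N) * `|b - a| = e * (((`|M| + 1) * `|b - a|) / N) by ring.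
rewrite ler_piMr //; first exact: ltW.
have := normr_ge0 M => ?.
by rewrite ler_pdivrMr // mul1r /N ler_wpM2l //; lra.
Qed.

Lemma Uder_int (f0 : R -> R) f : Ucont f ->
  Uder (fun x t => f0 x + sint (f x) 0 t) f.
Proof.
move=> fc B t e e0; have [d d0 Hd] := fc.2 B t e e0; exists d => // x h xB hd.
have fi : lint (f x) by apply/lint_lbm/lbm_continuous/Ucont_time.
rewrite -(@sint_chasles _ (f x) 0 t (t + h)) //.
have -> : f0 x + (sint (f x) 0 t + sint (f x) t (t + h)) - (f0 x + sint (f x) 0 t) - h * f x t
   = sint (fun s => f x s - f x t) t (t + h).
  by rewrite sintB //; [rewrite sint_cst; ring|exact/lint_lbm/lbm_cst].
have E : `|t + h - t| = `|h| by congr `| _ |; ring.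
rewrite -E; apply: sint_bound; first by apply: lintB => //; exact/lint_lbm/lbm_cst.
move=> s st; have := Hd x (s - t) xB; rewrite subrKC; apply.
apply: le_lt_trans hd; case: (leP t (t + h)) st => th /andP[s1 s2].
  by rewrite !ger0_norm; lra.
by rewrite ler0_norm ?(@ltr0_norm _ h); lra.
Qed.

End TimeCalculus.

(** * Energy estimates *)

Section Energy.
Variable R : realType.
Implicit Types (u x y t e d h B : R).

Definition pos (u : R) := Num.max 0 u.

Lemma pos_ge0 u : 0 <= pos u.
Proof. by rewrite le_max lexx. Qed.

Lemma pos_ge u : u <= pos u.
Proof. by rewrite le_max lexx orbT. Qed.

Lemma pos_le0 u : u <= 0 -> pos u = 0.
Proof. by move=> u0; rewrite /pos max_l. Qed.

(** Squaring removes the kink of the positive part: the error k^2 does not depend on u, so the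
    derivative exists everywhere and uniformly. *)
Lemma pos_sq_expand u k : `|pos (u + k) ^+ 2 - pos u ^+ 2 - k * (2 * pos u)| <= k ^+ 2.
Proof.
by rewrite /pos; case: (leP 0 u) => u0; case: (leP 0 (u + k)) => uk;
  rewrite ler_norml; apply/andP; split; nra.
Qed.

Lemma pos_sq_derive u : is_derive u 1 (fun u => pos u ^+ 2) (2 * pos u).
Proof.
apply: is_derive_eps => e e0; exists e => // h he.
apply: le_trans (pos_sq_expand u h) _.
by rewrite -(real_normK (num_real h)) expr2 ler_wpM2r // ltW.
Qed.

Lemma pos_cont : continuous pos.
Proof.
move=> u; apply/cont_epsP => e e0; exists e => // v vu; apply: le_trans (ltW vu).
rewrite /pos; case: (leP 0 u) => u0; case: (leP 0 v) => v0 //; rewrite ?subrr ?normr0 //.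
  by rewrite sub0r normrN [leRHS]distrC !ger0_norm; lra.
by rewrite subr0 !ger0_norm; lra.
Qed.

Lemma MVT_is_derive (f df : R -> R) a b : a < b -> (forall x, is_derive x 1 f (df x)) ->
  exists2 c, a < c < b & f b - f a = df c * (b - a).
Proof.
move=> ab H; have [|c] := @MVT R f df a b ab (fun x _ => H x).
  by apply: continuous_subspaceT => x; exact: is_derive_cont (H x).
by rewrite in_itv /= => cab E; exists c.
Qed.

Section Weight.
Variables (eta k c : R).
Hypotheses (eta0 : 0 < eta) (k0 : 0 < k) (c0 : 0 < c).

(** A paraboloid stands in for the cone: the support shrinks as t grows and stays in |x| <= k eta.
    There -w_t = 4 p c k / eta while |w_x| = 4 p |x| / eta^2 <= 4 p k / eta, with p the positive
    part; hence c |w_x| <= -w_t. *)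
Definition wt_arg x t := k ^+ 2 - 2 * c * k / eta * t - (x / eta) ^+ 2.
Definition wt x t := pos (wt_arg x t) ^+ 2.
Definition wt_t x t := - (2 * c * k / eta) * (2 * pos (wt_arg x t)).
Definition wt_x x t := 2 * pos (wt_arg x t) * - (2 * x / eta ^+ 2).

Lemma wt_Uder : Uder wt wt_t.
Proof.
move=> B t e e0; pose s := 2 * c * k / eta.
have s0 : 0 < s by rewrite divr_gt0 // !mulr_gt0.
exists (e / s ^+ 2); first by rewrite divr_gt0 // exprn_gt0.
move=> x h _; rewrite ltr_pdivlMr ?exprn_gt0 // => hd.
have E : wt_arg x (t + h) = wt_arg x t + - s * h by rewrite /wt_arg -/s; ring.
have := pos_sq_expand (wt_arg x t) (- s * h); rewrite -E.
have -> : pos (wt_arg x (t + h)) ^+ 2 - pos (wt_arg x t) ^+ 2 -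
    - s * h * (2 * pos (wt_arg x t)) = wt x (t + h) - wt x t - h * wt_t x t.
  by rewrite /wt /wt_t -/s; ring.
move=> /le_trans; apply; rewrite exprMn -(real_normK (num_real h)) sqrrN.
by have := normr_ge0 h; nra.
Qed.

Lemma wt_arg_cont t : continuous (wt_arg^~ t).
Proof.
move=> x; apply: cvgB; first exact: cvg_cst.
by under eq_fun do rewrite expr2; do 2 (apply: cvgM => //); exact: cvg_cst.
Qed.

Lemma wt_pos_cont t : continuous (fun x => pos (wt_arg x t)).
Proof. by move=> x; apply: (@continuous_comp _ _ _ (wt_arg^~ t) pos); [exact: wt_arg_cont|exact: pos_cont]. Qed.

Lemma wt_lbm t : lbm (wt^~ t).
Proof. by apply: (@lbmX _ _ 2); apply: lbm_continuous; exact: wt_pos_cont. Qed.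

Lemma wt_t_lbm t : lbm (wt_t^~ t).
Proof.
by apply: lbmM; [exact: lbm_cst|apply: lbmM; [exact: lbm_cst|]];
  apply: lbm_continuous; exact: wt_pos_cont.
Qed.

Lemma wt_x_cont t : continuous (wt_x^~ t).
Proof.
move=> x; apply: cvgM.
  by apply: cvgM; [exact: cvg_cst|exact: wt_pos_cont].
apply: cvgN; apply: cvgM; last exact: cvg_cst.
by apply: cvgM; [exact: cvg_cst|exact: cvg_id].
Qed.

Lemma wt_arg_derive t x : is_derive x 1 (wt_arg^~ t) (- (2 * x / eta ^+ 2)).
Proof.
apply: is_derive_eps => e e0; exists (e * eta ^+ 2); first by rewrite mulr_gt0 // exprn_gt0.
move=> h hd; have -> : wt_arg (x + h) t - wt_arg x t - h * - (2 * x / eta ^+ 2) =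
  - (h ^+ 2 / eta ^+ 2) by rewrite /wt_arg; field; rewrite gt_eqF.
rewrite normrN ger0_norm ?divr_ge0 ?sqr_ge0 // ler_pdivrMr ?exprn_gt0 //.
by rewrite -(real_normK (num_real h)); have := normr_ge0 h; nra.
Qed.

Lemma wt_prim t : prim (wt^~ t) (wt_x^~ t).
Proof.
apply: FTC_all; first exact: wt_x_cont.
move=> x; have := wt_arg_derive t x => H1.
have H2 := pos_sq_derive (wt_arg x t).
exact: (@is_derive1_comp _ (fun u => pos u ^+ 2) (wt_arg^~ t) _ _ _ H2 H1).
Qed.

Lemma wt_end x t : 0 <= t -> (k * eta) ^+ 2 <= x ^+ 2 -> wt x t = 0.
Proof.
move=> t0 xk; rewrite /wt pos_le0 ?expr0n //= /wt_arg.
have : k ^+ 2 <= (x / eta) ^+ 2.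
  by rewrite expr_div_n ler_pdivlMr ?exprn_gt0 // -exprMn.
have : 0 <= 2 * c * k / eta * t by rewrite mulr_ge0 // divr_ge0 // ?ltW // !mulr_gt0.
lra.
Qed.

Lemma wt_le x : wt x 0 <= k ^+ 4.
Proof.
rewrite (_ : k ^+ 4 = (k ^+ 2) ^+ 2); last by rewrite -exprM.
rewrite /wt ler_sqr ?nnegrE ?pos_ge0 ?sqr_ge0 //.
rewrite /pos ge_max sqr_ge0 /= /wt_arg mulr0 subr0.
by have := sqr_ge0 (x / eta); lra.
Qed.

(** For this k one has k^2 - 2 c k = 2 k, so at t = eta and |x| = eta the argument is still 2 k - 1
    = 4 c + 3. *)
Lemma wt_ge1 x t : k = 2 * c + 2 -> 0 <= t -> t <= eta -> - eta <= x -> x <= eta ->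
  1 <= wt x t.
Proof.
move=> kE t0 te x1 x2; have : 1 <= wt_arg x t.
  have h1 : (x / eta) ^+ 2 <= 1.
    rewrite expr_div_n ler_pdivrMr ?exprn_gt0 // mul1r -subr_ge0 subr_sqr.
    by apply: mulr_ge0; lra.
  have h2 : 2 * c * k / eta * t <= 2 * c * k.
    rewrite mulrAC ler_pdivrMr // ler_wpM2l // ltW // !mulr_gt0 //.
  rewrite /wt_arg; move: h1 h2; set a := 2 * c * k / eta * t; set b := (x / eta) ^+ 2.
  by rewrite kE; have := c0; nra.
by move=> h; have := pos_ge (wt_arg x t); rewrite /wt; nra.
Qed.

End Weight.

(** The symmetric hyperbolic system Q_x = S_t, S_x = rho Q_t, with energy density S^2 + rho Q^2. The
    space relations are stated through primitives because [rho] may be discontinuous. *)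
Record regular_pair (rho : R -> R) (S Q S' Q' : R -> R -> R) : Prop := RegularPair {
  rp_dS : Uder S S';
  rp_dQ : Uder Q Q';
  rp_cS : Ucont S';
  rp_cQ : Ucont Q';
  rp_pQ : forall t, prim (Q^~ t) (S'^~ t);
  rp_pS : forall t, prim (S^~ t) (fun x => Q' x t * rho x) }.

Section EnergyEstimate.
Variables (rho : R -> R) (m M : R).
Hypotheses (m0 : 0 < m) (rho_lb : forall x, m <= rho x) (rho_ub : forall x, rho x <= M)
  (rho_lbm : lbm rho).

(** A bound for the propagation speed 1 / sqrt(rho) that avoids a square root: [rho x * speed ^+ 2]
    is at least 1 whenever rho >= m. *)
Definition speed := 1 + m^-1.
Definition cone := 2 * speed + 2.
(** The weight is at most [cone ^+ 4], the factors 1 and rho of the density are at most 1 + M, and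
    the division by m recovers Q^2 from rho Q^2. *)
Definition energy_cst := cone ^+ 4 * (1 + M) / m.

Let c0 : 0 < speed.
Proof. by rewrite /speed ltr_pwDl // invr_ge0 ltW. Qed.

Lemma cone_gt0 : 0 < cone.
Proof. by rewrite /cone; have := c0; lra. Qed.

Let M0 : 0 < M.
Proof. exact: lt_le_trans m0 (le_trans (rho_lb 0) (rho_ub 0)). Qed.

Lemma energy_cst_gt0 : 0 < energy_cst.
Proof.
have := M0 => ?; apply: divr_gt0 => //; apply: mulr_gt0; last by lra.
exact/exprn_gt0/cone_gt0.
Qed.

Section Estimate.
Variables (S Q S' Q' : R -> R -> R) (eta : R).
Hypotheses (RP : regular_pair rho S Q S' Q') (eta0 : 0 < eta).

Let B := cone * eta.
Notation w := (wt eta cone speed).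
Notation w_t := (wt_t eta cone speed).
Notation w_x := (wt_x eta cone speed).

Lemma rp_lbmS' t : lbm (S'^~ t). Proof. exact: Ucont_lbm (rp_cS RP). Qed.
Lemma rp_lbmQ' t : lbm (Q'^~ t). Proof. exact: Ucont_lbm (rp_cQ RP). Qed.
Lemma rp_lbmQ t : lbm (Q^~ t). Proof. by apply: prim_lbm (rp_pQ RP t) (rp_lbmS' t). Qed.
Lemma rp_lbmS t : lbm (S^~ t).
Proof. by apply: prim_lbm (rp_pS RP t) _; apply: lbmM => //; exact: rp_lbmQ'. Qed.

Let dens x t := w_t x t * (S x t * S x t) + w x t * (S' x t * S x t + S x t * S' x t).
Let densQ x t := w_t x t * (Q x t * Q x t) + w x t * (Q' x t * Q x t + Q x t * Q' x t).

Definition energy t := sint (fun x => 1 * (w x t * (S x t * S x t))) (- B) B +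
  sint (fun x => rho x * (w x t * (Q x t * Q x t))) (- B) B.

Let lb1 t : lbm (w^~ t). Proof. exact: wt_lbm. Qed.
Let lb2 t : lbm (w_t^~ t). Proof. exact: wt_t_lbm. Qed.
Let lb3 t : lbm (w_x^~ t). Proof. by apply: lbm_continuous; exact: wt_x_cont. Qed.
Hint Resolve lb1 lb2 lb3 rp_lbmS rp_lbmS' rp_lbmQ rp_lbmQ' rho_lbm lbmM lbmD lbm_cst : core.

Lemma energy_derive t : is_derive t 1 energy
  (sint (fun x => 1 * dens x t) (- B) B + sint (fun x => rho x * densQ x t) (- B) B).
Proof.
have D1 : Uder (fun x t => w x t * (S x t * S x t)) dens.
  apply: UderM; auto; first by apply: wt_Uder => //; exact: cone_gt0.
  by apply: UderM; auto; exact: rp_dS RP.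
have D2 : Uder (fun x t => w x t * (Q x t * Q x t)) densQ.
  apply: UderM; auto; first by apply: wt_Uder => //; exact: cone_gt0.
  by apply: UderM; auto; exact: rp_dQ RP.
apply: is_deriveD.
  by apply: (sint_Uder (- B) B t (lbm_cst 1) _ _ D1) => s; rewrite /dens; auto 8.
by apply: (sint_Uder (- B) B t rho_lbm _ _ D2) => s; rewrite /densQ; auto 8.
Qed.

(** By the system, S S_t + rho Q Q_t = (S Q)_x. Integrating by parts against the weight, which
    vanishes at both ends, leaves w_t (S^2 + rho Q^2) - 2 w_x S Q, and the decay of the weight in
    time absorbs the second term. *)
Lemma energy_derive_le0 t : 0 <= t ->
  sint (fun x => 1 * dens x t) (- B) B + sint (fun x => rho x * densQ x t) (- B) B <= 0.
Proof.
move=> t0; have B0 : 0 <= B by rewrite mulr_ge0 // ltW // cone_gt0.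
have P : prim (fun x => w x t * (S x t * Q x t)) (fun x => w_x x t * (S x t * Q x t) +
    w x t * ((Q' x t * rho x) * Q x t + S x t * S' x t)).
  apply: prim_mul; [exact: wt_prim| |by []|by auto 8].
  by apply: prim_mul; [exact: rp_pS RP t|exact: rp_pQ RP t|auto|auto].
have E : sint (fun x => w_x x t * (S x t * Q x t) +
    w x t * ((Q' x t * rho x) * Q x t + S x t * S' x t)) (- B) B = 0.
  rewrite -P; rewrite !wt_end ?mul0r ?subrr //; try exact: cone_gt0.
  by rewrite /B sqrrN.
rewrite -sintD; try by apply: lint_lbm; rewrite /dens /densQ; auto 10.
(* Zero becomes twice the integral of the exact derivative (w S Q)_x, so that the comparison can be
   made pointwise in x. *)
have -> : 0 = 2 * 0 :> R by rewrite mulr0.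
rewrite -E -sintZ; last by apply: lint_lbm; auto 10.
apply: le_sint; [by apply: lint_lbm; rewrite /dens /densQ; auto 12| |lra|].
  by apply: lintZ; apply: lint_lbm; auto 10.
move=> x /andP[x1 x2]; rewrite /dens /densQ.
set a := S x t; set b := Q x t.
suff : w_t x t * (a ^+ 2 + rho x * b ^+ 2) <= 2 * (w_x x t * (a * b)) by nra.
rewrite /wt_t /wt_x; set p := pos _.
have p0 : 0 <= p by exact: pos_ge0.
have c2 : 1 <= rho x * speed ^+ 2.
  have mm : m * m^-1 = 1 by rewrite mulfV // gt_eqF.
  have mi : 0 < m^-1 by rewrite invr_gt0.
  have h : m * m^-1 <= rho x * m^-1 by rewrite ler_wpM2r // ltW.
  have r0 : 0 < rho x by exact: lt_le_trans (rho_lb x).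
  have h2 : 0 <= rho x * (m^-1) ^+ 2 by rewrite mulr_ge0 ?sqr_ge0 // ltW.
  rewrite (_ : rho x * speed ^+ 2 = rho x + 2 * (rho x * m^-1) + rho x * (m^-1) ^+ 2).
    by lra.
  by rewrite /speed; ring.
(* Expand the square of speed |a| - |b| and use rho speed^2 >= 1 on the b^2 term. *)
have ab : 2 * `|a * b| <= speed * (a ^+ 2 + rho x * b ^+ 2).
  rewrite normrM -(real_normK (num_real a)) -(real_normK (num_real b)).
  have : 0 <= (speed * `|a| - `|b|) ^+ 2 by exact: sqr_ge0.
  have := sqr_ge0 `|b| => h1 h2.
  have h3 : `|b| ^+ 2 <= rho x * speed ^+ 2 * `|b| ^+ 2 by rewrite ler_peMl.
  rewrite -(ler_pM2l c0); nra.
have xe : `|x| / eta ^+ 2 <= cone / eta.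
  have -> : cone / eta = B / eta ^+ 2 by rewrite /B; field; rewrite gt_eqF.
  by rewrite ler_wpM2r ?invr_ge0 ?sqr_ge0 // ler_norml x1.
have h1 : x / eta ^+ 2 * (a * b) <= cone / eta * `|a * b|.
  apply: le_trans (ler_norm _) _; rewrite normrM ler_wpM2r // normrM.
  by rewrite [`|_^-1|]ger0_norm // invr_ge0 sqr_ge0.
have ce : 0 <= cone / eta by rewrite divr_ge0 // ltW // cone_gt0.
have h2 : cone / eta * (2 * `|a * b|) <= cone / eta * (speed * (a ^+ 2 + rho x * b ^+ 2)).
  by rewrite ler_wpM2l.
have -> : - (2 * speed * cone / eta) * (2 * p) * (a ^+ 2 + rho x * b ^+ 2) =
  - (4 * p) * (cone / eta * (speed * (a ^+ 2 + rho x * b ^+ 2))) by ring.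
have -> : 2 * (2 * p * - (2 * x / eta ^+ 2) * (a * b)) =
  - (4 * p) * (2 * (x / eta ^+ 2 * (a * b))) by ring.
rewrite !mulNr lerN2 ler_wpM2l ?mulr_ge0 //; lra.
Qed.

Lemma energy_noninc t : 0 <= t -> energy t <= energy 0.
Proof.
rewrite le_eqVlt => /orP[/eqP <- //|t0].
have [s /andP[s0 _] E] := MVT_is_derive t0 energy_derive.
rewrite -subr_le0 E subr0 pmulr_lle0 //; apply: energy_derive_le0; exact: ltW.
Qed.

Lemma energy_bound t : 0 <= t -> t <= eta ->
  sint (fun x => Q x t ^+ 2) (- eta) eta <=
  energy_cst * (sint (fun x => S x 0 ^+ 2) (- B) B + sint (fun x => Q x 0 ^+ 2) (- B) B).
Proof.
move=> t0 te; have e0 : - eta <= eta by lra.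
have Be : eta <= B by rewrite /B ler_peMl ?ltW // /cone; have := c0; lra.
have BB : - B <= B by lra.
have w0 x s : 0 <= w x s by exact: sqr_ge0.
have r0 x : 0 <= rho x by apply: le_trans (rho_lb x); exact: ltW.
have s1 : sint (fun x => Q x t ^+ 2) (- eta) eta <=
    m^-1 * sint (fun x => rho x * (w x t * (Q x t * Q x t))) (- B) B.
  apply: (@le_trans _ _ (m^-1 * sint (fun x => rho x * (w x t * (Q x t * Q x t))) (- eta) eta)); last first.
    apply: ler_wpM2l; first by rewrite invr_ge0 ltW.
    apply: sint_sub => //; [by apply: lint_lbm; auto| |lra].
    by move=> s; rewrite mulr_ge0 // mulr_ge0 // -expr2 sqr_ge0.
  rewrite -sintZ; last by apply: lint_lbm; auto.
  apply: le_sint => //; [by apply/lint_lbm/lbmX|by apply: lint_lbm; auto|].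
  move=> x /andP[x1 x2]; rewrite mulrA -expr2.
  have := @wt_ge1 eta cone speed eta0 cone_gt0 c0 x t erefl t0 te x1 x2.
  move=> w1; have mr : 1 <= m^-1 * rho x by rewrite mulrC ler_pdivlMr // mul1r.
  rewrite mulrA ler_peMl ?sqr_ge0 //; nra.
have s2 : sint (fun x => rho x * (w x t * (Q x t * Q x t))) (- B) B <= energy t.
  rewrite lerDr; apply: sint_ge0 => // x _; rewrite mul1r mulr_ge0 // -expr2 sqr_ge0 //.
have s3 : energy 0 <= cone ^+ 4 * (1 + M) * (sint (fun x => S x 0 ^+ 2) (- B) B +
    sint (fun x => Q x 0 ^+ 2) (- B) B).
  have k4 : 0 <= cone ^+ 4 by rewrite exprn_ge0 // ltW // cone_gt0.
  have := M0 => MM.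
  rewrite mulrDr; apply: lerD; rewrite -sintZ; try by apply/lint_lbm/lbmX.
  - apply: le_sint => //; [by apply: lint_lbm; auto|by apply/lintZ/lint_lbm/lbmX|].
    move=> x _; rewrite mul1r -expr2 ler_wpM2r ?sqr_ge0 //.
    by apply: le_trans (wt_le _ _ _ x) _ => //; rewrite ler_peMr //; lra.
  - apply: le_sint => //; [by apply: lint_lbm; auto|by apply/lintZ/lint_lbm/lbmX|].
    move=> x _; rewrite mulrA -expr2 ler_wpM2r ?sqr_ge0 //.
    rewrite mulrC; apply: ler_pM => //; first exact: wt_le.
    by apply: le_trans (rho_ub x) _; lra.
apply: le_trans s1 _; rewrite /energy_cst mulrAC -[X in _ <= X]mulrC ler_wpM2l ?invr_ge0 ?(ltW m0) //.
apply: le_trans s2 _; apply: le_trans (energy_noninc t0) _; exact: s3.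
Qed.

End Estimate.
End EnergyEstimate.
End Energy.

(** * Energy bounds for the time derivatives of a regular pair *)

Section Levels.
Variable R : realType.
Implicit Types (u x y t e d h l a b c B T N eta : R) (chi dm : R -> R).

Definition dquot h (f : R -> R) t := h^-1 * (f (t + h) + -1 * f t).

Lemma norm_le_double (p q b : R) : `|p - q| <= b -> `|q| <= b -> `|p| <= 2 * b.
Proof. by have := ler_normD (p - q) q; rewrite subrK; lra. Qed.

Lemma sq_le_near (p q b : R) : `|p - q| <= b -> q ^+ 2 <= 2 * p ^+ 2 + 2 * b ^+ 2.
Proof.
rewrite ler_norml => /andP[h1 h2].
have : 0 <= (b - (p - q)) * (b + (p - q)) by apply: mulr_ge0; lra.
by have := sqr_ge0 (2 * p - q); lra.
Qed.

Lemma sq_le_half (p q : R) : `|q - p| <= `|p| / 2 -> p ^+ 2 <= 4 * q ^+ 2.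
Proof.
move=> H; have : `|p| <= 2 * `|q|.
  by have := ler_normD (p - q) q; rewrite subrK distrC; lra.
rewrite -(real_normK (num_real p)) -(real_normK (num_real q)) => K.
have -> : 4 * `|q| ^+ 2 = (2 * `|q|) ^+ 2 by ring.
by rewrite ler_sqr ?nnegrE // mulr_ge0.
Qed.

(** The mean value theorem is used twice: on the first difference quotient, whose derivative is that
    of [f1], and then on [f1]. No continuity of [f2] is involved. *)
Lemma dquot2_MVT (f f1 f2 : R -> R) t h : 0 < h ->
  (forall t, is_derive t 1 f (f1 t)) -> (forall t, is_derive t 1 f1 (f2 t)) ->
  exists2 s, t < s < t + 2 * h & dquot h (dquot h f) t = f2 s.
Proof.
move=> h0 d1 d2.
have D (s : R) : is_derive s 1 (dquot h f) (dquot h f1 s).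
  apply: is_derive_eps => e e0.
  pose e' := e * h / 2; have e'0 : 0 < e' by rewrite !mulr_gt0 ?invr_gt0.
  have [r1 r10 H1] := is_derive_epsP (d1 (s + h)) e'0.
  have [r2 r20 H2] := is_derive_epsP (d1 s) e'0.
  exists (Num.min r1 r2) => [|k]; first by rewrite lt_min r10.
  rewrite lt_min => /andP[k1 k2]; have := H1 k k1; have := H2 k k2.
  have -> : dquot h f (s + k) - dquot h f s - k * dquot h f1 s = h^-1 *
    ((f (s + h + k) - f (s + h) - k * f1 (s + h)) - (f (s + k) - f s - k * f1 s)).
    by rewrite /dquot [s + k + h]addrAC; ring.
  set p := f (s + h + k) - _ - _; set q := f (s + k) - _ - _ => hq hp.
  rewrite normrM gtr0_norm ?invr_gt0 // mulrC ler_pdivrMr //.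
  apply: le_trans (ler_normB _ _) _; apply: le_trans (lerD hp hq) _; rewrite /e'; lra.
have th : t < t + h by lra.
have [s1 /andP[a1 b1] E1] := MVT_is_derive th D.
have sh : s1 < s1 + h by lra.
have [s2 /andP[a2 b2] E2] := MVT_is_derive sh d2.
exists s2; first by apply/andP; split; lra.
have hn : h != 0 by rewrite gt_eqF.
have -> : dquot h (dquot h f) t = h^-1 * (dquot h f (t + h) - dquot h f t).
  by rewrite {1}/dquot mulN1r.
rewrite E1 [t + h]addrC addrK mulrC mulfK // /dquot mulN1r E2 [s1 + h]addrC addrK.
by rewrite mulrC mulfK.
Qed.

Lemma Uder_dquot f f' h : Uder f f' ->
  Uder (fun x => dquot h (f x)) (fun x => dquot h (f' x)).
Proof. by move=> H; apply: UderZ; apply: UderD; [exact: Uder_shift|exact: UderZ]. Qed.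

Lemma Ucont_dquot f h : Ucont f -> Ucont (fun x => dquot h (f x)).
Proof. by move=> H; apply: UcontZ; apply: UcontD; [exact: Ucont_shift|exact: UcontZ]. Qed.

Lemma primZ c (F f : R -> R) : lint f -> prim F f -> prim (fun x => c * F x) (fun x => c * f x).
Proof. by move=> fi H x y; rewrite sintZ // -H mulrBr. Qed.

Lemma primD (F f G g : R -> R) : lint f -> lint g -> prim F f -> prim G g ->
  prim (fun x => F x + G x) (fun x => f x + g x).
Proof. by move=> fi gi H1 H2 x y; rewrite sintD // -H1 -H2; ring. Qed.

Lemma eq_prim (F f G g : R -> R) : F =1 G -> f =1 g -> prim F f -> prim G g.
Proof. by move=> /funext -> /funext ->. Qed.

Section FixRho.
Variables (rho : R -> R) (m M : R).
Hypotheses (m0 : 0 < m) (rho_lb : forall x, m <= rho x) (rho_ub : forall x, rho x <= M)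
  (rho_lbm : lbm rho).

(** The system is linear and [rho] does not depend on time. This gives access to the pair (S', Q'),
    which need not be regular itself. *)
Lemma regular_pair_dquot S Q S' Q' h : regular_pair rho S Q S' Q' ->
  regular_pair rho (fun x => dquot h (S x)) (fun x => dquot h (Q x))
    (fun x => dquot h (S' x)) (fun x => dquot h (Q' x)).
Proof.
move=> RP; have lS t : lbm (S'^~ t) by exact: Ucont_lbm (rp_cS RP).
have lQ t : lbm (Q'^~ t) by exact: Ucont_lbm (rp_cQ RP).
split.
- exact: Uder_dquot (rp_dS RP).
- exact: Uder_dquot (rp_dQ RP).
- exact: Ucont_dquot (rp_cS RP).
- exact: Ucont_dquot (rp_cQ RP).
- move=> t; apply: primZ; first by apply: lint_lbm; apply: lbmD => //; apply: lbmM => //; exact: lbm_cst.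
  apply: primD; [exact/lint_lbm|apply/lint_lbm/lbmM => //; exact: lbm_cst|exact: rp_pQ RP _|].
  by apply: primZ; [exact/lint_lbm|exact: rp_pQ RP _].
- move=> t; have L s : lint (fun x => Q' x s * rho x) by apply/lint_lbm/lbmM.
  apply: (@eq_prim (fun x => h^-1 * (S x (t + h) + -1 * S x t))
    (fun x => h^-1 * (Q' x (t + h) * rho x + -1 * (Q' x t * rho x)))) => // [x|].
    by rewrite /dquot; ring.
  apply: primZ; first by apply: lintD => //; exact: lintZ.
  apply: primD => //; [exact: lintZ|exact: rp_pS RP _|].
  by apply: primZ => //; exact: rp_pS RP _.
Qed.

(** Time reversal is a symmetry provided that Q changes sign; it extends the estimates to negative
    times. *)
Lemma regular_pair_rev S Q S' Q' : regular_pair rho S Q S' Q' ->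
  regular_pair rho (fun x t => S x (- t)) (fun x t => -1 * Q x (- t))
    (fun x t => -1 * S' x (- t)) (fun x t => Q' x (- t)).
Proof.
move=> RP; split.
- have -> : (fun x t => -1 * S' x (- t)) = (fun x t => - S' x (- t)).
    by apply/funext => x; apply/funext => t; rewrite mulN1r.
  exact: Uder_rev (rp_dS RP).
- have -> : (fun x t => Q' x (- t)) = (fun x t => -1 * - Q' x (- t)).
    by apply/funext => x; apply/funext => t; rewrite mulN1r opprK.
  apply: (@UderZ R (-1) (fun x t => Q x (- t)) (fun x t => - Q' x (- t))).
  exact: Uder_rev (rp_dQ RP).
- apply: (@UcontZ R (-1) (fun x t => S' x (- t))); exact: Ucont_rev (rp_cS RP).
- exact: Ucont_rev (rp_cQ RP).
- move=> t; apply: primZ; last exact: rp_pQ RP _.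
  exact/lint_lbm/Ucont_lbm/(rp_cS RP).
- by move=> t; exact: rp_pS RP _.
Qed.

Lemma sint_sq_le (f : R -> R) B b : 0 <= B -> lbm f -> (forall x, `|x| <= B -> `|f x| <= b) ->
  sint (fun x => f x ^+ 2) (- B) B <= 2 * B * b ^+ 2.
Proof.
move=> B0 fb H; have -> : 2 * B * b ^+ 2 = sint (fun=> b ^+ 2) (- B) B.
  by rewrite sint_cst; ring.
apply: le_sint; [exact/lint_lbm/lbmX|exact/lint_lbm/lbm_cst|lra|].
move=> x; rewrite -ler_norml => /H h; rewrite -(real_normK (num_real (f x))).
by rewrite lerXn2r // nnegrE //; apply: le_trans h.
Qed.

Notation C := (energy_cst m M).
Notation cone := (cone m).

(** The energy estimate is applied to difference quotients. Their initial values are at most 2 b,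
    which gives 32 C cone after the factor 2 from passing back to Q'; the additional 4 comes from
    that last replacement. *)
Lemma level_bound_pos S Q S' Q' eta b t : regular_pair rho S Q S' Q' ->
  0 < eta -> 0 < b -> (forall x, `|S' x 0| <= b) -> (forall x, `|Q' x 0| <= b) ->
  0 <= t -> t <= eta ->
  sint (fun x => Q' x t ^+ 2) (- eta) eta <= (32 * C * cone + 4) * eta * b ^+ 2.
Proof.
move=> RP eta0 b0 Sb Qb t0 te; pose B := cone * eta.
have cn0 := cone_gt0 m0; have C0 := energy_cst_gt0 m0 rho_lb rho_ub.
have B0 : 0 < B by exact: mulr_gt0.
have [d1 d10 H1] := rp_dS RP B 0 b0; have [d2 d20 H2] := rp_dQ RP B 0 b0.
have [d3 d30 H3] := rp_dQ RP eta t b0.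
(* One fixed step suffices, with no limit: the quotients are within b of S' and Q' on the base at
   time 0, and within b of Q' on [-eta, eta] at time t. *)
pose h := Num.min d1 (Num.min d2 d3) / 2.
have mn : 0 < Num.min d1 (Num.min d2 d3) by rewrite !lt_min d10 d20.
have h0 : 0 < h by rewrite divr_gt0.
have : h < Num.min d1 (Num.min d2 d3) by rewrite /h; lra.
rewrite !lt_min -{1 2 3}(gtr0_norm h0) => /and3P[h1 h2 h3].
have hn : h != 0 by rewrite gt_eqF.
have dq (f : R -> R) s l : `|f (s + h) - f s - h * l| <= b * `|h| -> `|dquot h f s - l| <= b.
  have -> : dquot h f s - l = h^-1 * (f (s + h) - f s - h * l) by rewrite /dquot; field.
  by rewrite (gtr0_norm h0) => H; rewrite normrM gtr0_norm ?invr_gt0 // mulrC ler_pdivrMr.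
have RPh := regular_pair_dquot h RP.
have := energy_bound m0 rho_lb rho_ub rho_lbm RPh eta0 t0 te; rewrite -/B => E.
have lS s : lbm (fun x => dquot h (S x) s) by exact: (rp_lbmS rho_lbm RPh).
have lQ s : lbm (fun x => dquot h (Q x) s) by exact: (rp_lbmQ RPh).
have e1 : sint (fun x => dquot h (S x) 0 ^+ 2) (- B) B <= 2 * B * (2 * b) ^+ 2.
  apply: sint_sq_le => //; first exact: ltW.
  move=> x xB; exact: norm_le_double (dq _ _ _ (H1 x h xB h1)) (Sb x).
have e2 : sint (fun x => dquot h (Q x) 0 ^+ 2) (- B) B <= 2 * B * (2 * b) ^+ 2.
  apply: sint_sq_le => //; first exact: ltW.
  move=> x xB; exact: norm_le_double (dq _ _ _ (H2 x h xB h2)) (Qb x).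
have e3 : sint (fun x => Q' x t ^+ 2) (- eta) eta <=
    2 * sint (fun x => dquot h (Q x) t ^+ 2) (- eta) eta + 4 * eta * b ^+ 2.
  have -> : 4 * eta * b ^+ 2 = sint (fun=> 2 * b ^+ 2) (- eta) eta by rewrite sint_cst; ring.
  have l1 : lint (fun x => dquot h (Q x) t ^+ 2) by apply/lint_lbm/lbmX.
  have l2 : lint (fun=> 2 * b ^+ 2) by exact/lint_lbm/lbm_cst.
  rewrite -sintZ // -sintD //; last exact: lintZ.
  apply: le_sint; [exact/lint_lbm/lbmX/(rp_lbmQ' RP)|by apply: lintD => //; exact: lintZ|by rewrite ge0_cp // ltW|].
  by move=> x; rewrite -ler_norml => /H3/(_ h3)/dq; exact: sq_le_near.
apply: le_trans e3 _.
have : C * (sint (fun x => dquot h (S x) 0 ^+ 2) (- B) B +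
    sint (fun x => dquot h (Q x) 0 ^+ 2) (- B) B) <= C * (16 * B * b ^+ 2).
  by rewrite ler_wpM2l ?(ltW C0) //; lra.
rewrite /B; move: E; lra.
Qed.

Lemma level_bound S Q S' Q' eta b t : regular_pair rho S Q S' Q' ->
  0 < eta -> 0 < b -> (forall x, `|S' x 0| <= b) -> (forall x, `|Q' x 0| <= b) ->
  `|t| <= eta ->
  sint (fun x => Q' x t ^+ 2) (- eta) eta <= (32 * C * cone + 4) * eta * b ^+ 2.
Proof.
move=> RP eta0 b0 Sb Qb te; have [t0|/ltW t0] := leP 0 t.
  by apply: (level_bound_pos RP) => //; rewrite -(ger0_norm t0).
have := @level_bound_pos _ _ _ _ eta b (- t) (regular_pair_rev RP) eta0 b0.
rewrite opprK; apply; rewrite ?oppr_ge0 //; last by rewrite -(ler0_norm t0).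
  by move=> x; rewrite mulN1r oppr0 normrN.
by move=> x; rewrite oppr0.
Qed.

(* At the lowest level the potential has no pointwise time derivative; only its
   pairings with bounded functions do. *)
Definition weak_flux (Q : R -> R -> R) (G : (R -> R) -> R -> R -> R -> R) :=
  (forall chi a b, lbm chi -> a <= b -> exists dm : R -> R,
    [/\ forall t, is_derive t 1 (fun t => sint (fun x => chi x * Q x t) a b) (dm t),
        forall t, is_derive t 1 dm (G chi a b t) & dm 0 = 0]) /\
  (forall T a b, a <= b -> exists2 N, 0 <= N & forall chi t, lbm chi -> `|t| <= T ->
    G chi a b t ^+ 2 <= N * sint (fun x => chi x ^+ 2) a b).

(** Second difference quotients of (S, Q) stand in for two time derivatives. At time t, pairing them
    with [chi] gives [dm] at a nearby time; at time 0 the S part is controlled by [v] and the Q part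
    by its own pairing. *)
Lemma level0_bound_pos S Q S' Q' v G eta b t chi dm : regular_pair rho S Q S' Q' ->
  Uder S' v -> Ucont v -> weak_flux Q' G ->
  0 < eta -> 0 < b -> (forall x, `|v x 0| <= b) -> lbm chi ->
  (forall t, is_derive t 1 (fun t => sint (fun x => chi x * Q' x t) (- eta) eta) (dm t)) ->
  (forall t, is_derive t 1 dm (G chi (- eta) eta t)) ->
  0 <= t -> t <= eta ->
  dm t ^+ 2 <= 40 * C * cone * eta * b ^+ 2 * sint (fun x => chi x ^+ 2) (- eta) eta.
Proof.
move=> RP Sv vc [G1 G2] eta0 b0 vb cb dm1 dm2 t0 te; pose B := cone * eta.
have cn0 := cone_gt0 m0; have C0 := energy_cst_gt0 m0 rho_lb rho_ub.
have B0 : 0 < B by exact: mulr_gt0.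
have BB : - B <= B by rewrite ge0_cp // ltW.
have ee : - eta <= eta by rewrite ge0_cp // ltW.
have X0 : 0 <= sint (fun x => chi x ^+ 2) (- eta) eta.
  by apply: sint_ge0 => // x _; exact: sqr_ge0.
(* The zero value is set aside because the continuity tolerance below is [|dm t| / 2]. *)
have [E0|En] := eqVneq (dm t) 0.
  rewrite E0 expr0n /=; apply: mulr_ge0 => //; apply: mulr_ge0; last exact: sqr_ge0.
  have [? ? ?] := And3 (ltW C0) (ltW cn0) (ltW eta0).
  by do ?[apply: mulr_ge0 => //]; exact: ler0n.
have dc : {for t, continuous dm} by exact: is_derive_cont (dm2 t).
have En2 : 0 < `|dm t| / 2 by rewrite divr_gt0 // normr_gt0.
have [d1 d10 H1] := (cont_epsP dm t).1 dc _ En2.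
have [d2 d20 H2] := vc.2 B 0 b b0.
have [N N0 HN] := G2 1 (- B) B BB.
(* Chosen so that N d3 <= 2 B b^2, the size allowed for the squared norm of the second quotient of Q
   at time 0. *)
pose d3 := b ^+ 2 * (2 * B) / (N + 1).
have d30 : 0 < d3 by rewrite divr_gt0 // ?mulr_gt0 // ?exprn_gt0 //; lra.
pose dd := Num.min (Num.min d1 d2) (Num.min d3 1).
have dd0 : 0 < dd by rewrite /dd !lt_min d10 d20 d30 ltr01.
pose h := dd / 2.
have h0 : 0 < h by rewrite divr_gt0.
have h2E : 2 * h = dd by rewrite /h; lra.
have [h2d1 h2d2 h2d3 h2d4] : [/\ 2 * h <= d1, 2 * h <= d2, 2 * h <= d3 & 2 * h <= 1].
  by rewrite h2E /dd !ge_min !lexx !orbT.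
have RPh := regular_pair_dquot h (regular_pair_dquot h RP).
have := energy_bound m0 rho_lb rho_ub rho_lbm RPh eta0 t0 te; rewrite -/B => E.
have lS s : lbm (fun x => dquot h (dquot h (S x)) s) by exact: (rp_lbmS rho_lbm RPh).
have lQ s : lbm (fun x => dquot h (dquot h (Q x)) s) by exact: (rp_lbmQ RPh).
have e1 : sint (fun x => dquot h (dquot h (S x)) 0 ^+ 2) (- B) B <= 2 * B * (2 * b) ^+ 2.
  apply: sint_sq_le => //; first exact: ltW.
  move=> x xB; have [s] := @dquot2_MVT (S x) (S' x) (v x) 0 h h0
     (fun t => Uder_is_derive x t (rp_dS RP)) (fun t => Uder_is_derive x t Sv).
  rewrite !add0r => /andP[s0 s1] ->.
  have : `|s| < d2 by rewrite gtr0_norm //; exact: lt_le_trans h2d2.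
  by move=> /(H2 x s xB); rewrite add0r => /norm_le_double; apply.
have lc (c : R -> R) : lbm c -> forall s : R, is_derive s 1 (fun t => sint (fun x => c x * Q x t) (- B) B)
    (sint (fun x => c x * Q' x s) (- B) B).
  move=> cl s; apply: (sint_Uder (- B) B s cl _ _ (rp_dQ RP)).
    exact: (rp_lbmQ RP).
  exact: (rp_lbmQ' RP).
have lce (c : R -> R) : lbm c -> forall s : R, is_derive s 1 (fun t => sint (fun x => c x * Q x t) (- eta) eta)
    (sint (fun x => c x * Q' x s) (- eta) eta).
  move=> cl s; apply: (sint_Uder (- eta) eta s cl _ _ (rp_dQ RP)).
    exact: (rp_lbmQ RP).
  exact: (rp_lbmQ' RP).
have dq2 (c : R -> R) (a a' s : R) : lbm c -> sint (fun x => c x * dquot h (dquot h (Q x)) s) a a' =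
    dquot h (dquot h (fun t => sint (fun x => c x * Q x t) a a')) s.
  move=> cl; have L r : lint (fun x => c x * Q x r) by apply/lint_lbm/lbmM => //; exact: (rp_lbmQ RP).
  have Z k r : lint (fun x => k * (c x * Q x r)) by exact: lintZ.
  rewrite /dquot -!sintZ // -!sintD // -!sintZ; try by repeat first [apply: lintD => //|apply: lintZ].
  rewrite -!sintD // -?sintZ; try by repeat first [apply: lintD => //|apply: lintZ].
  by apply: eq_sint => x _; ring.
(* The quotient serves as its own test function: its squared norm X is the first derivative [dr] of
   the pairing at some small s. As [dr] vanishes at 0, X is s times a value of G, so X^2 <= N X s^2,
   and X is small with s. *)
pose r x := dquot h (dquot h (Q x)) 0.
have e2 : sint (fun x => r x ^+ 2) (- B) B <= 2 * B * b ^+ 2.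
  have rl : lbm r by exact: lQ.
  have [dr [dr1 dr2 dr0]] := G1 r (- B) B rl BB.
  have [s /andP[s0 s1] Es] := @dquot2_MVT _ _ dr 0 h h0 (lc r rl) dr1.
  rewrite add0r in s1.
  have s10 : s < 1 by exact: lt_le_trans h2d4.
  have sd3 : s < d3 by exact: lt_le_trans h2d3.
  have [s' /andP[s'0 s's]] := MVT_is_derive s0 dr2.
  rewrite dr0 !subr0 => Es'.
  have X : sint (fun x => r x ^+ 2) (- B) B = dr s.
    by rewrite -Es -dq2 //; apply: eq_sint => x _; rewrite expr2.
  have X0' : 0 <= sint (fun x => r x ^+ 2) (- B) B.
    by apply: sint_ge0 => // x _; exact: sqr_ge0.
  have s'1 : `|s'| <= 1 by rewrite gtr0_norm // ltW // (lt_trans s's).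
  move: (HN r s' rl s'1) X0' X; set X := sint _ _ _ => GX X0' EX.
  have X2 : X ^+ 2 <= X * d3 * (N + 1).
    have -> : X ^+ 2 = G r (- B) B s' ^+ 2 * s ^+ 2 by rewrite EX Es' exprMn.
    apply: le_trans (_ : N * X * s ^+ 2 <= _); first by rewrite ler_wpM2r // sqr_ge0.
    have : s ^+ 2 <= d3.
      by apply: le_trans (ltW sd3); rewrite expr2 ler_piMl // ltW.
    have NX : 0 <= N * X by rewrite mulr_ge0.
    move=> s2; apply: le_trans (ler_wpM2l NX s2) _.
    have -> : X * d3 * (N + 1) = N * X * d3 + X * d3 by ring.
    by rewrite lerDl mulr_ge0 // ltW.
  have E3 : d3 * (N + 1) = b ^+ 2 * (2 * B) by rewrite /d3 divfK // gt_eqF // ltr_wpDl.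
  have [->|Xn] := eqVneq X 0; first by rewrite !mulr_ge0 // ?sqr_ge0 // ltW.
  have Xp : 0 < X by rewrite lt_def Xn.
  by rewrite -(ler_pM2l Xp) -expr2; apply: le_trans X2 _;
    rewrite -mulrA E3 [b ^+ 2 * _]mulrC.
have [s /andP[s0 s1] Es] := @dquot2_MVT _ _ dm t h h0 (lce chi cb) dm1.
have st : `|s - t| < d1.
  by rewrite gtr0_norm ?subr_gt0 //; apply: lt_le_trans h2d1; rewrite ltrBlDl.
have := H1 s st => dst.
have dmts : dm t ^+ 2 <= 4 * dm s ^+ 2 by exact: sq_le_half.
have CS : dm s ^+ 2 <= sint (fun x => chi x ^+ 2) (- eta) eta *
    sint (fun x => dquot h (dquot h (Q x)) t ^+ 2) (- eta) eta.
  by rewrite -Es -dq2 //; apply: L2l_CS => //; exact: L2l_lbm.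
apply: le_trans dmts _.
have E4 : sint (fun x => dquot h (dquot h (Q x)) t ^+ 2) (- eta) eta <= C * (10 * B * b ^+ 2).
  apply: le_trans E _; rewrite ler_wpM2l ?(ltW C0) //.
  have : 0 <= B * b ^+ 2 by rewrite mulr_ge0 ?sqr_ge0 // ltW.
  move: e1 e2; rewrite /r; lra.
have := ler_wpM2l X0 E4; rewrite /B; lra.
Qed.

Lemma is_derive_rev (f df : R -> R) t : (forall t, is_derive t 1 f (df t)) ->
  is_derive t 1 (fun t => f (- t)) (- df (- t)).
Proof.
move=> H; apply: is_derive_eps => e e0; have [d d0 Hd] := is_derive_epsP (H (- t)) e0.
exists d => // h hd; have := Hd (- h); rewrite normrN => /(_ hd).
by rewrite opprD mulrN mulNr.
Qed.

Lemma level0_bound S Q S' Q' v G eta b t chi dm : regular_pair rho S Q S' Q' ->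
  Uder S' v -> Ucont v -> weak_flux Q' G ->
  0 < eta -> 0 < b -> (forall x, `|v x 0| <= b) -> lbm chi ->
  (forall t, is_derive t 1 (fun t => sint (fun x => chi x * Q' x t) (- eta) eta) (dm t)) ->
  (forall t, is_derive t 1 dm (G chi (- eta) eta t)) ->
  `|t| <= eta ->
  dm t ^+ 2 <= 40 * C * cone * eta * b ^+ 2 * sint (fun x => chi x ^+ 2) (- eta) eta.
Proof.
move=> RP Sv vc WF eta0 b0 vb cb dm1 dm2 te; have [t0|/ltW t0] := leP 0 t.
  by apply: (level0_bound_pos RP Sv vc WF) => //; rewrite -(ger0_norm t0).
have RPr := regular_pair_rev RP.
have Sv' : Uder (fun x t => -1 * S' x (- t)) (fun x t => v x (- t)).
  have -> : (fun x t => v x (- t)) = (fun x t => -1 * - v x (- t)).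
    by apply/funext => x; apply/funext => s; rewrite mulN1r opprK.
  by apply: (@UderZ R (-1) (fun x t => S' x (- t)) (fun x t => - v x (- t))); exact: Uder_rev.
have WF' : weak_flux (fun x t => Q' x (- t)) (fun chi a b t => G chi a b (- t)).
  case: WF => [W1 W2]; split.
    move=> c a a' cl aa'; have [d [d1 d2 d3]] := W1 c a a' cl aa'.
    exists (fun t => - d (- t)); split; last by rewrite oppr0 d3 oppr0.
      by move=> s; exact: (is_derive_rev s d1).
    move=> s; have := is_derive_rev s d2 => H; have := is_deriveN H.
    by rewrite opprK.
  move=> T a a' aa'; have [N N0 HN] := W2 T a a' aa'; exists N => // c s cl sT.
  by apply: HN => //; rewrite normrN.
have := @level0_bound_pos _ _ _ _ _ _ eta b (- t) chi (fun t => - dm (- t)) RPr Sv'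
  (Ucont_rev vc) WF' eta0 b0.
rewrite opprK sqrrN; apply => //.
- by move=> x; rewrite oppr0.
- by move=> s; exact: (is_derive_rev s dm1).
- move=> s; have := is_derive_rev s dm2 => H; have := is_deriveN H.
  by rewrite opprK.
- by rewrite oppr_ge0.
- by rewrite -(ler0_norm t0).
Qed.

End FixRho.
End Levels.

(** * Weak solutions of the micro-problem *)

Section WeakTools.
Variable R : realType.
Implicit Types (u x y t s e d h l a b c B T N eta r : R) (f chi dm phi : R -> R).
Notation mu := (@lebesgue_measure R).

Lemma Rintegral_support f a b : (forall x, ~~ (a <= x <= b) -> f x = 0) -> a <= b ->
  \int[mu]_x f x = sint f a b.
Proof.
move=> H ab; rewrite sint_le // [RHS]Rintegral_mkcond; congr (Rintegral _ _ _).
apply/funext => x; rewrite /patch.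
case: ifPn => // xab.
by apply: H; apply: contra xab => xab; rewrite inE /= in_itv.
Qed.

Lemma sint_support f a b a' b' : lint f -> (forall x, ~~ (a <= x <= b) -> f x = 0) ->
  a' <= a -> a <= b -> b <= b' -> sint f a' b' = sint f a b.
Proof.
move=> fi H aa ab bb; rewrite -(Rintegral_support H ab) -(@Rintegral_support f a' b') //.
  by move=> x xab; apply: H; apply: contra xab => /andP[? ?]; apply/andP; split; lra.
lra.
Qed.

Lemma C1c_intro phi dphi B : (forall x, is_derive x 1 phi (dphi x)) -> continuous dphi ->
  (forall x, ~~ (- B <= x <= B) -> phi x = 0) -> C1c phi /\ phi^`() = dphi.
Proof.
move=> d1 c1 H; have E : phi^`() = dphi.
  by apply/funext => x; rewrite derive1E; have [_ ->] := d1 x.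
split => //; split; [by move=> x; have [] := d1 x|by rewrite E|].
apply: (@subclosed_compact _ _ `[- B, B]).
- exact: closed_closure.
- exact: segment_compact.
- have /closure_id -> : closed (`[- B, B] : set R) by exact: itv_closed.
  apply: closureS => x /= xn.
  by rewrite in_itv /=; apply: contraNT xn => /H ->.
Qed.

Lemma sint_L2 f x y B : L2l f -> `|x| <= B -> `|y| <= B ->
  sint f x y ^+ 2 <= `|y - x| * sint (fun s => f s ^+ 2) (- B) B.
Proof.
move=> fl; suff W u v : u <= v -> `|u| <= B -> `|v| <= B ->
    sint f u v ^+ 2 <= `|v - u| * sint (fun s => f s ^+ 2) (- B) B.
  by move=> xB yB; have [/W|/ltW/W H] := leP x y; [apply|rewrite sint_rev sqrrN distrC; apply: H].
move=> uv; rewrite (ler_norml u) (ler_norml v) => /andP[u1 u2] /andP[v1 v2].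
have E : sint f u v = sint (fun s => 1 * f s) u v by apply: eq_sint => s _; rewrite mul1r.
rewrite E; apply: le_trans (L2l_CS uv (L2l_lbm (lbm_cst 1)) fl) _.
have -> : sint (fun=> 1 ^+ 2) u v = v - u by rewrite sint_cst expr1n mul1r.
rewrite ger0_norm ?subr_ge0 // ler_wpM2l ?subr_ge0 //.
apply: sint_sub => //; first exact: fl.2.
by move=> s; exact: sqr_ge0.
Qed.

(* Continuous maps from time into L2_loc. *)
Definition L2c (g : R -> R -> R) := (forall t, L2l (g^~ t)) /\
  forall r t0 e, 0 < r -> 0 < e -> exists2 d, 0 < d & forall t, `|t - t0| < d ->
    sint (fun x => (g x t - g x t0) ^+ 2) (- r) r <= e.

Lemma L2c_mul chi (g : R -> R -> R) : lbm chi -> L2c g -> L2c (fun x t => chi x * g x t).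
Proof.
move=> cb [gl gc]; split => [t|r t0 e r0 e0]; first exact: L2lM.
have [_ /(_ r)[M HM]] := cb; have M0 : 0 < M ^+ 2 + 1 by have := sqr_ge0 M; lra.
have [d d0 Hd] := gc r t0 _ r0 (divr_gt0 e0 M0); exists d => // t /Hd.
rewrite ler_pdivlMr // mulrC; apply: le_trans.
have i1 s1 s2 : lint (fun x => (g x s1 - g x s2) ^+ 2) by exact: (L2lB (gl _) (gl _)).2.
rewrite -sintZ //; apply: le_sint; [|exact: lintZ|lra|].
  by have := (L2lM cb (L2lB (gl t) (gl t0))).2; apply: eq_lint => x; rewrite mulrBr.
move=> x; rewrite -ler_norml => /HM hx; rewrite -mulrBr exprMn ler_wpM2r ?sqr_ge0 //.
rewrite -(real_normK (num_real (chi x))); have := normr_ge0 (chi x); nra.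
Qed.

Lemma L2c_sint_cont (g : R -> R -> R) a b : L2c g -> continuous (fun t => sint (g^~ t) a b).
Proof.
move=> [gl gc] t0; apply/cont_epsP => e e0; pose r := `|a| + `|b| + 1.
have a0 := normr_ge0 a; have b0 := normr_ge0 b.
have r0 : 0 < r by rewrite /r; lra.
pose L := `|b - a| + 1; have L0 : 0 < L by have := normr_ge0 (b - a); rewrite /L; lra.
have e2 : 0 < e ^+ 2 / L by rewrite divr_gt0 // exprn_gt0.
have [d d0 Hd] := gc r t0 _ r0 e2; exists d => // t /Hd H.
rewrite -sintB; [|exact: L2l_lint|exact: L2l_lint].
have := sint_L2 (L2lB (gl t) (gl t0)) (_ : `|a| <= r) (_ : `|b| <= r).
rewrite /r => /(_ _ _)/(le_trans)X.
have : sint (fun x => g x t - g x t0) a b ^+ 2 <= e ^+ 2.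
  apply: X; [lra|lra|]; apply: (@le_trans _ _ (L * (e ^+ 2 / L))).
    apply: ler_pM => //; [by apply: sint_ge0 => [|s _]; [lra|exact: sqr_ge0]|rewrite /L; lra].
  by rewrite mulrC divfK // gt_eqF.
by rewrite -(real_normK (num_real (sint _ _ _))) ler_sqr // nnegrE ltW.
Qed.

Lemma L2c_norm_cont (g : R -> R -> R) r : 0 < r -> L2c g ->
  continuous (fun t => sint (fun x => g x t ^+ 2) (- r) r).
Proof.
move=> r0 [gl gc] t0; apply/cont_epsP => e e0; have rr : - r <= r by lra.
pose n := sint (fun x => g x t0 ^+ 2) (- r) r.
have n0 : 0 <= n by apply: sint_ge0 => // x _; exact: sqr_ge0.
pose k := Num.min 1 (e / (2 * (n + 1))).
have k0 : 0 < k by rewrite lt_min ltr01 divr_gt0 // mulr_gt0 //; lra.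
have k1 : k <= 1 by rewrite ge_min lexx.
have k2 : k * (2 * (n + 1)) <= e.
  by rewrite -ler_pdivlMr ?mulr_gt0 //; [rewrite ge_min lexx orbT|lra].
pose e' := Num.min (e / 4) (k * (e / 4)).
have e'0 : 0 < e' by rewrite lt_min !mulr_gt0 // ?invr_gt0.
have e'1 : e' <= e / 4 by rewrite ge_min lexx.
have e'2 : e' <= k * (e / 4) by rewrite ge_min lexx orbT.
have [d d0 Hd] := gc r t0 _ r0 e'0; exists d => // t /Hd H.
set z := fun x => g x t - g x t0; have zl : L2l z by exact: L2lB.
have E : sint (fun x => g x t ^+ 2) (- r) r - n =
    sint (fun x => z x ^+ 2) (- r) r + 2 * sint (fun x => z x * g x t0) (- r) r.
  rewrite /n -sintB; [|exact: (gl _).2|exact: (gl _).2].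
  rewrite -sintZ; last exact: L2l_mul.
  rewrite -sintD; [|exact: zl.2|by apply: lintZ; exact: L2l_mul].
  by apply: eq_sint => x _; rewrite /z; ring.
rewrite E; set Z := sint (fun x => z x ^+ 2) _ _; set X := sint (fun x => z x * _) _ _.
have Z0 : 0 <= Z by apply: sint_ge0 => // x _; exact: sqr_ge0.
have HZ : Z <= e' by exact: H.
have CS : X ^+ 2 <= Z * n by exact: L2l_CS.
(* 2|X| <= k n + Z/k *)
have X2 : 2 * `|X| <= k * n + Z / k.
  have e1 : Z = Z / k * k by rewrite divfK // gt_eqF.
  have q0 : 0 <= Z / k by rewrite divr_ge0 // ltW.
  rewrite -(real_normK (num_real X)) in CS.
  have : (2 * `|X|) ^+ 2 <= (k * n + Z / k) ^+ 2.
    have := sqr_ge0 (k * n - Z / k) => h1; rewrite e1 in CS; nra.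
  by rewrite ler_sqr // nnegrE ?mulr_ge0 // addr_ge0 // mulr_ge0 // ltW.
have Zk : Z / k <= e / 4.
  by rewrite ler_pdivrMr // mulrC; apply: le_trans HZ _; rewrite ge_min lexx orbT.
apply: le_trans (ler_normD _ _) _; rewrite (ger0_norm Z0) normrM (ger0_norm (ler0n _ 2)).
have : k * n <= e / 2 by nra.
lra.
Qed.

Lemma cont_bounded f T : continuous f -> exists2 M, 0 <= M & forall t, `|t| <= T -> `|f t| <= M.
Proof.
move=> cf; have [_ /(_ T)[M HM]] := lbm_continuous cf; exists `|M| => // t /HM.
by move=> /le_trans; apply; exact: ler_norm.
Qed.

Lemma L2c_bounded (g : R -> R -> R) r T : L2c g -> exists2 M, 0 <= M & forall t, `|t| <= T ->
  sint (fun x => g x t ^+ 2) (- r) r <= M.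
Proof.
move=> gc; have [r0|r0] := ltP 0 r.
  have [M M0 HM] := cont_bounded T (L2c_norm_cont r0 gc); exists M => // t /HM.
  by apply: le_trans; exact: ler_norm.
exists 0 => // t _; rewrite sint_rev oppr_le0; apply: sint_ge0; first lra.
by move=> x _; exact: sqr_ge0.
Qed.

Definition dint f t := sint (sint f 0) 0 t.

Lemma sint_cont f : continuous f -> continuous (sint f 0).
Proof.
move=> cf t; apply: is_derive_cont (sint_is_derive 0 _ _); last exact: cf.
exact/lint_lbm/lbm_continuous.
Qed.

Lemma dint_is_derive f t : continuous f -> is_derive t 1 (dint f) (sint f 0 t).
Proof.
move=> cf; apply: sint_is_derive; last exact: sint_cont.
exact/lint_lbm/lbm_continuous/sint_cont.
Qed.

Lemma sint0_is_derive f t : continuous f -> is_derive t 1 (sint f 0) (f t).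
Proof. by move=> cf; apply: sint_is_derive; [exact/lint_lbm/lbm_continuous|exact: cf]. Qed.

Lemma dint_bound f t k : continuous f -> (forall s, `|s| <= `|t| -> `|f s| <= k) ->
  `|dint f t| <= k * t ^+ 2.
Proof.
move=> cf H; have k0 : 0 <= k by apply: le_trans (normr_ge0 _) (H 0 _); rewrite normr0.
have between s s' : Num.min 0 s' <= s <= Num.max 0 s' -> `|s| <= `|s'|.
  case: (leP 0 s') => h /andP[h1 h2]; first by rewrite !ger0_norm; lra.
  by rewrite (ltr0_norm h) ler0_norm; lra.
rewrite -(real_normK (num_real t)) expr2 mulrA -{3}(subr0 t); apply: sint_bound.
  exact/lint_lbm/lbm_continuous/sint_cont.
move=> s /between st; apply: (@le_trans _ _ (k * `|s - 0|)); last first.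
  by rewrite subr0 ler_wpM2l.
apply: sint_bound; first exact/lint_lbm/lbm_continuous.
by move=> s' /between ss; apply: H; exact: le_trans st.
Qed.

Lemma eq_deriv (f g df : R -> R) : (forall t, is_derive t 1 f (df t)) ->
  (forall t, is_derive t 1 g (df t)) -> f 0 = g 0 -> f =1 g.
Proof.
move=> H1 H2 E t; have D s : is_derive s 1 (fun t => f t - g t) 0.
  by have := is_deriveB (H1 s) (H2 s); rewrite subrr; exact.
by apply/eqP; rewrite -subr_eq0 (is_derive_0_is_cst t 0 D) E subrr.
Qed.

(** The quotient is the average of [f] over [x, x + h]. Along the steps 1 / (n + 1) it converges to
    [f] almost everywhere by Lebesgue differentiation, and in L2 by domination. *)
Lemma mollify f B B' e : 0 <= B -> lbm f -> (forall x, ~~ (- B <= x <= B) -> f x = 0) ->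
  0 < e -> exists h, [/\ 0 < h, h <= 1, h <= e &
    sint (fun x => (h^-1 * (sint f (- B) (x + h) - sint f (- B) x) - f x) ^+ 2) (- B') B' <= e].
Proof.
move=> B0 fb f0 e0; have fi := lint_lbm fb.
have [_ /(_ B)[M HM]] := fb.
have fM x : `|f x| <= `|M|.
  have [xB|xB] := boolP (- B <= x <= B); last by rewrite f0 // normr0.
  by apply: le_trans (ler_norm M); apply: HM; rewrite ler_norml.
have [B'0|B'0] := leP B' 0.
  exists (Num.min 1 e); split; rewrite ?lt_min ?ltr01 // ?ge_min ?lexx ?orbT //.
  rewrite sint_rev lerNl; apply: (@le_trans _ _ 0); first lra.
  by apply: sint_ge0 => [|x _]; [lra|exact: sqr_ge0].
pose hn (n : nat) : R := n.+1%:R^-1.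
have hn0 n : 0 < hn n by rewrite invr_gt0.
have hn1 n : hn n <= 1 by rewrite invf_le1 // ler1n.
have hn_small d : 0 < d -> exists k : nat, forall n, (k <= n)%N -> hn n < d.
  move=> d0; exists (Num.truncn d^-1) => n kn.
  rewrite invf_plt ?posrE //; apply: lt_le_trans (truncnS_gt _) _.
  by rewrite ler_nat ltnS.
pose q n x := (hn n)^-1 * (sint f (- B) (x + hn n) - sint f (- B) x) - f x.
have pf : prim (sint f (- B)) f.
  by move=> x y; rewrite -(@sint_chasles _ f (- B) x y) //; ring.
have qE n x : q n x = (hn n)^-1 * sint f x (x + hn n) - f x.
  by rewrite /q pf.
have pl : lbm (sint f (- B)) by exact: prim_lbm pf fb.
have pc : continuous (sint f (- B)) by exact: prim_cont pf fb.
have ql n : lbm (q n).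
  apply: lbmB => //; apply: lbmM; first exact: lbm_cst.
  apply: lbmB => //; apply: lbm_continuous => x.
  apply: (@continuous_comp _ _ _ (fun x => x + hn n) (sint f (- B))); last exact: pc.
  by apply: cvgD; [exact: cvg_id|exact: cvg_cst].
have qM n x : `|q n x| <= 2 * `|M|.
  rewrite qE; apply: le_trans (ler_normB _ _) _.
  suff : `|(hn n)^-1 * sint f x (x + hn n)| <= `|M| by have := fM x; lra.
  rewrite normrM gtr0_norm ?invr_gt0 // mulrC ler_pdivrMr //.
  have := @sint_bound _ f x (x + hn n) `|M| fi (fun s _ => fM s).
  by rewrite addrAC subrr add0r (gtr0_norm (hn0 n)).
(* A base point to the left of [-B', B'], so that the primitive started there is differentiable at
   almost every point of that interval. *)
pose c : R := - (B + B') - 1.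
have fAE : f = f \_ `[- B, B].
  apply/funext => x; rewrite /patch; case: ifPn => // xab.
  by apply: f0; apply: contra xab => xab; rewrite inE /= in_itv.
have floc : locally_integrable setT f.
  by rewrite fAE; apply: integrable_locally => //; exact: fi.
have ae := @FTC1 R f (BLeft c) (fun y => fi c y) floc.
have qcv : {ae mu, forall x, `[- B', B'] x -> (fun n => ((q n x) ^+ 2)%:E) @ \oo --> (cst 0%E : R -> \bar R) x}.
  move: ae; apply: filterS; first exact: (ae_filter_ringOfSetsType mu).
  move=> x Hx /=; rewrite in_itv /= => /andP[x1 x2].
  have cx : c < x by rewrite /c; lra.
  have [|dF dE] := Hx; first by rewrite /= lte_fin.
  have := is_derive_epsP (DeriveDef dF (esym (derive1E _ _))); rewrite dE => D.
  apply: cvg_EFin; first by exact: nearW.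
  apply/cvgrPdist_le => k k0 /=; have sk : 0 < Num.min 1 k by rewrite lt_min ltr01.
  have [d d0 Hd] := D _ sk; have [n0 Hn0] := hn_small d d0.
  exists n0 => // n /= /Hn0 hd; have := Hd (hn n); rewrite (gtr0_norm (hn0 n)) => /(_ hd).
  have cxh : c <= x + hn n by rewrite (le_trans (ltW cx)) // lerDl ltW.
  rewrite -!sint_le ?(ltW cx) //.
  rewrite -(@sint_chasles _ f c x (x + hn n)) // [sint f c x + _ - _]addrAC subrr add0r => h1.
  have : `|q n x| <= Num.min 1 k.
    have -> : q n x = (hn n)^-1 * (sint f x (x + hn n) - hn n * f x).
      by rewrite qE; field; rewrite gt_eqF.
    by rewrite normrM gtr0_norm ?invr_gt0 // mulrC ler_pdivrMr.
  rewrite le_min => /andP[q1 qk]; rewrite sub0r normrN normrX.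
  by have := normr_ge0 (q n x); nra.
have q2i n : mu.-integrable `[- B', B'] (EFin \o (fun x => q n x ^+ 2)).
  by apply: lint_lbm; exact: lbmX.
have mq n : measurable_fun `[- B', B'] (fun x => (q n x ^+ 2)%:E).
  by have /integrableP[] := q2i n.
have bi : mu.-integrable `[- B', B'] (cst ((2 * `|M|) ^+ 2)%:E).
  by apply: lint_lbm; exact: lbm_cst.
have bq : {ae mu, forall x, forall n, `[- B', B'] x ->
    (`|(q n x ^+ 2)%:E| <= cst ((2 * `|M|) ^+ 2)%:E x)%E}.
  apply: aeW => x n _ /=; rewrite lee_fin ger0_norm ?sqr_ge0 //.
  by rewrite -(real_normK (num_real (q n x))) lerXn2r // nnegrE ?mulr_ge0.
have mD : measurable (`[- B', B'] : set (measurableTypeR R)) by exact: measurable_itv.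
have mc : measurable_fun `[- B', B'] (cst 0%E : R -> \bar R) by exact: measurable_cst.
have [_ _ cv] := @dominated_convergence _ _ R mu `[- B', B'] mD
  (fun n x => (q n x ^+ 2)%:E) (cst 0%E) (cst ((2 * `|M|) ^+ 2)%:E) mq mc qcv bi bq.
move: cv; rewrite integral0 => /fine_cvg /cvgrPdist_le /(_ e e0)[k0 _ Hk0].
have [k1 Hk1] := hn_small e e0; pose k := maxn k0 k1.
exists (hn k); split => //; first by apply/ltW/Hk1; rewrite leq_maxr.
have := Hk0 k; rewrite /= leq_maxl => /(_ isT); rewrite sub0r normrN.
rewrite sint_le; last lra.
by apply: le_trans; exact: ler_norm.
Qed.

End WeakTools.

(** * The deviation from the steady state and its potential *)

Section WeakSolution.
Variable R : realType.
Implicit Types (u x y t s e d h l a b c B T N eta r : R) (f chi dm phi : R -> R).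
Notation mu := (@lebesgue_measure R).

Lemma prim_L2_cont (F f : R -> R) : prim F f -> L2l f -> continuous F.
Proof.
move=> pF fl x; apply/cont_epsP => e e0.
pose B := `|x| + 1; pose N := sint (fun s => f s ^+ 2) (- B) B.
have N0 : 0 <= N by apply: sint_ge0 => [|s _]; [rewrite /B; have := normr_ge0 x; lra|exact: sqr_ge0].
exists (Num.min 1 (e ^+ 2 / (N + 1))); first by rewrite lt_min ltr01 divr_gt0 ?exprn_gt0 //; lra.
move=> y; rewrite lt_min => /andP[y1 y2].
have yB : `|y| <= B by rewrite -(subrK x y); apply: le_trans (ler_normD _ _) _; rewrite /B; lra.
have xB : `|x| <= B by rewrite /B; lra.
rewrite pF; have := sint_L2 fl xB yB; rewrite -/N => h.
have : sint f x y ^+ 2 <= e ^+ 2.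
  apply: le_trans h _; move: y2; rewrite ltr_pdivlMr; last lra.
  have := normr_ge0 (y - x); nra.
by rewrite -(real_normK (num_real (sint _ _ _))) ler_sqr // nnegrE ltW.
Qed.

Lemma dist_chain (p p0 q r g k d1 d2 d3 : R) : q = r + g -> `|q - p| <= d1 ->
  `|r - p0| <= d2 -> `|g - k| <= d3 -> `|p - (p0 + k)| <= d1 + d2 + d3.
Proof.
move=> -> h1 h2 h3; have -> : p - (p0 + k) = - (r + g - p) + (r - p0) + (g - k) by ring.
apply: le_trans (ler_normD _ _) _; apply: lerD => //.
by apply: le_trans (ler_normD _ _) _; apply: lerD => //; rewrite normrN.
Qed.

Variables (A rho : R -> R) (w wx : R -> R -> R) (ab c00 : R).
Hypotheses (Al : lbm A) (rhol : lbm rho) (Arho : forall x, A x * rho x = 1).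
Hypothesis sol : micro_solution A w wx.

(** The constant [c00] stays free here; it is fixed later so that the initial deviation has mean
    zero over a cell. *)
Definition W0 x := sint (fun s => ab * rho s) 0 x + c00.
Definition v x t := w x t - W0 x.
Definition vx x t := wx x t - ab * rho x.

Let abr : lbm (fun s => ab * rho s).
Proof. by apply: lbmM => //; exact: lbm_cst. Qed.

Lemma W0_prim : prim W0 (fun s => ab * rho s).
Proof. by move=> x y; rewrite /W0 -(@sint_chasles _ _ 0 x y (lint_lbm abr)); ring. Qed.

Lemma wx_L2l t : L2l (wx^~ t).
Proof.
split; first exact: micro_meas sol t.
move=> x y; have [mf _ K] := micro_L2loc sol t.
apply/integrableP; split.
  by apply/measurable_EFinP; exact: measurable_funTS.
by apply: K => //; exact: segment_compact.
Qed.

Lemma vx_L2l t : L2l (vx^~ t).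
Proof. by apply: L2lB; [exact: wx_L2l|exact: L2l_lbm]. Qed.

Lemma vx_L2c : L2c vx.
Proof.
split=> [t|r t0 e r0 e0]; first exact: vx_L2l.
have /cvgrPdist_le/(_ e e0)[d /= d0 Hd] := micro_cont sol t0 r0.
exists d => // t tt0; have := Hd t; rewrite /ball_ /= distrC => /(_ tt0).
rewrite sub0r normrN -sint_le; last lra.
move=> H; apply: le_trans (le_trans (ler_norm _) H); rewrite le_eqVlt; apply/orP; left; apply/eqP.
by apply: eq_sint => x _; rewrite /vx; congr (_ ^+ 2); ring.
Qed.

Lemma w_prim t : prim (w^~ t) (wx^~ t).
Proof.
move=> x y; have [xy|/ltW xy] := leP x y; first by rewrite sint_le // -(micro_deriv sol).
by rewrite sint_rev sint_le // -(micro_deriv sol) // opprB.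
Qed.

Lemma v_prim t : prim (v^~ t) (vx^~ t).
Proof.
move=> x y; rewrite /v /vx sintB; [|exact/L2l_lint/wx_L2l|exact: lint_lbm].
by rewrite -w_prim -W0_prim; ring.
Qed.

Lemma v_cont t : continuous (v^~ t).
Proof. exact: prim_L2_cont (@v_prim t) (vx_L2l t). Qed.

Let D x t := sint (vx^~ t) 0 x.

Let D_Ucont : Ucont D.
Proof.
split=> [t|B t e e0].
  apply: (@prim_L2_cont _ (vx^~ t)); last exact: vx_L2l.
  move=> x y; rewrite /D -(@sint_chasles _ _ 0 x y (L2l_lint (vx_L2l t))); ring.
pose r := `|B| + 1; have r0 : 0 < r by rewrite /r; have := normr_ge0 B; lra.
have e2 : 0 < e ^+ 2 / r by rewrite divr_gt0 // exprn_gt0.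
have [d d0 Hd] := vx_L2c.2 r t _ r0 e2; exists d => // x h xB hd.
have := Hd (t + h); rewrite addrAC subrr add0r => /(_ hd) H.
rewrite /D -sintB; [|exact/L2l_lint/vx_L2l|exact/L2l_lint/vx_L2l].
have xr : `|x| <= r by rewrite /r; have := ler_norm B; lra.
have zr : `|0 : R| <= r by rewrite normr0; exact: ltW.
have := sint_L2 (L2lB (vx_L2l (t + h)) (vx_L2l t)) zr xr; rewrite subr0 => X.
have : sint (fun s => vx s (t + h) - vx s t) 0 x ^+ 2 <= e ^+ 2.
  apply: le_trans X _; apply: (@le_trans _ _ (r * (e ^+ 2 / r))).
    by apply: ler_pM => //; apply: sint_ge0 => [|s _]; [lra|exact: sqr_ge0].
  by rewrite mulrC divfK // gt_eqF.
by rewrite -(real_normK (num_real (sint _ _ _))) ler_sqr // nnegrE ltW.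
Qed.

Let vE x t : v x t = v 0 t + D x t.
Proof. by rewrite /D -v_prim; ring. Qed.

(** This is the square of the positive part of 1 - x^2, a C1 test function supported in [-1, 1]. *)
Let bump := (wt (1 : R) 1 1)^~ 0.

Let bump0 x : ~~ (- (1 : R) <= x <= 1) -> bump x = 0.
Proof.
move=> xn; apply: wt_end; rewrite ?ltr01 // mulr1 expr1n.
move: xn; rewrite -ler_norml -ltNge => x1.
by rewrite -(real_normK (num_real x)); nra.
Qed.

Let bump_lbm : lbm bump. Proof. exact: wt_lbm. Qed.

Let bump_derive x : is_derive x 1 bump (wt_x (1 : R) 1 1 x 0).
Proof.
exact: (@is_derive1_comp _ (fun u => pos u ^+ 2) (wt_arg (1 : R) 1 1 ^~ 0) _ _ _
  (pos_sq_derive _) (wt_arg_derive 1 1 (@ltr01 R) 0 x)).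
Qed.

Let bump_C1c : C1c bump.
Proof. by have [] := C1c_intro bump_derive (@wt_x_cont R 1 1 1 0) bump0. Qed.

Let bump_int_gt0 : 0 < sint bump (-1) 1.
Proof.
have bl := lint_lbm bump_lbm.
apply: (@lt_le_trans _ _ (sint bump (- 2^-1) 2^-1)); last first.
  by apply: sint_sub => //; [move=> s; exact: sqr_ge0|lra|lra|lra].
apply: (@lt_le_trans _ _ (sint (fun=> (4^-1 : R)) (- 2^-1) 2^-1)).
  by rewrite sint_cst; lra.
apply: le_sint => //; [exact/lint_lbm/lbm_cst|lra|].
move=> x /andP[x1 x2]; have h : 2^-1 <= wt_arg (1 : R) 1 1 x 0.
  rewrite /wt_arg expr1n mulr0 subr0 divr1.
  have : 0 <= (2^-1 - x) * (2^-1 + x) by apply: mulr_ge0; lra.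
  by lra.
have := pos_ge (wt_arg (1 : R) 1 1 x 0); rewrite /bump /wt; nra.
Qed.

(** A weak solution provides continuity in time only for [wx] in L2 and for pairings of [w] with
    test functions. Writing v(x,t) = v(0,t) + D(x,t), the first fact handles D, and pairing with the
    bump isolates v(0,t). *)
Lemma v_Ucont : Ucont v.
Proof.
suff c0 : continuous (v 0).
  have -> : v = (fun x t => v 0 t + D x t) by apply/funext => x; apply/funext => t; exact: vE.
  apply: (@UcontD R (fun x t => v 0 t)); last exact: D_Ucont.
  split=> [t x|B t e e0]; first exact: cvg_cst.
  have [d d0 Hd] := (cont_epsP _ _).1 (c0 t) e e0; exists d => // x h _ hd.
  by apply: Hd; rewrite addrAC subrr add0r.
have [dm _ _] := micro_wave sol bump_C1c.
pose m t := \int[mu]_x (w x t * bump x); pose I := sint bump (-1) 1.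
have In : I != 0 by rewrite gt_eqF // bump_int_gt0.
have mE t : v 0 t = (m t - sint (fun x => bump x * W0 x) (-1) 1 -
    sint (fun x => bump x * D x t) (-1) 1) / I.
  have -> : m t = sint (fun x => bump x * w x t) (-1) 1.
    rewrite /m (@Rintegral_support _ _ (-1) 1); [|by move=> x /bump0 ->; rewrite mulr0|lra].
    by apply: eq_sint => x _; rewrite mulrC.
  have l1 : lbm (fun x => bump x * w x t).
    apply: lbmM => //; apply: lbm_continuous.
    exact: prim_L2_cont (@w_prim t) (wx_L2l t).
  have l2 : lbm (fun x => bump x * W0 x) by apply: lbmM => //; exact: prim_lbm W0_prim abr.
  have l3 : lbm (fun x => bump x * D x t) by apply: lbmM => //; exact: Ucont_lbm D_Ucont.
  rewrite -sintB; [|exact: lint_lbm|exact: lint_lbm].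
  rewrite -sintB; [|by apply: lint_lbm; exact: lbmB|exact: lint_lbm].
  have -> : sint (fun s => bump s * w s t - bump s * W0 s - bump s * D s t) (-1) 1 =
    sint (fun s => v 0 t * bump s) (-1) 1.
    by apply: eq_sint => x _; rewrite -mulrBr -mulrBr -/(v x t) vE addrK mulrC.
  by rewrite sintZ ?mulfK //; exact: lint_lbm.
have -> : v 0 = (fun t => (m t - sint (fun x => bump x * W0 x) (-1) 1 -
    sint (fun x => bump x * D x t) (-1) 1) / I) by apply/funext.
move=> t; apply: cvgM; last exact: cvg_cst.
apply: cvgB; last exact: (sint_Ucont bump_lbm D_Ucont).
apply: cvgB; last exact: cvg_cst.
by apply: differentiable_continuous; apply/derivable1_diffP; exact: dm.
Qed.

Lemma v0E x : v x 0 = x - W0 x.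
Proof. by rewrite /v (micro_init sol). Qed.

Definition flux x t := A x * vx x t.

Lemma flux_L2c : L2c flux.
Proof. exact: L2c_mul Al vx_L2c. Qed.

Section TestFunction.
Variables (f : R -> R) (B : R).
Hypotheses (B0 : 0 < B) (fl : lbm f) (f0 : forall x, B <= `|x| -> f x = 0)
  (fint : sint f (- B) B = 0).

Let phi := sint f (- B).
Let B' := B + 1.
Let fi := lint_lbm fl.

Lemma test_prim : prim phi f.
Proof. by move=> x y; rewrite /phi -(@sint_chasles _ _ (- B) x y fi); ring. Qed.

Lemma test_cont : continuous phi. Proof. exact: prim_cont test_prim fl. Qed.

Lemma test_out x : B <= `|x| -> phi x = 0.
Proof.
have B0' := B0.
have Z a b : (forall s, Num.min a b <= s <= Num.max a b -> B <= `|s|) -> sint f a b = 0.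
  move=> H; rewrite (@eq_sint _ _ (fun=> 0)); first by rewrite sint_cst mul0r.
  by move=> s /H/f0.
rewrite ler_normr => /orP[Bx|Bx]; rewrite /phi.
  rewrite -(@sint_chasles _ _ (- B) B x fi) fint add0r Z // => s.
  by rewrite min_l // max_r // => /andP[s1 s2]; rewrite ger0_norm; lra.
rewrite Z // => s; rewrite min_r; last lra.
by rewrite max_l; [move=> /andP[s1 s2]; rewrite ler0_norm; lra|lra].
Qed.

Let flux_f t := - sint (fun x => f x * flux x t) (- B') B'.

Let flux_cont chi : lbm chi -> continuous (fun t => - sint (fun x => chi x * flux x t) (- B') B').
Proof.
move=> cl t; apply: cvgN; apply: (@L2c_sint_cont _ (fun x t => chi x * flux x t)).
exact: L2c_mul cl flux_L2c.
Qed.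

Section Mollified.
Variable h : R.
Hypotheses (h0 : 0 < h) (h1 : h <= 1).

(** [phi] is merely Lipschitz, since [f] is only bounded. Its averages are C1 test functions with
    derivative [psih], the corresponding average of [f]; the margin 1 in [B'] contains their support
    because h <= 1. *)
Definition phih x := h^-1 * (sint phi 0 (x + h) - sint phi 0 x).
Definition psih x := h^-1 * (phi (x + h) - phi x).

Let phi_i : lint phi. Proof. exact/lint_lbm/lbm_continuous/test_cont. Qed.

Lemma phih_derive x : is_derive x 1 phih (psih x).
Proof.
have H y : is_derive y 1 (sint phi 0) (phi y) by apply: sint0_is_derive; exact: test_cont.
have := is_deriveZ (h^-1) (is_deriveB
  (@is_derive1_comp _ (sint phi 0) (fun x => x + h) x _ _ (H (x + h))
     (is_deriveD (is_derive_id x 1) (is_derive_cst h x 1))) (H x)).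
by rewrite addr0 mulr1.
Qed.

Lemma psih_cont : continuous psih.
Proof.
move=> x; apply: cvgM; first exact: cvg_cst.
apply: cvgB; last exact: test_cont.
apply: (@continuous_comp _ _ _ (fun x => x + h) phi); last exact: test_cont.
by apply: cvgD; [exact: cvg_id|exact: cvg_cst].
Qed.

Lemma phih_out x : (x <= - B' \/ B' <= x) -> phih x = 0.
Proof.
move=> H; have h0' := h0; have h1' := h1; have B0' := B0.
rewrite /phih; have -> : sint phi 0 (x + h) - sint phi 0 x = sint phi x (x + h).
  by rewrite -(@sint_chasles _ _ 0 x (x + h) phi_i); ring.
rewrite (@eq_sint _ _ (fun=> 0)); first by rewrite sint_cst mul0r mulr0.
move=> s; rewrite min_l ?max_r; try lra.
move=> /andP[s1 s2]; apply: test_out; rewrite /B' in H; rewrite ler_normr; apply/orP.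
by case: H => H; [right|left]; lra.
Qed.

Lemma phih_close M x : (forall y, `|f y| <= M) -> `|phih x - phi x| <= M * h.
Proof.
have h0' := h0; have h1' := h1.
move=> fM; have M0 : 0 <= M by apply: le_trans (fM 0).
have -> : phih x - phi x = h^-1 * sint (fun s => phi s - phi x) x (x + h).
  rewrite sintB //; last exact/lint_lbm/lbm_cst.
  rewrite sint_cst /phih -(@sint_chasles _ _ 0 x (x + h) phi_i); field; rewrite gt_eqF //.
rewrite normrM gtr0_norm ?invr_gt0 // mulrC ler_pdivrMr //.
have := @sint_bound _ (fun s => phi s - phi x) x (x + h) (M * h).
rewrite addrAC subrr add0r (gtr0_norm h0); apply.
  by apply: lintB => //; exact/lint_lbm/lbm_cst.
move=> s; rewrite min_l ?max_r; try lra.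
move=> /andP[s1 s2]; rewrite test_prim; apply: (@le_trans _ _ (M * `|s - x|)).
  by apply: sint_bound.
by rewrite ler_wpM2l // ger0_norm; lra.
Qed.

Lemma mollified_weak t :
  sint (fun x => phih x * v x t) (- B') B' = sint (fun x => phih x * v x 0) (- B') B' +
  dint (fun t => - sint (fun x => psih x * flux x t) (- B') B') t.
Proof.
have B0' := B0; have B'0 : - B' <= B' by rewrite /B'; lra.
have out x : ~~ (- B' <= x <= B') -> phih x = 0.
  by rewrite negb_and -!ltNge => /orP[/ltW|/ltW] H; apply: phih_out; auto.
have [C1 E1] := C1c_intro phih_derive psih_cont out.
have psil := lbm_continuous psih_cont.
have pp : prim phih psih by exact: FTC_all psih_cont phih_derive.
have phil : lbm phih by exact: prim_lbm pp psil.
have [d1 d2 d3] := micro_wave sol C1; have d4 := micro_init_t sol C1.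
set m := fun t => _ in d1 d2 d3 d4.
have mE s : m s = sint (fun x => phih x * v x s) (- B') B' + sint (fun x => phih x * W0 x) (- B') B'.
  rewrite /m (@Rintegral_support _ _ (- B') B') //; last by move=> x /out ->; rewrite mulr0.
  rewrite -sintD; first by apply: eq_sint => x _; rewrite /v; ring.
    by apply/lint_lbm/lbmM => //; exact/lbm_continuous/v_cont.
  by apply/lint_lbm/lbmM => //; exact: prim_lbm W0_prim abr.
pose g t := - sint (fun x => psih x * flux x t) (- B') B'.
have gc : continuous g by exact: flux_cont.
have ddm s : m^`(2) s = g s.
  rewrite d3 E1 /g; congr (- _).
  have pz x : ~~ (- B' <= x <= B') -> psih x = 0.
    have h0' := h0; have h1' := h1.
    rewrite negb_and -!ltNge /psih /B' => H; rewrite !test_out ?subrr ?mulr0 //.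
      by rewrite ler_normr; case/orP: H => H; apply/orP; [right|left]; lra.
    by rewrite ler_normr; case/orP: H => H; apply/orP; [right|left]; lra.
  rewrite (@Rintegral_support _ _ (- B') B') //; last by move=> x /pz ->; rewrite mulr0.
  (* Since A rho = 1, A wx is the flux of the deviation plus the constant [ab]; the constant
     disappears because [psih] has integral zero. *)
  have -> : sint (fun x => A x * wx x s * psih x) (- B') B' =
    sint (fun x => psih x * flux x s + ab * psih x) (- B') B'.
    apply: eq_sint => x _; rewrite /flux /vx.
    have -> : psih x * (A x * (wx x s - ab * rho x)) + ab * psih x =
      A x * wx x s * psih x + ab * psih x * (1 - A x * rho x) by ring.
    by rewrite Arho subrr mulr0 addr0.
  rewrite sintD; [|apply: lint_mul => //; exact/L2l_lint/(flux_L2c.1 s)|exact/lintZ/lint_lbm].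
  rewrite sintZ; last exact: lint_lbm.
  by rewrite -pp !phih_out ?subrr ?mulr0 ?addr0 //; [left|right].
have D1 s : is_derive s 1 m (m^`() s) by apply: DeriveDef; [exact: d1|rewrite derive1E].
have D2 s : is_derive s 1 m^`() (g s).
  by rewrite -ddm; apply: DeriveDef; [exact: d2|rewrite [RHS]derive1E].
have E2 : m^`() =1 sint g 0.
  apply: eq_deriv D2 _ _; last by rewrite d4 sintxx.
  by move=> s; exact: sint0_is_derive.
have := @eq_deriv _ m (fun t => m 0 + dint g t) (sint g 0) _ _ _ t; rewrite !mE => E3.
apply: (@addIr _ (sint (fun x => phih x * W0 x) (- B') B')); rewrite [RHS]addrAC; apply: E3.
- by move=> s; rewrite -E2.
- move=> s; have := is_deriveD (is_derive_cst (m 0) s 1) (dint_is_derive s gc).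
  by rewrite add0r mE; exact.
- by rewrite /dint sintxx addr0.
Qed.

End Mollified.

Let phil : lbm phi. Proof. exact: lbm_continuous test_cont. Qed.
Let vl t : lbm (v^~ t). Proof. exact/lbm_continuous/v_cont. Qed.

(** The averages [phih] approach [phi] uniformly, and [psih] approaches [f] in L2 by [mollify],
    while the flux stays bounded in L2 over the time interval. So the weak equation survives for
    Lipschitz test functions. *)
Lemma test_weak t : sint (fun x => phi x * v x t) (- B') B' =
  sint (fun x => phi x * v x 0) (- B') B' + dint flux_f t.
Proof.
have B0' := B0; have B'0 : - B' <= B' by rewrite /B'; lra.
have fc : continuous flux_f by exact: flux_cont.
have [_ /(_ B)[M HM]] := fl.
have fM x : `|f x| <= `|M|.
  have [xB|/ltW xB] := leP `|x| B; last by rewrite f0 // normr0.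
  by apply: le_trans (ler_norm M); exact: HM.
have [_ /(_ B')[V1 HV1]] := vl t; have [_ /(_ B')[V2 HV2]] := vl 0.
have [N N0 HN] := L2c_bounded B' `|t| flux_L2c.
pose K := `|M| * (`|V1| + `|V2|) * (2 * B').
have K0 : 0 <= K by rewrite /K !mulr_ge0 // ?addr_ge0 // /B'; lra.
apply/eqP; rewrite -subr_eq0 -normr_le0; apply/ler_addgt0Pr => e e0; rewrite add0r.
have K1 : 0 < K + 1 by lra.
have t1 : 0 < t ^+ 2 + 1 by have := sqr_ge0 t; lra.
have N1 : 0 < N + 1 by lra.
pose k := e / 2 / (t ^+ 2 + 1); have k0 : 0 < k by rewrite /k !divr_gt0.
pose e1 := Num.min (e / 2 / (K + 1)) (k ^+ 2 / (N + 1)).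
have e10 : 0 < e1 by rewrite lt_min !divr_gt0 ?exprn_gt0.
have f0' x : ~~ (- B <= x <= B) -> f x = 0.
  by rewrite -ler_norml -ltNge => /ltW; exact: f0.
have [h [h0 h1 he Hh]] := mollify B' (ltW B0') fl f0' e10.
have := mollified_weak h0 h1 t.
pose g t := - sint (fun x => psih h x * flux x t) (- B') B'; rewrite -/g.
have psil : lbm (psih h) by exact/lbm_continuous/psih_cont.
have gc : continuous g by exact: flux_cont.
have phihl : lbm (phih h).
  apply: (prim_lbm _ psil); apply: FTC_all; [exact: psih_cont|exact: phih_derive].
move=> E.
have close V s : (forall x, `|x| <= B' -> `|v x s| <= V) ->
    `|sint (fun x => phih h x * v x s) (- B') B' - sint (fun x => phi x * v x s) (- B') B'|
    <= `|M| * h * `|V| * (2 * B').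
  move=> HV; rewrite -sintB; try by apply: lint_lbm; exact: lbmM.
  have -> : 2 * B' = `|B' - - B'| by rewrite ger0_norm; lra.
  apply: sint_bound; first by apply: lintB; apply: lint_lbm; exact: lbmM.
  move=> x; rewrite min_l // max_r // -ler_norml => xB; rewrite -mulrBl normrM.
  apply: ler_pM => //; first exact: phih_close.
  by apply: le_trans (ler_norm V); exact: HV.
have gclose s : `|s| <= `|t| -> `|g s - flux_f s| <= k.
  move=> st; have Fl := flux_L2c.1 s.
  have -> : g s - flux_f s = - sint (fun x => (psih h x - f x) * flux x s) (- B') B'.
    rewrite /g /flux_f opprK addrC -[X in _ = - X]opprK opprK.
    rewrite -opprB -sintB; try by apply: lint_mul => //; exact: L2l_lint.
    by congr (- _); apply: eq_sint => x _; ring.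
  rewrite normrN.
  have : sint (fun x => (psih h x - f x) * flux x s) (- B') B' ^+ 2 <= k ^+ 2.
    apply: le_trans (L2l_CS B'0 (L2l_lbm (lbmB psil fl)) Fl) _.
    apply: (@le_trans _ _ (e1 * N)).
      apply: ler_pM; [by apply: sint_ge0 => // x _; exact: sqr_ge0|by apply: sint_ge0 => // x _; exact: sqr_ge0| |exact: HN].
      exact: Hh.
    have : e1 <= k ^+ 2 / (N + 1) by rewrite ge_min lexx orbT.
    by rewrite ler_pdivlMr //; lra.
  by rewrite -(real_normK (num_real (sint _ _ _))) ler_sqr // nnegrE ltW.
have dclose : `|dint g t - dint flux_f t| <= e / 2.
  have -> : dint g t - dint flux_f t = dint (fun s => g s - flux_f s) t.
    rewrite /dint -sintB; try by apply/lint_lbm/lbm_continuous/sint_cont.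
    apply: eq_sint => s _; rewrite sintB //; exact/lint_lbm/lbm_continuous.
  apply: le_trans (dint_bound (k := k) _ gclose) _.
    by move=> s; apply: cvgB; [exact: gc|exact: fc].
  rewrite /k mulrAC ler_pdivrMr //; have := sqr_ge0 t; nra.
have c1 := close V1 t HV1; have c2 := close V2 0 HV2.
have hK : h * K <= e / 2.
  have : h <= e / 2 / (K + 1) by apply: le_trans he _; rewrite ge_min lexx.
  by rewrite ler_pdivlMr //; lra.
apply: le_trans (dist_chain E c1 c2 dclose) _.
have -> : `|M| * h * `|V1| * (2 * B') + `|M| * h * `|V2| * (2 * B') = h * K by rewrite /K; ring.
by move: hK; move: (h * K) => z; lra.
Qed.

(** By parts in x: a space primitive of [v] has the flux as its second time derivative, up to a
    function of time alone, which the zero mean of [f] annihilates. *)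
Lemma potential_weak t :
  sint (fun x => f x * sint (v^~ t) 0 x) (- B') B' =
  sint (fun x => f x * sint (v^~ 0) 0 x) (- B') B' +
  dint (fun t => sint (fun x => f x * flux x t) (- B') B') t.
Proof.
have B0' := B0.
have vi s : lint (v^~ s) by exact: lint_lbm.
have pv s : prim (sint (v^~ s) 0) (v^~ s).
  by move=> x y; rewrite -(@sint_chasles _ _ 0 x y (vi s)); ring.
have H s : sint (fun x => f x * sint (v^~ s) 0 x) (- B') B' = - sint (fun x => phi x * v x s) (- B') B'.
  have rl : lbm (sint (v^~ s) 0) by exact: prim_lbm (pv s) (vl s).
  have := prim_mul test_prim (pv s) fl (vl s) (- B') B'.
  rewrite -/phi !test_out ?normrN; try by rewrite /B' ger0_norm; lra.
  rewrite !mul0r subrr sintD; try by apply: lint_lbm; exact: lbmM.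
  by move=> /eqP; rewrite eq_sym addr_eq0 => /eqP.
rewrite !H test_weak opprD; congr (_ + _).
have fc : continuous (fun t => sint (fun x => f x * flux x t) (- B') B').
  exact: (@L2c_sint_cont _ (fun x t => f x * flux x t)) (L2c_mul fl flux_L2c).
have fi' := lint_lbm (lbm_continuous fc).
rewrite /dint -sintN; last exact/lint_lbm/lbm_continuous/sint_cont/flux_cont.
apply: eq_sint => s _; rewrite -sintN; last exact/lint_lbm/lbm_continuous/flux_cont.
by apply: eq_sint => r _; rewrite /flux_f opprK.
Qed.

End TestFunction.

Definition weak_flux_fun chi a b t := sint (fun x => chi x * flux x t) a b.

(* The additive constant in [v_x = potential] is fixed, at all times at once, by
   testing with the indicator of [0, 1]. *)
Definition potential (q00 : R) x t := q00 + sint (v^~ t) 0 x +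
  (dint (fun t => sint (flux^~ t) 0 1) t -
   (sint (sint (v^~ t) 0) 0 1 - sint (sint (v^~ 0) 0) 0 1)).

Section Potential.
Variable q00 : R.
Notation Q1 := (potential q00).

Let vl t : lbm (v^~ t). Proof. exact/lbm_continuous/v_cont. Qed.
Let vi t : lint (v^~ t). Proof. exact: lint_lbm. Qed.
Let pv s : prim (sint (v^~ s) 0) (v^~ s).
Proof. by move=> x y; rewrite -(@sint_chasles _ _ 0 x y (vi s)); ring. Qed.
Let rc s : continuous (sint (v^~ s) 0).
Proof. exact: prim_cont (pv s) (vl s). Qed.
Let rl s : lbm (sint (v^~ s) 0).
Proof. exact: lbm_continuous. Qed.
Let fluxi s : lint (flux^~ s). Proof. exact/L2l_lint/(flux_L2c.1 s). Qed.
Let flux01 : continuous (fun t => sint (flux^~ t) 0 1).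
Proof. exact: L2c_sint_cont flux_L2c. Qed.

Lemma potential_prim t : prim (Q1^~ t) (v^~ t).
Proof.
move=> x y; rewrite /potential; move: (dint _ t - _) => c.
by rewrite -(pv t x y); move: (sint _ 0 x) (sint _ 0 y) => p q; ring.
Qed.

Lemma potential0 x : Q1 x 0 = q00 + sint (v^~ 0) 0 x.
Proof.
by rewrite /potential [dint _ 0]sintxx; move: (sint (sint _ 0) 0 1) => c; rewrite !subrr addr0.
Qed.

Let rUcont : Ucont (fun x t => sint (v^~ t) 0 x).
Proof.
split=> [t|B t e e0]; first exact: rc.
pose K := `|B| + 1; have K0 : 0 < K by rewrite /K; have := normr_ge0 B; lra.
have [d d0 Hd] := v_Ucont.2 B t _ (divr_gt0 e0 K0); exists d => // x h xB hd.
rewrite -sintB //; apply: (@le_trans _ _ (e / K * `|x - 0|)).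
  apply: sint_bound; first exact: lintB.
  move=> s sx; apply: Hd => //; apply: le_trans xB.
  case: (leP 0 x) sx => x0 /andP[s1 s2]; first by rewrite !ger0_norm; lra.
  by rewrite (ltr0_norm x0) ler0_norm; lra.
rewrite subr0 mulrAC ler_pdivrMr // ler_wpM2l ?ltW //.
by rewrite /K; have := ler_norm B; lra.
Qed.

Lemma potential_Ucont : Ucont Q1.
Proof.
have rt : continuous (fun t => sint (sint (v^~ t) 0) 0 1).
  rewrite (_ : (fun t => _) = (fun t => sint (fun x => 1 * sint (v^~ t) 0 x) 0 1)).
    exact: (sint_Ucont (lbm_cst 1) rUcont).
  by apply/funext => t; apply: eq_sint => x _; rewrite mul1r.
have cc : continuous (fun t => dint (fun t => sint (flux^~ t) 0 1) t -
   (sint (sint (v^~ t) 0) 0 1 - sint (sint (v^~ 0) 0) 0 1)).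
  move=> t; apply: cvgB; first exact: is_derive_cont (dint_is_derive t flux01).
  by apply: cvgB; [exact: rt|exact: cvg_cst].
have timefun (f : R -> R) : continuous f -> Ucont (fun x t => f t).
  move=> cf; split=> [t x|B t e e0]; first exact: cvg_cst.
  have [d d0 Hd] := (cont_epsP _ _).1 (cf t) e e0; exists d => // x h _ hd.
  by apply: Hd; rewrite addrAC subrr add0r.
apply: UcontD; last exact: timefun.
apply: (@UcontD R (fun x t => q00)); last exact: rUcont.
by apply: timefun => t; exact: cvg_cst.
Qed.

Lemma potential_weak_flux : weak_flux Q1 weak_flux_fun.
Proof.
split; last first.
  move=> T a b ab_; have [N N0 HN] := L2c_bounded (`|a| + `|b|) T flux_L2c.
  exists N => // chi t cl tT; rewrite /weak_flux_fun.
  apply: le_trans (L2l_CS ab_ (L2l_lbm cl) (flux_L2c.1 t)) _.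
  rewrite mulrC ler_wpM2r //; first by apply: sint_ge0 => // x _; exact: sqr_ge0.
  apply: le_trans (HN t tT); have := ler_norm a; have := ler_norm b.
  have := ler_norm (- a); have := normr_ge0 a; have := normr_ge0 b; rewrite normrN => *.
  by apply: sint_sub => //; [exact: (flux_L2c.1 t).2|move=> s; exact: sqr_ge0|lra|lra].
move=> chi a b cl ab_; pose X := sint chi a b.
pose i1 := (\1_([set` `[a, b]%R]) : R -> R); pose i2 := (\1_([set` `[0, 1]%R]) : R -> R).
(* A multiple of the indicator of [0, 1] makes the test function mean-free, so that [potential_weak]
   applies; the normalisation of the potential accounts for the subtracted part. *)
pose f x := chi x * i1 x - X * i2 x.
pose B := `|a| + `|b| + 2; pose B' := B + 1.
have [na nb] := (normr_ge0 a, normr_ge0 b).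
have aN : - `|a| <= a /\ a <= `|a| by split; [have := ler_norm (- a); rewrite normrN; lra|exact: ler_norm].
have bN : - `|b| <= b /\ b <= `|b| by split; [have := ler_norm (- b); rewrite normrN; lra|exact: ler_norm].
have B0 : 0 < B by rewrite /B; lra.
have i1l : lbm i1 by exact: lbm_indic_itv.
have i2l : lbm i2 by exact: lbm_indic_itv.
have i1E x : a <= x <= b -> i1 x = 1.
  by move=> xab; rewrite /i1 indicE mem_set //= in_itv.
have i1E0 x : ~~ (a <= x <= b) -> i1 x = 0.
  by move=> xab; rewrite /i1 indicE memNset //= in_itv; exact/negP.
have i2E x : 0 <= x <= 1 -> i2 x = 1.
  by move=> xab; rewrite /i2 indicE mem_set //= in_itv.
have i2E0 x : ~~ (0 <= x <= 1) -> i2 x = 0.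
  by move=> xab; rewrite /i2 indicE memNset //= in_itv; exact/negP.
have fl : lbm f by apply: lbmB; apply: lbmM => //; exact: lbm_cst.
have split_f g c : B <= c -> lint g ->
    sint (fun x => f x * g x) (- c) c = sint (fun x => chi x * g x) a b - X * sint g 0 1.
  move=> Bc gi; have E1 : sint (fun x => i1 x * (chi x * g x)) (- c) c = sint (fun x => chi x * g x) a b.
    rewrite (@sint_support _ _ a b) //; [|by apply: lint_mul => //; exact: lint_mul|by move=> x /i1E0 ->; rewrite mul0r|rewrite /B in Bc; lra|rewrite /B in Bc; lra].
    by apply: eq_sint => x; rewrite min_l // max_r // => /i1E ->; rewrite mul1r.
  have E2 : sint (fun x => i2 x * g x) (- c) c = sint g 0 1.
    rewrite (@sint_support _ _ 0 1) //; [|exact: lint_mul|by move=> x /i2E0 ->; rewrite mul0r|rewrite /B in Bc; lra|rewrite /B in Bc; lra].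
    by apply: eq_sint => x; rewrite min_l // max_r // => /i2E ->; rewrite mul1r.
  rewrite -E1 -E2 -sintZ; last exact: lint_mul.
  rewrite -sintB; [|by apply: lint_mul => //; exact: lint_mul|by apply: lintZ; exact: lint_mul].
  by apply: eq_sint => x _; rewrite /f; ring.
have f0 x : B <= `|x| -> f x = 0.
  move=> Bx; rewrite /f i1E0 ?i2E0 ?mulr0 ?subr0 //.
    apply/negP => /andP[x1 x2]; move: Bx; rewrite leNgt => /negP; apply.
    by rewrite /B ltr_norml; apply/andP; split; lra.
  apply/negP => /andP[x1 x2]; move: Bx; rewrite leNgt => /negP; apply.
  by rewrite /B ltr_norml; apply/andP; split; lra.
have fint : sint f (- B) B = 0.
  have -> : sint f (- B) B = sint (fun x => f x * 1) (- B) B.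
    by apply: eq_sint => x _; rewrite mulr1.
  rewrite split_f //; last exact/lint_lbm/lbm_cst.
  rewrite sint_cst subr0 !mulr1; have -> : sint (fun x => chi x * 1) a b = X.
    by apply: eq_sint => x _; rewrite mulr1.
  by rewrite subrr.
have PW := potential_weak B0 fl f0 fint.
have BB' : B <= B' by rewrite /B'; lra.
pose F t := sint (fun x => f x * flux x t) (- B') B'.
have FE t : F t = weak_flux_fun chi a b t - X * sint (flux^~ t) 0 1 by exact: split_f.
have Fc : continuous F.
  exact: (@L2c_sint_cont _ (fun x t => f x * flux x t)) (L2c_mul fl flux_L2c).
pose k0 := X * q00 + sint (fun x => f x * sint (v^~ 0) 0 x) (- B') B' + X * sint (sint (v^~ 0) 0) 0 1.
have mE t : sint (fun x => chi x * Q1 x t) a b = k0 + (dint F t + X * dint (fun t => sint (flux^~ t) 0 1) t).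
  pose cc := q00 + (dint (fun t => sint (flux^~ t) 0 1) t -
     (sint (sint (v^~ t) 0) 0 1 - sint (sint (v^~ 0) 0) 0 1)).
  have -> : sint (fun x => chi x * Q1 x t) a b =
     sint (fun x => chi x * sint (v^~ t) 0 x) a b + cc * X.
    rewrite -sintZ; last exact: lint_lbm.
    rewrite -sintD; [|by apply: lint_lbm; exact: lbmM|by apply: lintZ; exact: lint_lbm].
    apply: eq_sint => x _; rewrite /potential /cc.
    by move: (dint _ t - _) (sint _ 0 x) => c1 c2; ring.
  have := split_f (sint (v^~ t) 0) B' BB' (lint_lbm (rl t)); rewrite PW => E.
  have -> : sint (fun x => chi x * sint (v^~ t) 0 x) a b =
    sint (fun x => f x * sint (v^~ 0) 0 x) (- B') B' + dint F t + X * sint (sint (v^~ t) 0) 0 1.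
    by rewrite /F E subrK.
  rewrite /k0 /cc; move: (dint F t) (dint _ t) (sint _ 0 1) (sint _ 0 1) (sint _ (- B') B').
  by move=> c1 c2 c3 c4 c5; ring.
exists (fun t => sint F 0 t + X * sint (fun t => sint (flux^~ t) 0 1) 0 t); split.
- move=> t; have -> : (fun t => sint (fun x => chi x * Q1 x t) a b) =
    (fun t => k0 + (dint F t + X * dint (fun t => sint (flux^~ t) 0 1) t)) by apply/funext.
  have := is_deriveD (is_derive_cst k0 t 1) (is_deriveD (dint_is_derive t Fc)
     (is_deriveZ X (dint_is_derive t flux01))).
  by rewrite add0r.
- move=> t; have := is_deriveD (sint0_is_derive t Fc) (is_deriveZ X (sint0_is_derive t flux01)).
  by rewrite FE /GRing.scale /= subrK.
- by rewrite !sintxx mulr0 addr0.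
Qed.

End Potential.
End WeakSolution.

(** * Affine change of variables *)

Section Affine.
Variable R : realType.
Implicit Types (x y t s e d h k l a b c B T N eta : R) (f : R -> R).
Notation mu := (@lebesgue_measure R).

Lemma affine_itv k c x y : 0 < k ->
  (fun s => k * s + c) @^-1` `[k * x + c, k * y + c] = (`[x, y] : set R).
Proof.
move=> k0; apply/seteqP; split => s /=; rewrite !in_itv /= !lerD2r !ler_pM2l //.
Qed.

(** Lebesgue measure equals k times its image under s -> k s + c, by uniqueness from the values on
    half-open intervals. *)
Lemma integral_affine k c x y (f : R -> R) : 0 < k -> measurable_fun setT f ->
  (forall s, 0 <= f s) ->
  (\int[mu]_(s in `[(k * x + c)%R, (k * y + c)%R]) (f s)%:E =
   k%:E * \int[mu]_(s in `[x, y]) (f (k * s + c)%R)%:E)%E.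
Proof.
move=> k0 mf f0; pose phi : measurableTypeR R -> measurableTypeR R := fun x => k * x + c.
have mphi : measurable_fun setT phi.
  apply: continuous_measurable_fun => z; apply: cvgD; last exact: cvg_cst.
  by apply: cvgM; [exact: cvg_cst|exact: cvg_id].
pose k' := NngNum (ltW k0).
pose nu0 := mscale k' (pushforward mu phi) : {measure set (measurableTypeR R) -> \bar R}.
pose nu := nu0 mphi.
have E (A : set (measurableTypeR R)) : measurable A -> mu A = nu A.
  move=> mA; apply: lebesgue_measure_unique => //= _ [[a b]] _ <-.
  rewrite /nu /nu0 /mscale /= /pushforward.
  have -> : phi @^-1` `]a, b] = `](a - c) / k, (b - c) / k].
    apply/seteqP; split => s /=; rewrite !in_itv /= /phi ltr_pdivrMr // ler_pdivlMr //;
     by rewrite ltrBlDr lerBrDr [s * k]mulrC.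
  rewrite !lebesgue_measure_itv /= !lte_fin ltr_pM2r ?invr_gt0 // ltrD2r.
  case: ifP => _; last by rewrite mule0.
  rewrite -!EFinB -EFinM; congr EFin; rewrite -mulrBl mulrCA mulfV ?gt_eqF // mulr1.
  ring.
have mD : measurable (`[(k * x + c)%R, (k * y + c)%R] : set (measurableTypeR R)) by exact: measurable_itv.
rewrite (@eq_measure_integral _ _ _ _ nu); last by move=> A mA _; exact: E.
rewrite ge0_integral_mscale //; last 2 first.
- by apply/measurable_EFinP; exact: measurable_funTS.
- by move=> s _; rewrite lee_fin.
congr (_ * _)%E; rewrite ge0_integral_pushforward //=.
- by rewrite /phi affine_itv.
- by apply/measurable_EFinP; exact: measurable_funTS.
- by move=> s _; rewrite lee_fin.
Qed.

Lemma sint_affine_ge0 k c x y f : 0 < k -> measurable_fun setT f -> (forall s, 0 <= f s) ->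
  sint f (k * x + c) (k * y + c) = k * sint (fun s => f (k * s + c)) x y.
Proof.
move=> k0 mf f0; wlog xy : x y / x <= y => [W|].
  by have [/W//|/ltW/W E] := leP x y; rewrite sint_rev E [in RHS]sint_rev mulrN.
rewrite !sint_le ?lerD2r ?ler_pM2l // /Rintegral integral_affine //.
set I := (\int[_]_(_ in _) _)%E; have I0 : (0 <= I)%E.
  by apply: integral_ge0 => s _; rewrite lee_fin.
(* If the integral is infinite, both real-valued integrals take the default value 0. *)
have := leey I; rewrite le_eqVlt => /predU1P[->|Iy]; last by rewrite fineM // ge0_fin_numE.
by rewrite gt0_muley ?lte_fin //= mulr0.
Qed.

Lemma sint_translate f c x y b : measurable_fun setT f -> (forall s, `|f s| <= b) ->
  sint f (x + c) (y + c) = sint (fun s => f (s + c)) x y.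
Proof.
move=> mf fb; have fl : lbm f by split => // B; exists b.
have fcl : lbm (fun s => f (s + c)).
  split; last by move=> B; exists b.
  apply: (@measurableT_comp _ _ _ _ _ _ f _ (fun s => s + c)) => //.
  apply: continuous_measurable_fun => z; apply: cvgD; [exact: cvg_id|exact: cvg_cst].
(* Adding the bound b reduces to a nonnegative integrand. *)
have := @sint_affine_ge0 1 c x y (fun s => f s + b) ltr01 _ _.
rewrite !mul1r => /(_ _ _)E.
have {E} : sint (fun s => f s + b) (x + c) (y + c) = sint (fun s => f (s + c) + b) x y.
  rewrite E //; first by apply: eq_sint => s _; rewrite mul1r.
    exact: measurable_funD.
  by move=> s; have := fb s; rewrite ler_norml => /andP[]; lra.
rewrite !sintD; try by apply: lint_lbm => //; exact: lbm_cst.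
by rewrite !sint_cst; lra.
Qed.

End Affine.

(** * Periodic primitives *)

Section Periodic.
Variable R : realType.
Variable eps : R.
Hypothesis eps0 : 0 < eps.
Implicit Types (x y t s e d h k l a b c B T N eta : R) (f theta : R -> R).

Definition periodic_of f := forall x, f (x + eps) = f x.

Lemma periodic_int f (n : int) x : periodic_of f -> f (x + n%:~R * eps) = f x.
Proof.
move=> pf; have P (k : nat) z : f (z + k%:R * eps) = f z.
  elim: k z => [|k IH] z; first by rewrite mul0r addr0.
  by rewrite -natr1 mulrDl mul1r addrA pf.
case: n => n; first exact: P.
by rewrite NegzE mulrNz mulNr -[in RHS](subrK (n.+1%:R * eps) x) P.
Qed.

Lemma periodic_reduce x : exists n : int, 0 <= x - n%:~R * eps < eps.
Proof.
exists (Num.floor (x / eps)); have := floor_le (x / eps); have := floorD1_gt (x / eps).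
rewrite ltr_pdivrMr // ler_pdivlMr // intrD mulrDl mul1r => h1 h2.
by apply/andP; split; lra.
Qed.

Lemma periodic_sint f b x : periodic_of f -> measurable_fun setT f -> (forall s, `|f s| <= b) ->
  sint f x (x + eps) = sint f 0 eps.
Proof.
move=> pf mf fb; have fl : lint f by apply: lint_lbm; split => // B; exists b.
have := sint_translate eps 0 x mf fb; rewrite add0r.
rewrite (@eq_sint _ (fun s => f (s + eps)) f) // => E.
apply: (addrI (sint f 0 x)); rewrite sint_chasles // -(@sint_chasles _ f 0 eps (x + eps)) //.
by rewrite E addrC.
Qed.

(** The constant makes the theta-weighted mean over a cell vanish. The weight is the factor by which
    this function is multiplied before the next integration, so the next primitive is periodic as
    well. *)
Definition pprim theta f x :=
  sint f 0 x - sint (fun s => theta s * sint f 0 s) 0 eps / sint theta 0 eps.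

Section PeriodicPrimitive.
Variables (theta f : R -> R) (m b : R).
Hypotheses (m0 : 0 < m) (thetal : lbm theta) (theta_lb : forall x, m <= theta x).
Hypotheses (fl : lbm f) (pf : periodic_of f) (f0 : sint f 0 eps = 0)
  (fb : forall x, `|f x| <= b).

Let fi : lint f. Proof. exact: lint_lbm. Qed.

Let F_prim : prim (sint f 0) f.
Proof. by move=> x y; rewrite -(@sint_chasles _ f 0 x y fi); ring. Qed.

Let Fl : lbm (sint f 0). Proof. exact: prim_lbm F_prim fl. Qed.

Lemma pprim_prim : prim (pprim theta f) f.
Proof. by move=> x y; rewrite -F_prim /pprim; ring. Qed.

Lemma pprim_lbm : lbm (pprim theta f). Proof. exact: prim_lbm pprim_prim fl. Qed.

Let F_per : periodic_of (sint f 0).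
Proof.
move=> x; rewrite -(@sint_chasles _ f 0 x (x + eps) fi).
by rewrite (periodic_sint x pf _ fb) ?f0 ?addr0 //; case: fl.
Qed.

Lemma pprim_periodic : periodic_of (pprim theta f).
Proof. by move=> x; rewrite /pprim F_per. Qed.

Let I0 : 0 < sint theta 0 eps.
Proof.
apply: (@lt_le_trans _ _ (sint (fun=> m) 0 eps)); first by rewrite sint_cst mulr_gt0 // subr0.
by apply: le_sint => //; [exact/lint_lbm/lbm_cst|exact: lint_lbm|exact: ltW].
Qed.

Lemma pprim_mean : sint (fun x => theta x * pprim theta f x) 0 eps = 0.
Proof.
set c := sint (fun s => theta s * sint f 0 s) 0 eps / sint theta 0 eps.
have -> : sint (fun x => theta x * pprim theta f x) 0 eps =
  sint (fun s => theta s * sint f 0 s - c * theta s) 0 eps.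
  by apply: eq_sint => s _; rewrite /pprim -/c; ring.
rewrite sintB; [|by apply: lint_lbm; exact: lbmM|by apply: lintZ; exact: lint_lbm].
by rewrite sintZ ?/c ?divfK ?subrr // ?gt_eqF //; exact: lint_lbm.
Qed.

Let b0 : 0 <= b. Proof. by apply: le_trans (fb 0). Qed.

Let F_bound x : `|sint f 0 x| <= b * eps.
Proof.
have [n /andP[n0 n1]] := periodic_reduce x.
rewrite -(subrK (n%:~R * eps) x) (periodic_int _ _ F_per).
apply: (@le_trans _ _ (b * `|x - n%:~R * eps - 0|)); first exact: sint_bound.
by rewrite subr0 ger0_norm // ler_wpM2l // ltW.
Qed.

(** Periodicity reduces x to one cell, where the primitive from 0 is at most b eps; the weighted
    mean that is subtracted obeys the same bound. *)
Lemma pprim_bound x : `|pprim theta f x| <= 2 * eps * b.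
Proof.
apply: le_trans (ler_normB _ _) _.
suff : `|sint (fun s => theta s * sint f 0 s) 0 eps / sint theta 0 eps| <= b * eps.
  by have := F_bound x; lra.
rewrite normrM normfV (gtr0_norm I0) ler_pdivrMr //.
have ti : lint theta by exact: lint_lbm.
rewrite -sintZ //; apply: le_trans (sint_abs _ (ltW eps0)) _.
  by apply: lint_lbm; exact: lbmM.
apply: le_sint; [apply: lint_abs; apply: lint_lbm; exact: lbmM|exact: lintZ|exact: ltW|].
move=> s _; have t0 : 0 <= theta s by apply: le_trans (theta_lb s); exact: ltW.
by rewrite normrM (ger0_norm t0) mulrC ler_wpM2r.
Qed.

End PeriodicPrimitive.
End Periodic.

(** * Iterated time integrals of the deviation and the potential *)

Section Antiderivatives.
Variable R : realType.
Implicit Types (x y t s e d h k l b c B T N eta : R) (chi dm f : R -> R) (n : nat).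
Variables (A rho : R -> R) (w wx : R -> R -> R) (ab c00 m M : R).
Hypotheses (Al : lbm A) (rhol : lbm rho) (Arho : forall x, A x * rho x = 1).
Hypothesis sol : micro_solution A w wx.
Hypotheses (m0 : 0 < m) (rho_lb : forall x, m <= rho x) (rho_ub : forall x, rho x <= M).

Notation v := (v rho w ab c00).
Notation vx := (vx rho wx ab).
Notation flux := (flux A rho wx ab).
Notation potential := (potential A rho w wx ab c00).
Notation weak_flux_fun := (weak_flux_fun A rho wx ab).

Variables (s0 q0 : nat -> R -> R).
Hypotheses (s00 : forall x, s0 0 x = v x 0) (q00 : forall x, q0 0 x = 0)
  (s0_prim : forall n, prim (s0 n.+1) (fun x => q0 n x * rho x))
  (q0_prim : forall n, prim (q0 n.+1) (s0 n)).

(** The integration constants [s0], [q0] satisfy the space relations at time zero; integrating in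
    time then preserves these relations. That [q0 0] vanishes expresses that the motion starts at
    rest. *)
Fixpoint Sn n : R -> R -> R :=
  if n is n'.+1 then fun x t => s0 n x + sint (Sn n' x) 0 t else v.

(* [Qn n] is paired with [Sn n.+1]. *)
Fixpoint Qn n : R -> R -> R :=
  if n is n'.+1 then fun x t => q0 n.+1 x + sint (Qn n' x) 0 t else potential (q0 1 0).

Lemma Sn0 n x : Sn n x 0 = s0 n x.
Proof. by case: n => [|n] /=; rewrite ?s00 // sintxx addr0. Qed.

Lemma Qn0 n x : Qn n x 0 = q0 n.+1 x.
Proof.
case: n => [|n] /=; last by rewrite sintxx addr0.
rewrite potential0; have := q0_prim 0 0 x.
rewrite (eq_sint (g := v^~ 0)); first lra.
by move=> s _; exact: s00.
Qed.

Let vU : Ucont v. Proof. exact: (v_Ucont ab c00 rhol sol). Qed.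
Let QU : Ucont (Qn 0). Proof. exact: (potential_Ucont ab c00 Al rhol sol (q0 1 0)). Qed.

Let s1_cst x y : s0 1 y = s0 1 x.
Proof.
apply/eqP; rewrite -subr_eq0 s0_prim (eq_sint (g := fun=> 0)); first by rewrite sint_cst mul0r.
by move=> s _; rewrite q00 mul0r.
Qed.

Let v_ti x : lint (v x).
Proof. exact/lint_lbm/lbm_continuous/Ucont_time. Qed.

(** [s0 1] is constant in x, and the increments of [v] in x are of order the square root of |y - x|,
    uniformly on the time interval, by the L2 bound on [vx]. *)
Let S1_cont t : continuous ((Sn 1)^~ t).
Proof.
move=> x; apply/cont_epsP => e e0; pose B := `|x| + 1.
have [N N0 HN] := L2c_bounded B `|t| (vx_L2c ab rhol sol).
pose k := e / (`|t| + 1); have t1 : 0 < `|t| + 1 by have := normr_ge0 t; lra.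
have k0 : 0 < k by rewrite divr_gt0.
have N1 : 0 < N + 1 by lra.
exists (Num.min 1 (k ^+ 2 / (N + 1))); first by rewrite lt_min ltr01 divr_gt0 ?exprn_gt0.
move=> y; rewrite lt_min => /andP[y1 y2].
have yB : `|y| <= B by rewrite -(subrK x y); apply: le_trans (ler_normD _ _) _; rewrite /B; lra.
have xB : `|x| <= B by rewrite /B; lra.
rewrite /= (s1_cst x y) opprD addrACA subrr add0r -sintB //.
apply: (@le_trans _ _ (k * `|t - 0|)); last first.
  rewrite subr0 /k mulrAC ler_pdivrMr // ler_wpM2l ?ltW //; lra.
apply: sint_bound; first exact: lintB.
move=> s st; have sT : `|s| <= `|t|.
  case: (leP 0 t) st => h /andP[h1 h2]; first by rewrite !ger0_norm; lra.
  by rewrite (ltr0_norm h) ler0_norm; lra.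
rewrite (v_prim ab c00 rhol sol s).
have := sint_L2 (vx_L2l ab rhol sol s) xB yB => X.
have : sint (vx^~ s) x y ^+ 2 <= k ^+ 2.
  apply: le_trans X _; move: y2; rewrite ltr_pdivlMr // => y2.
  apply: le_trans (ler_wpM2l (normr_ge0 _) (HN s sT)) _; have := normr_ge0 (y - x); nra.
by rewrite -(real_normK (num_real (sint _ _ _))) ler_sqr // nnegrE ltW.
Qed.

Let S1_der : Uder (Sn 1) v. Proof. exact: Uder_int. Qed.

Let S1_U : Ucont (Sn 1).
Proof. by apply: Uder_Ucont S1_der S1_cont _ => t; exact: Ucont_lbm vU. Qed.

Lemma Sn1_Uder : Uder (Sn 1) v. Proof. exact: S1_der. Qed.

(** Each space relation is an identity between functions of time with equal values at 0 and equal
    time derivatives. For S_x = rho Q_t two time derivatives are needed, the second of them taken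
    weakly. *)
Let base : regular_pair rho (Sn 2) (Qn 1) (Sn 1) (Qn 0).
Proof.
have lQ t : lbm ((Qn 0)^~ t) by exact: Ucont_lbm QU.
have lS t : lbm ((Sn 1)^~ t) by exact: Ucont_lbm S1_U.
have lv t : lbm (v^~ t) by exact: Ucont_lbm vU.
have dS : Uder (Sn 2) (Sn 1) by exact: Uder_int.
have dQ : Uder (Qn 1) (Qn 0) by exact: Uder_int.
split => //.
- move=> t x y; pose g t := sint (fun x => 1 * Sn 1 x t) x y.
  have gE t' : g t' = sint ((Sn 1)^~ t') x y by apply: eq_sint => s _; rewrite mul1r.
  rewrite -gE.
  apply: (@eq_deriv _ (fun t => Qn 1 y t - Qn 1 x t) g (fun t => sint (fun x => 1 * v x t) x y)).
  + move=> s; have -> : sint (fun x => 1 * v x s) x y = Qn 0 y s - Qn 0 x s.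
      rewrite /= (potential_prim ab c00 rhol sol).
      by apply: eq_sint => z _; rewrite mul1r.
    by apply: is_deriveB; exact: Uder_is_derive.
  + by move=> s; exact: (sint_Uder x y s (lbm_cst 1)).
  + rewrite !Qn0 q0_prim gE; by apply: eq_sint => z _; rewrite Sn0.
- move=> t; have W x y : x <= y -> Sn 2 y t - Sn 2 x t = sint (fun x => rho x * Qn 0 x t) x y.
    (* Tested against [rho], the flux turns back into v_x because rho A = 1. *)
    move=> xy; have [dm [d1 d2 d3]] := (potential_weak_flux ab c00 Al rhol Arho sol (q0 1 0)).1 rho x y rhol xy.
    have S1E : (fun t => Sn 1 y t - Sn 1 x t) =1 dm.
      apply: eq_deriv (_ : forall t, is_derive t 1 _ (v y t - v x t)) _ _.
      - by move=> s; apply: is_deriveB; exact: Uder_is_derive.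
      - move=> s; have -> : v y s - v x s = weak_flux_fun rho x y s; last exact: d2.
        rewrite (v_prim ab c00 rhol sol); apply: eq_sint => z _.
        by rewrite /flux mulrA [rho z * _]mulrC Arho mul1r.
      - by rewrite d3 !Sn0 (s1_cst x y) subrr.
    apply: (@eq_deriv _ (fun t => Sn 2 y t - Sn 2 x t)
      (fun t => sint (fun x => rho x * Qn 0 x t) x y) dm) => //.
    + by move=> s; rewrite -S1E; apply: is_deriveB; exact: Uder_is_derive.
    + rewrite !Sn0 s0_prim; by apply: eq_sint => z _; rewrite -(Qn0 0) mulrC.
  move=> x y; rewrite (eq_sint (g := fun x => rho x * Qn 0 x t)); last by move=> z _; rewrite mulrC.
  have [/W//|/ltW/W E] := leP x y.
  by rewrite sint_rev -E opprB.
Qed.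

Lemma SQ_regular n : regular_pair rho (Sn n.+2) (Qn n.+1) (Sn n.+1) (Qn n).
Proof.
elim: n => [|n IH]; first exact: base.
have lQ t : lbm ((Qn n.+1)^~ t) := rp_lbmQ IH t.
have lS t : lbm ((Sn n.+2)^~ t) := rp_lbmS rhol IH t.
have lQ' t : lbm ((Qn n)^~ t) := rp_lbmQ' IH t.
have lS' t : lbm ((Sn n.+1)^~ t) := rp_lbmS' IH t.
have cQ : Ucont (Qn n.+1).
  by apply: Uder_Ucont (rp_dQ IH) _ lQ' => t; apply: prim_cont (rp_pQ IH t) _.
have cS : Ucont (Sn n.+2).
  apply: Uder_Ucont (rp_dS IH) _ lS' => t; apply: prim_cont (rp_pS IH t) _.
  exact: lbmM.
have dS : Uder (Sn n.+3) (Sn n.+2) by exact: Uder_int.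
have dQ : Uder (Qn n.+2) (Qn n.+1) by exact: Uder_int.
split => //.
- move=> t x y; pose g t := sint (fun x => 1 * Sn n.+2 x t) x y.
  have gE t' : g t' = sint ((Sn n.+2)^~ t') x y by apply: eq_sint => s _; rewrite mul1r.
  rewrite -gE.
  apply: (@eq_deriv _ (fun t => Qn n.+2 y t - Qn n.+2 x t) g (fun t => sint (fun x => 1 * Sn n.+1 x t) x y)).
  + move=> s; have -> : sint (fun x => 1 * Sn n.+1 x s) x y = Qn n.+1 y s - Qn n.+1 x s.
      by rewrite (rp_pQ IH); apply: eq_sint => z _; rewrite mul1r.
    by apply: is_deriveB; exact: Uder_is_derive.
  + by move=> s; apply: (sint_Uder x y s (lbm_cst 1)) => //; exact: rp_dS IH.
  + rewrite !Qn0 q0_prim gE; by apply: eq_sint => z _; rewrite Sn0.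
- move=> t x y; rewrite (eq_sint (g := fun x => rho x * Qn n.+1 x t)); last by move=> z _; rewrite mulrC.
  apply: (@eq_deriv _ (fun t => Sn n.+3 y t - Sn n.+3 x t)
    (fun t => sint (fun x => rho x * Qn n.+1 x t) x y) (fun t => sint (fun x => rho x * Qn n x t) x y)).
  + move=> s; have -> : sint (fun x => rho x * Qn n x s) x y = Sn n.+2 y s - Sn n.+2 x s.
      by rewrite (rp_pS IH); apply: eq_sint => z _; rewrite mulrC.
    by apply: is_deriveB; exact: Uder_is_derive.
  + by move=> s; apply: (sint_Uder x y s rhol) => //; exact: rp_dQ IH.
  + rewrite !Sn0 s0_prim; by apply: eq_sint => z _; rewrite Qn0 mulrC.
Qed.

Variables (eta : R) (b : nat -> R).
Hypotheses (eta0 : 0 < eta) (b0 : forall n, 0 < b n)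
  (s0b : forall n x, `|s0 n x| <= b n) (q0b : forall n x, `|q0 n x| <= b n).

Notation C := (energy_cst m M).
Notation cone := (cone m).

Definition moment chi n t := sint (fun x => chi x * Qn n x t) (- eta) eta.

Lemma moment_derive chi n t : lbm chi ->
  is_derive t 1 (moment chi n.+1) (moment chi n t).
Proof.
move=> cl; have RP := SQ_regular n.
exact: (sint_Uder (- eta) eta t cl (rp_lbmQ RP) (rp_lbmQ' RP) (rp_dQ RP)).
Qed.

Lemma moment0_derive chi : lbm chi -> exists dm : R -> R,
  [/\ forall t, is_derive t 1 (moment chi 0) (dm t),
      forall t, is_derive t 1 dm (sint (fun x => chi x * flux x t) (- eta) eta) &
      forall t, `|t| <= eta -> dm t ^+ 2 <= 40 * C * cone * eta * b 0 ^+ 2 *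
        sint (fun x => chi x ^+ 2) (- eta) eta].
Proof.
move=> cl; have eta0' := eta0; have ee : - eta <= eta by lra.
have WF := potential_weak_flux ab c00 Al rhol Arho sol (q0 1 0).
have [dm [d1 d2 _]] := WF.1 chi _ _ cl ee.
exists dm; split => // t te.
apply: (level0_bound m0 rho_lb rho_ub rhol (SQ_regular 0) Sn1_Uder vU WF) => //.
by move=> x; rewrite -s00.
Qed.

Lemma moment_bound chi n t : lbm chi -> `|t| <= eta ->
  moment chi n t ^+ 2 <= (32 * C * cone + 4) * eta * b n.+1 ^+ 2 *
    sint (fun x => chi x ^+ 2) (- eta) eta.
Proof.
move=> cl te; have RP := SQ_regular n; have eta0' := eta0.
have ee : - eta <= eta by lra.
apply: le_trans (L2l_CS ee (L2l_lbm cl) (L2l_lbm (rp_lbmQ' RP t))) _.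
rewrite mulrC ler_wpM2r //; first by apply: sint_ge0 => // x _; exact: sqr_ge0.
apply: (level_bound m0 rho_lb rho_ub rhol RP) => // x; first by rewrite Sn0.
by rewrite Qn0.
Qed.

End Antiderivatives.

(** * The HMM coefficient *)

Section Kernel.
Variable R : realType.
Implicit Types (x y t s e d h k l b c B T N eta tau : R) (f g : R -> R) (n i : nat).
Notation mu := (@lebesgue_measure R).

(** The values of the kernel at the ends of its interval are arbitrary; they form a null set, and a
    globally defined [g] can replace it. *)
Lemma Rintegral_eq_oo a b f g : a < b -> measurable_fun setT g ->
  (forall x, a < x < b -> f x = g x) -> \int[mu]_(x in `[a, b]) f x = sint g a b.
Proof.
move=> ab mg fg; have mgE (D : set R) : measurable D -> measurable_fun D (EFin \o g).
  by move=> mD; apply/measurable_EFinP; exact: measurable_funTS.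
have mf : measurable_fun `]a, b[ (EFin \o f).
  apply: (eq_measurable_fun (EFin \o g)); last exact: mgE.
  by move=> x /[!inE]/=; rewrite in_itv /= => xab; rewrite fg.
rewrite sint_le ?(ltW ab) // /Rintegral; congr fine.
rewrite integral_itv_bndoo // [RHS]integral_itv_bndoo; last exact: mgE.
by apply: eq_integral => x /[!inE]/=; rewrite in_itv /= => xab; rewrite fg.
Qed.

Lemma prim_scale (F f : R -> R) tau : 0 < tau -> continuous f -> prim F f ->
  prim (fun t => F (t / tau)) (fun t => tau^-1 * f (t / tau)).
Proof.
move=> tau0 cf pF; have sc : continuous (fun t : R => t / tau).
  by move=> t; apply: cvgM; [exact: cvg_id|exact: cvg_cst].
apply: FTC_all.
  move=> t; apply: cvgM; first exact: cvg_cst.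
  by apply: (@continuous_comp _ _ _ (fun t => t / tau) f); [exact: sc|exact: cf].
move=> t; have dF x : is_derive x 1 F (f x).
  have -> : F = (fun x => F 0 + sint f 0 x) by apply/funext => y; rewrite -pF; ring.
  have := is_deriveD (is_derive_cst (F 0) x 1) (sint0_is_derive x cf).
  by rewrite add0r.
have dS : is_derive t 1 (fun t => t / tau) tau^-1.
  apply: is_derive_eps => e e0; exists 1 => // h _.
  have -> : (t + h) / tau - t / tau - h * tau^-1 = 0 by ring.
  by rewrite normr0 mulr_ge0 // ltW.
rewrite [tau^-1 * _]mulrC.
exact: (@is_derive1_comp _ F (fun t => t / tau) t _ _ (dF _) dS).
Qed.

Variables (p q : nat) (K : R -> R).
Hypothesis hK : kernel_class p q K.

(** [K] is unconstrained outside (-1, 1). Cutting each derivative off by zero gives a continuous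
    function on the line, thanks to the vanishing limits at the ends. *)
Definition Kl i x := if (- 1 < x) && (x < 1) then K^`(i) x else 0.

Lemma Kl_in i x : - 1 < x -> x < 1 -> Kl i x = K^`(i) x.
Proof. by rewrite /Kl => -> ->. Qed.

Lemma Kl_ge i x : 1 <= x -> Kl i x = 0.
Proof. by rewrite /Kl leNgt andbC => /negbTE ->. Qed.

Lemma Kl_le i x : x <= -1 -> Kl i x = 0.
Proof. by rewrite /Kl leNgt => /negbTE ->. Qed.

Lemma Kder_cont i x : (i <= q)%N -> - 1 < x -> x < 1 -> {for x, continuous K^`(i)}.
Proof.
case: hK => K1 K2 _ _ _; rewrite leq_eqVlt => /predU1P[->|iq] x1 x2.
  by apply: K2; rewrite x1.
by apply: differentiable_continuous; apply/derivable1_diffP; apply: K1; rewrite ?x1.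
Qed.

Lemma Kl_cont i : (i <= q)%N -> continuous (Kl i).
Proof.
move=> iq x; have [_ _ /(_ i iq)[/cvgrPdist_le L1 /cvgrPdist_le L2] _ _] := hK.
apply/cont_epsP => e e0.
have [x1|x1] := ltP x (-1).
  exists (-1 - x); first lra.
  move=> y yx; rewrite !Kl_le ?subrr ?normr0; try lra.
  by have := ler_norm (y - x); lra.
have [x2|x2] := ltP 1 x.
  exists (x - 1); first lra.
  move=> y yx; rewrite !Kl_ge ?subrr ?normr0; try lra.
  by move: yx; rewrite distrC => yx; have := ler_norm (x - y); lra.
have [->|xn1] := eqVneq x (-1).
  have [d /= d0 Hd] := L1 e e0; exists (Num.min d 1); first by rewrite lt_min d0 ltr01.
  move=> y; rewrite lt_min => /andP[yd y1]; rewrite [Kl i (-1)]Kl_le // subr0.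
  have [ym|ym] := leP y (-1); first by rewrite Kl_le // normr0 ltW.
  rewrite Kl_in //; last by have := ler_norm (y - -1); lra.
  have := Hd y; rewrite /ball_ /= sub0r normrN; apply => //.
  by rewrite distrC.
have [->|xn2] := eqVneq x 1.
  have [d /= d0 Hd] := L2 e e0; exists (Num.min d 1); first by rewrite lt_min d0 ltr01.
  move=> y; rewrite lt_min => /andP[yd y1]; rewrite [Kl i 1]Kl_ge // subr0.
  have [ym|ym] := leP 1 y; first by rewrite Kl_ge // normr0 ltW.
  rewrite Kl_in //; last by have := ler_norm (1 - y); rewrite distrC; lra.
  have := Hd y; rewrite /ball_ /= sub0r normrN; apply => //.
  by rewrite distrC.
have x1' : -1 < x by rewrite lt_def xn1.
have x2' : x < 1 by rewrite lt_def eq_sym xn2.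
have [d d0 Hd] := (cont_epsP _ _).1 (Kder_cont iq x1' x2') e e0.
exists (Num.min d (Num.min (x + 1) (1 - x))); first by rewrite !lt_min d0; apply/andP; split; lra.
move=> y; rewrite !lt_min => /and3P[yd y1 y2].
have y3 : -1 < y by move: y1; rewrite distrC => y1; have := ler_norm (x - y); lra.
have y4 : y < 1 by have := ler_norm (y - x); lra.
by rewrite !Kl_in //; exact: Hd.
Qed.

Lemma Kl_lbm i : (i <= q)%N -> lbm (Kl i).
Proof. by move=> iq; apply: lbm_continuous; exact: Kl_cont. Qed.

Lemma Kl_derive i x : (i < q)%N -> - 1 < x -> x < 1 -> is_derive x 1 (Kl i) (Kl i.+1 x).
Proof.
move=> iq x1 x2; have [K1 _ _ _ _] := hK.
have D : is_derive x 1 K^`(i) (K^`(i.+1) x).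
  by apply: DeriveDef; [apply: K1; rewrite ?x1|rewrite /= derive1E].
apply: is_derive_eps => e e0; have [d d0 Hd] := is_derive_epsP D e0.
exists (Num.min d (Num.min (x + 1) (1 - x))); first by rewrite !lt_min d0; apply/andP; split; lra.
move=> h; rewrite !lt_min => /and3P[hd h1 h2].
have h3 := ler_norm h; have h4 := ler_norm (- h); rewrite normrN in h4.
rewrite !Kl_in //; try lra.
exact: Hd.
Qed.

(** No derivative is claimed at the points -1 and 1: [H] is constant on [-1, 1] by continuity and
    the mean value theorem, and outside both of its terms stop changing. *)
Lemma Kl_prim i : (i < q)%N -> prim (Kl i) (Kl i.+1).
Proof.
move=> iq; have c0 := Kl_cont (ltnW iq); have c1 := Kl_cont iq.
have ci := lint_lbm (Kl_lbm iq).
pose H x := Kl i x - sint (Kl i.+1) 0 x.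
have Hc : continuous H.
  by move=> x; apply: cvgB; [exact: c0|exact: sint_cont].
have Hin x y : -1 <= x -> x < y -> y <= 1 -> H y = H x.
  move=> x1 xy y1.
  have dH z : z \in `]x, y[%R -> is_derive z 1 H 0.
    rewrite in_itv /= => /andP[z1 z2].
    have [z3 z4] : -1 < z /\ z < 1 by split; lra.
    by have := is_deriveB (Kl_derive iq z3 z4) (sint0_is_derive z c1); rewrite subrr.
  have [|z _] := MVT xy dH; first exact: continuous_subspaceT.
  by rewrite mul0r => /eqP; rewrite subr_eq0 => /eqP.
have H0 x : H x = H 0.
  have [xm|xm] := leP x (-1).
    rewrite (@Hin (-1) 0) //; try lra.
    rewrite /H !Kl_le // -(@sint_chasles _ _ 0 (-1) x ci).
    rewrite (@eq_sint _ (Kl i.+1) (fun=> 0) (-1) x) ?sint_cst ?mul0r ?addr0 //.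
    by move=> s; rewrite min_r // max_l // => /andP[_ s1]; exact: Kl_le.
  have [xp|xp] := leP 1 x.
    rewrite -(@Hin 0 1) //; try lra.
    rewrite /H !Kl_ge // -(@sint_chasles _ _ 0 1 x ci).
    rewrite (@eq_sint _ (Kl i.+1) (fun=> 0) 1 x) ?sint_cst ?mul0r ?addr0 //.
    by move=> s; rewrite min_l // max_r // => /andP[s1 _]; exact: Kl_ge.
  have [x0|x0|-> //] := ltgtP x 0; first by rewrite (@Hin x 0) //; lra.
  by rewrite (@Hin 0 x) //; lra.
have KE x : Kl i x = sint (Kl i.+1) 0 x + H 0 by rewrite -(H0 x) /H subrKC.
move=> x y; rewrite !KE -(@sint_chasles _ _ 0 x y ci).
by move: (sint _ 0 x) (sint _ x y) (H 0) => c2 c3 c4; ring.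
Qed.

Definition Ks tau i t := Kl i (t / tau).

Lemma Ks_cont tau i : (i <= q)%N -> continuous (Ks tau i).
Proof.
move=> iq t; apply: (@continuous_comp _ _ _ (fun t => t / tau) (Kl i)); last exact: Kl_cont.
by apply: cvgM; [exact: cvg_id|exact: cvg_cst].
Qed.

Lemma Kl_int : sint (Kl 0) (-1) 1 = 1.
Proof.
have [_ _ _ E _] := hK; rewrite -[RHS]E; apply/esym/Rintegral_eq_oo; first lra.
  by have [] := Kl_lbm (leq0n q).
by move=> x /andP[x1 x2]; rewrite Kl_in.
Qed.

Lemma Ks_int tau : 0 < tau -> sint (Ks tau 0) (- tau) tau = tau.
Proof.
move=> tau0; have c0 := Kl_cont (leq0n q); have ci := lint_lbm (Kl_lbm (leq0n q)).
have P : prim (sint (Kl 0) 0) (Kl 0).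
  by move=> x y; rewrite -(@sint_chasles _ _ 0 x y ci); ring.
have := prim_scale tau0 c0 P (- tau) tau.
rewrite mulNr mulfV ?gt_eqF // P Kl_int.
rewrite (@sintZ _ _ (Ks tau 0)); last exact/lint_lbm/lbm_continuous/Ks_cont.
by move=> /(congr1 ( *%R tau)); rewrite mulr1 mulVKf ?gt_eqF.
Qed.

(** Every integration by parts differentiates the kernel once, at the price -1 / tau, and loses its
    boundary terms since each cut-off derivative vanishes at the ends. *)
Lemma Ks_ibp (T : nat -> R -> R) tau i : 0 < tau ->
  (forall n, continuous (T n)) -> (forall n t, is_derive t 1 (T n.+1) (T n t)) ->
  (i <= q)%N ->
  sint (fun t => Ks tau 0 t * T 0 t) (- tau) tau =
  (- tau^-1) ^+ i * sint (fun t => Ks tau i t * T i t) (- tau) tau.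
Proof.
move=> tau0 Tc Td; elim: i => [|i IH] iq; first by rewrite expr0 mul1r.
rewrite IH ?(ltnW iq) // exprSr -mulrA; congr (_ * _).
have Pk : prim (Ks tau i) (fun t => tau^-1 * Ks tau i.+1 t).
  by apply: (prim_scale tau0); [exact: Kl_cont|exact: Kl_prim].
have Pt : prim (T i.+1) (T i) by exact: FTC_all.
have l1 n : lbm (T n) by exact: lbm_continuous.
have l2 : lbm (Ks tau i) by apply/lbm_continuous/Ks_cont; exact: ltnW.
have l3 : lbm (Ks tau i.+1) by apply/lbm_continuous/Ks_cont.
have l4 : lbm (fun t => tau^-1 * Ks tau i.+1 t) by apply: lbmM => //; exact: lbm_cst.
have := prim_mul Pk Pt l4 (l1 i) (- tau) tau.
have -> : Ks tau i tau = 0 by rewrite /Ks mulfV ?gt_eqF // Kl_ge.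
have -> : Ks tau i (- tau) = 0 by rewrite /Ks mulNr mulfV ?gt_eqF // Kl_le.
rewrite !mul0r subrr sintD; [|by apply: lint_lbm; exact: lbmM|by apply: lint_lbm; exact: lbmM].
have -> : sint (fun s => tau^-1 * Ks tau i.+1 s * T i.+1 s) (- tau) tau =
   tau^-1 * sint (fun s => Ks tau i.+1 s * T i.+1 s) (- tau) tau.
  rewrite -sintZ; last by apply: lint_lbm; exact: lbmM.
  by apply: eq_sint => s _; rewrite mulrA.
by rewrite mulNr => /eqP; rewrite eq_sym addrC addr_eq0 => /eqP.
Qed.

Lemma Kl_bound i : (i <= q)%N -> exists2 N, 0 < N & forall x, `|Kl i x| <= N.
Proof.
move=> iq; have [N N0 HN] := cont_bounded 1 (Kl_cont iq).
exists (N + 1) => [|x]; first lra.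
have [x1|/ltW x1] := leP `|x| 1; first by have := HN x x1; lra.
move: x1; rewrite ler_normr => /orP[x1|x1]; first by rewrite Kl_ge // normr0; lra.
by rewrite Kl_le ?normr0; lra.
Qed.

End Kernel.

Section HMM.
Variable R : realType.
Implicit Types (x y t s e d h k l b c T N eta tau eps : R) (f g : R -> R) (n i : nat).
Notation mu := (@lebesgue_measure R).

Lemma le_of_sqr (x y : R) : 0 <= y -> x ^+ 2 <= y ^+ 2 -> `|x| <= y.
Proof. by move=> y0; rewrite -(real_normK (num_real x)) ler_sqr // nnegrE. Qed.

Section Coefficient.
Variable a : R -> R.
Hypothesis ha : admissible_coef a.

Definition a_inf := inf (range a).
Definition a_sup := sup (range a).

Lemma a_inf_gt0 : 0 < a_inf. Proof. by case: ha. Qed.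

Lemma a_ge y : a_inf <= a y.
Proof.
have [_ _ a0 _] := ha; apply: ge_inf; last by exists y.
(* Without a lower bound the infimum would take its default value 0, against its positivity. *)
apply: contrapT => nlb; move: a0; rewrite inf_out ?ltxx // => -[_ lb]; exact: nlb.
Qed.

Lemma a_le y : a y <= a_sup.
Proof. by have [_ _ _ ub] := ha; apply: ub_le_sup => //; exists y. Qed.

Lemma a_gt0 y : 0 < a y.
Proof. exact: lt_le_trans a_inf_gt0 (a_ge y). Qed.

Lemma a_sup_gt0 : 0 < a_sup.
Proof. exact: lt_le_trans (a_gt0 0) (a_le 0). Qed.

Definition inva y := (a y)^-1.

Lemma inva_ge y : a_sup^-1 <= inva y.
Proof. by rewrite lef_pV2 ?posrE ?a_gt0 ?a_sup_gt0 ?a_le. Qed.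

Lemma inva_le y : inva y <= a_inf^-1.
Proof. by rewrite lef_pV2 ?posrE ?a_gt0 ?a_inf_gt0 ?a_ge. Qed.

Lemma inva_gt0 y : 0 < inva y. Proof. by rewrite invr_gt0 a_gt0. Qed.

(** Inversion is discontinuous at 0; on the range of [a] it agrees with the continuous function
    [g]. *)
Lemma inva_meas : measurable_fun setT inva.
Proof.
pose g y := (a_inf + pos (y - a_inf))^-1.
have pc : continuous (fun y : R => pos (y - a_inf)).
  move=> y; apply: (@continuous_comp _ _ _ (fun y : R => y - a_inf) (@pos R)); last exact: pos_cont.
  by apply: cvgB; [exact: cvg_id|exact: cvg_cst].
have gc : continuous g.
  move=> y; apply: cvgV; first by rewrite gt_eqF // ltr_pwDl ?a_inf_gt0 ?pos_ge0.
  by apply: cvgD; [exact: cvg_cst|exact: pc].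
have -> : inva = g \o a.
  apply/funext => y; rewrite /inva /g /= /pos max_r ?subr_ge0 ?a_ge //; congr (_ ^-1); ring.
by apply: measurableT_comp; [exact: continuous_measurable_fun|case: ha].
Qed.

Lemma abarE : abar a = (sint inva 0 1)^-1.
Proof. by rewrite /abar sint_le. Qed.

Lemma inva_lbm : lbm inva.
Proof.
split; first exact: inva_meas.
by move=> B; exists a_inf^-1 => x _; rewrite gtr0_norm ?inva_gt0 // inva_le.
Qed.

Lemma inva_int_gt0 : 0 < sint inva 0 1.
Proof.
apply: (@lt_le_trans _ _ (sint (fun=> a_sup^-1) 0 1)).
  by rewrite sint_cst subr0 mulr1 invr_gt0 a_sup_gt0.
apply: le_sint; [exact/lint_lbm/lbm_cst|exact/lint_lbm/inva_lbm|exact: ler01|].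
by move=> s _; exact: inva_ge.
Qed.

Lemma abar_gt0 : 0 < abar a.
Proof. by rewrite abarE invr_gt0 inva_int_gt0. Qed.

Section Micro.
Variables (eps Xc : R).
Hypothesis eps0 : 0 < eps.

Definition cellA x := a_eps a eps (Xc + x).
Definition cellrho x := (cellA x)^-1.

Lemma cellrhoE x : cellrho x = inva (eps^-1 * x + Xc / eps).
Proof. by rewrite /cellrho /cellA /a_eps /inva; congr ((a _)^-1); ring. Qed.

Let affine_cont : continuous (fun x => eps^-1 * x + Xc / eps).
Proof.
move=> x; apply: cvgD; last exact: cvg_cst.
by apply: cvgM; [exact: cvg_cst|exact: cvg_id].
Qed.

Lemma cellA_lbm : lbm cellA.
Proof.
split.
  have -> : cellA = a \o (fun x => eps^-1 * x + Xc / eps).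
    by apply/funext => x; rewrite /cellA /a_eps /=; congr (a _); ring.
  by apply: measurableT_comp; [case: ha|exact: continuous_measurable_fun].
by move=> B; exists a_sup => x _; rewrite gtr0_norm ?a_gt0 ?a_le.
Qed.

Lemma cellrho_lbm : lbm cellrho.
Proof.
split.
  have -> : cellrho = inva \o (fun x => eps^-1 * x + Xc / eps).
    by apply/funext => x; rewrite cellrhoE.
  by apply: measurableT_comp; [exact: inva_meas|exact: continuous_measurable_fun].
by move=> B; exists a_inf^-1 => x _; rewrite cellrhoE gtr0_norm ?inva_gt0 ?inva_le.
Qed.

Lemma cellrho_ge x : a_sup^-1 <= cellrho x. Proof. by rewrite cellrhoE inva_ge. Qed.
Lemma cellrho_le x : cellrho x <= a_inf^-1. Proof. by rewrite cellrhoE inva_le. Qed.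
Lemma cellrho_gt0 x : 0 < cellrho x. Proof. by rewrite cellrhoE inva_gt0. Qed.
Lemma cellA_rho x : cellA x * cellrho x = 1.
Proof. by rewrite /cellrho mulfV // gt_eqF // a_gt0. Qed.

Lemma cellrho_periodic : periodic_of eps cellrho.
Proof.
move=> x; rewrite /cellrho /cellA /a_eps; congr (_ ^-1); have [_ per _ _] := ha.
by rewrite -[RHS]per; congr (a _); field; rewrite gt_eqF.
Qed.

(** This is where the harmonic mean enters: it is the constant flux for which the steady state gains
    exactly eps per cell, as the initial datum x does. *)
Lemma cellrho_int : abar a * sint cellrho 0 eps = eps.
Proof.
have k0 : 0 < eps^-1 by rewrite invr_gt0.
have := @sint_affine_ge0 R eps^-1 (Xc / eps) 0 eps inva k0 inva_meas (fun s => ltW (inva_gt0 s)).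
rewrite mulr0 add0r mulVf ?gt_eqF // [1 + _]addrC.
have per : periodic_of 1 inva by move=> y; rewrite /inva; have [_ -> _ _] := ha.
rewrite (@periodic_sint _ _ inva (a_inf^-1)) //; first last.
- by move=> s; rewrite gtr0_norm ?inva_gt0 ?inva_le.
- exact: inva_meas.
move=> E; have -> : sint cellrho 0 eps = eps * sint inva 0 1.
  rewrite E mulVKf ?gt_eqF //; apply: eq_sint => s _; exact: cellrhoE.
by rewrite abarE mulrCA mulVf ?mulr1 // gt_eqF // inva_int_gt0.
Qed.

(** The derivative of the initial deviation x - W0. *)
Definition defect x := 1 - abar a * cellrho x.

(** The constants ([s0], [q0]). The first component is integrated next as it stands, hence the
    weight 1; the second is multiplied by [cellrho] before its integration, hence that weight. *)
Fixpoint sq n : (R -> R) * (R -> R) :=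
  if n is n'.+1 then
    (pprim eps (fun=> 1) (fun x => (sq n').2 x * cellrho x), pprim eps cellrho (sq n').1)
  else (pprim eps (fun=> 1) defect, fun=> 0).

(** A normalised primitive costs 2 eps, and multiplication by [cellrho] at most [a_inf^-1]; the sum
    covers both kinds of step. [c3] bounds the defect. *)
Definition c2 := 2 * (a_inf^-1 + 1).
Definition c3 := 1 + abar a * a_inf^-1.
Definition bseq n := c3 * (c2 * eps) ^+ n.+1.

Lemma bseq_gt0 n : 0 < bseq n.
Proof.
have M0 : 0 < a_inf^-1 by rewrite invr_gt0 a_inf_gt0.
rewrite /bseq /c3 /c2; apply: mulr_gt0.
  by have := mulr_gt0 abar_gt0 M0; lra.
by apply: exprn_gt0; apply: mulr_gt0 => //; lra.
Qed.

Let defectl : lbm defect.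
Proof.
by apply: lbmB; [exact: lbm_cst|apply: lbmM; [exact: lbm_cst|exact: cellrho_lbm]].
Qed.

Let defect_per : periodic_of eps defect.
Proof. by move=> x; rewrite /defect cellrho_periodic. Qed.

Let defect_mean : sint defect 0 eps = 0.
Proof.
have r := lint_lbm cellrho_lbm.
rewrite /defect sintB; [|exact/lint_lbm/lbm_cst|exact: lintZ].
by rewrite sint_cst sintZ // cellrho_int; ring.
Qed.

Let defect_bound x : `|defect x| <= c3.
Proof.
rewrite /defect /c3; apply: le_trans (ler_normB _ _) _; rewrite normr1 lerD2l normrM.
by rewrite !gtr0_norm ?abar_gt0 ?cellrho_gt0 // ler_pM2l ?abar_gt0 // cellrho_le.
Qed.

Let one_lb x : (1 : R) <= 1. Proof. by []. Qed.
Let m0 : 0 < a_sup^-1. Proof. by rewrite invr_gt0 a_sup_gt0. Qed.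

Lemma sq_inv n : [/\ lbm (sq n).1 /\ lbm (sq n).2,
   periodic_of eps (sq n).1 /\ periodic_of eps (sq n).2,
   sint (sq n).1 0 eps = 0, sint (fun x => cellrho x * (sq n).2 x) 0 eps = 0 &
   forall x, `|(sq n).1 x| <= bseq n /\ `|(sq n).2 x| <= bseq n].
Proof.
have M0 : 0 < a_inf^-1 by rewrite invr_gt0 a_inf_gt0.
elim: n => [|n [[l1 l2] [p1 p2] i1 i2 b12]] /=.
  split.
  - by split; [exact: pprim_lbm|exact: lbm_cst].
  - by split => //; exact: (pprim_periodic (fun=> 1) defectl defect_per defect_mean defect_bound).
  - have := pprim_mean eps0 ltr01 (lbm_cst 1) one_lb defectl => E.
    by rewrite -[RHS]E; apply: eq_sint => s _; rewrite mul1r.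
  - rewrite (@eq_sint _ _ (fun=> 0)); first by rewrite sint_cst mul0r.
    by move=> s _; rewrite mulr0.
  - move=> x; rewrite normr0 (ltW (bseq_gt0 0)); split => //.
    apply: le_trans (pprim_bound eps0 ltr01 (lbm_cst 1) one_lb defectl defect_per defect_mean defect_bound x) _.
    have c30 : 0 <= c3 by apply: le_trans (defect_bound 0).
    rewrite /bseq expr1 /c2; have := mulr_ge0 c30 (ltW eps0); have := mulr_ge0 (mulr_ge0 c30 (ltW eps0)) (ltW M0); lra.
have fl : lbm (fun x => (sq n).2 x * cellrho x) by apply: lbmM => //; exact: cellrho_lbm.
have fp : periodic_of eps (fun x => (sq n).2 x * cellrho x).
  by move=> x; rewrite p2 cellrho_periodic.
have fm : sint (fun x => (sq n).2 x * cellrho x) 0 eps = 0.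
  by rewrite -[RHS]i2; apply: eq_sint => s _; rewrite mulrC.
have fb x : `|(sq n).2 x * cellrho x| <= bseq n * a_inf^-1.
  rewrite normrM; apply: ler_pM => //; first by case: (b12 x).
  by rewrite gtr0_norm ?cellrho_gt0 // cellrho_le.
have gb x : `|(sq n).1 x| <= bseq n by case: (b12 x).
have be : 0 <= bseq n * eps by apply: mulr_ge0; apply: ltW => //; exact: bseq_gt0.
have bE : bseq n.+1 = c2 * eps * bseq n by rewrite /bseq [in LHS]exprS; ring.
split.
- by split; exact: pprim_lbm.
- split; first exact: (pprim_periodic (fun=> 1) fl fp fm fb).
  exact: (pprim_periodic cellrho l1 p1 i1 gb).
- have := pprim_mean eps0 ltr01 (lbm_cst 1) one_lb fl => E.
  by rewrite -[RHS]E; apply: eq_sint => s _; rewrite mul1r.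
- exact: (pprim_mean eps0 m0 cellrho_lbm cellrho_ge l1).
- move=> x; rewrite bE; split.
    apply: le_trans (pprim_bound eps0 ltr01 (lbm_cst 1) one_lb fl fp fm fb x) _.
    by rewrite /c2; have := mulr_ge0 be (ltW M0); lra.
  apply: le_trans (pprim_bound eps0 m0 cellrho_lbm cellrho_ge l1 p1 i1 gb x) _.
  by rewrite /c2; have := mulr_ge0 be (ltW M0); lra.
Qed.

Lemma sq_prim1 n : prim (sq n.+1).1 (fun x => (sq n).2 x * cellrho x).
Proof.
have [[l1 l2] _ _ _ _] := sq_inv n.
by apply: pprim_prim; apply: lbmM => //; exact: cellrho_lbm.
Qed.

Lemma sq_prim2 n : prim (sq n.+1).2 (sq n).1.
Proof. by have [[l1 l2] _ _ _ _] := sq_inv n; exact: pprim_prim. Qed.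

Definition c00 := - (sint (fun s => 1 * sint defect 0 s) 0 eps / sint (fun=> 1) 0 eps).

Lemma sq0 x : (sq 0).1 x = x - W0 cellrho (abar a) (- c00) x.
Proof.
rewrite /= /pprim /W0 /c00 opprK; have r := lint_lbm cellrho_lbm.
have -> : sint defect 0 x = x - sint (fun s => abar a * cellrho s) 0 x.
  by rewrite /defect sintB ?sint_cst; [ring|exact/lint_lbm/lbm_cst|exact: lintZ].
by move: (sint _ 0 x) (_ / _) => u1 u2; ring.
Qed.

End Micro.

(** Large enough for both the factor 40 of the lowest level and the 32 and 4 of the levels above. *)
Definition lev := 40 * energy_cst a_sup^-1 a_inf^-1 * cone a_sup^-1 + 4.

Variables (p q : nat) (K : R -> R).
Hypothesis hK : kernel_class p q K.

Lemma lev_ge : 1 <= lev.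
Proof.
have m0 : 0 < a_sup^-1 by rewrite invr_gt0 a_sup_gt0.
have lb : forall x, a_sup^-1 <= inva x := inva_ge.
have ub : forall x, inva x <= a_inf^-1 := inva_le.
have C0 := energy_cst_gt0 m0 lb ub; have c0 := cone_gt0 m0.
have : 0 <= 40 * energy_cst a_sup^-1 a_inf^-1 * cone a_sup^-1.
  by apply: mulr_ge0; [apply: mulr_ge0 => //|]; exact: ltW.
by rewrite /lev; lra.
Qed.

(** A wx is the constant [abar a] plus the flux of the deviation, and the kernels have mean 1; so
    the constant is reproduced exactly. *)
Lemma hmm_reduction eps eta Xc alpha w wx : 0 < eps -> 0 < eta ->
  micro_solution (cellA eps Xc) w wx ->
  alpha = (eta * eta)^-1 * \int[mu]_(t in `[- eta, eta]) (\int[mu]_(x in `[- eta, eta])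
    (K (x / eta) * K (t / eta) * cellA eps Xc x * wx x t)) ->
  alpha = abar a + (eta * eta)^-1 * sint (fun t => Ks K eta 0 t *
    sint (fun x => Ks K eta 0 x * flux (cellA eps Xc) (cellrho eps Xc) wx (abar a) x t)
      (- eta) eta) (- eta) eta.
Proof.
move=> eps0 eta0 sol ->; set A := cellA eps Xc; set rho := cellrho eps Xc.
have Al : lbm A by exact: cellA_lbm.
have rhol : lbm rho by exact: cellrho_lbm.
have Arho x : A x * rho x = 1 by exact: cellA_rho.
pose psi := Ks K eta 0.
have psic : continuous psi by exact: (Ks_cont hK).
have psil := lbm_continuous psic.
have ee : - eta < eta by lra.
have Fc := flux_L2c (abar a) Al rhol sol.
set fl := flux A rho wx (abar a) in Fc *.
pose G t := sint (fun x => psi x * fl x t) (- eta) eta.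
pose Gw t := sint (fun x => psi x * (A x * wx x t)) (- eta) eta.
have AwL t : L2l (fun x => A x * wx x t) by apply: L2lM => //; exact: wx_L2l sol t.
have psi_in x : - eta < x < eta -> psi x = K (x / eta).
  move=> /andP[x1 x2]; rewrite /psi /Ks Kl_in //; first by rewrite ltr_pdivlMr // mulN1r.
  by rewrite ltr_pdivrMr // mul1r.
have inner t : \int[mu]_(x in `[- eta, eta]) (K (x / eta) * K (t / eta) * A x * wx x t) =
    K (t / eta) * Gw t.
  rewrite (@Rintegral_eq_oo _ _ _ _ (fun x => K (t / eta) * (psi x * (A x * wx x t)))) //.
  - by rewrite sintZ //; apply: lint_mul => //; exact: L2l_lint.
  - apply: measurable_funM; first exact: measurable_cst.
    by apply: measurable_funM; [case: psil|case: (AwL t)].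
  - by move=> x /psi_in ->; ring.
have GwE t : Gw t = G t + abar a * eta.
  have -> : abar a * eta = sint (fun x => abar a * psi x) (- eta) eta.
    by rewrite sintZ ?(Ks_int hK) //; exact: lint_lbm.
  rewrite -sintD; [|by apply: lint_mul => //; exact: L2l_lint (Fc.1 t)|exact/lintZ/lint_lbm].
  apply: eq_sint => x _; rewrite /fl /flux /vx.
  have -> : psi x * (A x * (wx x t - abar a * rho x)) + abar a * psi x =
    psi x * (A x * wx x t) + abar a * psi x * (1 - A x * rho x) by ring.
  by rewrite Arho subrr mulr0 addr0.
have Gc : continuous G.
  exact: (@L2c_sint_cont _ (fun x t => psi x * fl x t)) (L2c_mul psil Fc).
have Gl := lbm_continuous Gc.
rewrite (@Rintegral_eq_oo _ _ _ _ (fun t => psi t * G t + abar a * eta * psi t)) //.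
- rewrite sintD; [|by apply: lint_lbm; exact: lbmM|exact/lintZ/lint_lbm].
  rewrite sintZ; last exact: lint_lbm.
  rewrite (Ks_int hK) // -/psi -/G; move: (sint _ _ _) => z.
  by field; rewrite gt_eqF.
- by apply: (lbmD _ _).1; apply: lbmM => //; exact: lbm_cst.
- by move=> t teta; rewrite inner GwE (psi_in t teta); ring.
Qed.

Lemma hmm_estimate : (0 < q)%N -> exists2 C, 0 < C &
  forall eps eta Xc alpha, 0 < eps -> 0 < eta -> hmm_coef a K eps eta eta Xc alpha ->
  `|abar a - alpha| <= C * (eps / eta) ^+ q.
Proof.
move=> q0; have [N0 N00 HN0] := Kl_bound hK (leq0n q).
have [Nq Nq0 HNq] := Kl_bound hK (leqnn q).
have L1 := lev_ge; have ab0 := abar_gt0.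
have M0 : 0 < a_inf^-1 by rewrite invr_gt0 a_inf_gt0.
have m0 : 0 < a_sup^-1 by rewrite invr_gt0 a_sup_gt0.
pose c1 := lev * 2 * N0 ^+ 2 + 1.
have LN : 0 <= lev * 2 * N0 ^+ 2 by rewrite mulr_ge0 ?sqr_ge0 //; lra.
have c10 : 0 < c1 by rewrite /c1; lra.
have c20 : 0 < c2 by rewrite /c2; lra.
have c30 : 0 < c3 by have := mulr_gt0 ab0 M0; rewrite /c3; lra.
exists (2 * Nq * c1 * c3 * c2 ^+ q).
  by rewrite !mulr_gt0 // exprn_gt0.
move=> eps eta Xc alpha eps0 eta0 [w [wx [sol alphaE]]].
rewrite (hmm_reduction eps0 eta0 sol alphaE) opprD addrA subrr add0r normrN.
pose A := cellA eps Xc; pose rho := cellrho eps Xc.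
have Al : lbm A by exact: cellA_lbm.
have rhol : lbm rho by exact: cellrho_lbm.
have Arho x : A x * rho x = 1 by exact: cellA_rho.
have rlb x : a_sup^-1 <= rho x by exact: cellrho_ge.
have rub x : rho x <= a_inf^-1 by exact: cellrho_le.
pose psi := Ks K eta 0.
have psic : continuous psi by exact: (Ks_cont hK).
have psil := lbm_continuous psic.
have ee : - eta <= eta by lra.
pose s0 n := (sq eps Xc n).1; pose q_ n := (sq eps Xc n).2.
pose cc := - c00 eps Xc.
have s00 x : s0 0 x = v rho w (abar a) cc x 0.
  by rewrite /s0 sq0 (v0E _ _ _ sol).
have q00 x : q_ 0 x = 0 by [].
have sp n : prim (s0 n.+1) (fun x => q_ n x * rho x) by exact: sq_prim1.
have qp n : prim (q_ n.+1) (s0 n) by exact: sq_prim2.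
have sb n x : `|s0 n x| <= bseq eps n.
  by have [_ _ _ _ B] := sq_inv Xc eps0 n; case: (B x).
have qb n x : `|q_ n x| <= bseq eps n.
  by have [_ _ _ _ B] := sq_inv Xc eps0 n; case: (B x).
have b0 n : 0 < bseq eps n by exact: bseq_gt0.
have [dm [dm1 dm2 dm3]] := @moment0_derive _ _ _ _ _ _ _ _ _ Al rhol Arho sol m0 rlb rub
   s0 q_ s00 q00 sp qp eta (bseq eps) eta0 b0 sb psi psil.
pose mom n := moment A rho w wx (abar a) cc q_ eta psi n.
pose fl t := sint (fun x => psi x * flux A rho wx (abar a) x t) (- eta) eta.
(* A chain of time antiderivatives of the averaged flux: the flux is the second weak derivative of
   the potential, so [dm] and the moment of the potential precede the moments of its own time
   integrals. *)
pose T n := match n with 0%N => fl | 1%N => dm | n.+2 => mom n end.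
have flc : continuous fl.
  exact: (@L2c_sint_cont _ (fun x t => psi x * flux A rho wx (abar a) x t))
    (L2c_mul psil (flux_L2c (abar a) Al rhol sol)).
have Td n t : is_derive t 1 (T n.+1) (T n t).
  case: n => [|[|n]]; [exact: dm2|exact: dm1|].
  exact: (moment_derive Al rhol Arho sol s00 q00 sp qp).
have Tc n : continuous (T n).
  by case: n => [|n]; [exact: flc|move=> t; exact: is_derive_cont (Td n t)].
have psi2 : sint (fun x => psi x ^+ 2) (- eta) eta <= 2 * eta * N0 ^+ 2.
  by apply: sint_sq_le => //; [exact: ltW|move=> x _; exact: HN0].
have psi20 : 0 <= sint (fun x => psi x ^+ 2) (- eta) eta.
  by apply: sint_ge0 => // x _; exact: sqr_ge0.
have Tb n t : `|t| <= eta -> `|T n.+1 t| <= c1 * (eta * bseq eps n).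
  move=> te; have bn := b0 n; have eb : 0 < eta * bseq eps n by exact: mulr_gt0.
  apply: le_of_sqr; first by rewrite mulr_ge0 // ltW.
  have X : T n.+1 t ^+ 2 <= lev * eta * bseq eps n ^+ 2 * sint (fun x => psi x ^+ 2) (- eta) eta.
    have C0 := energy_cst_gt0 m0 rlb rub; have cn0 := cone_gt0 m0.
    have CC : 0 < energy_cst a_sup^-1 a_inf^-1 * cone a_sup^-1 by exact: mulr_gt0.
    case: n bn eb => [|n] bn eb.
      apply: le_trans (dm3 t te) _; apply: ler_wpM2r => //; apply: ler_wpM2r; first exact: sqr_ge0.
      by apply: ler_wpM2r; [exact: ltW|rewrite /lev; lra].
    apply: le_trans (moment_bound Al rhol Arho sol m0 rlb rub s00 q00 sp qp eta0 b0 sb qb n psil te) _.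
    apply: ler_wpM2r => //; apply: ler_wpM2r; first exact: sqr_ge0.
    by apply: ler_wpM2r; [exact: ltW|rewrite /lev; lra].
  apply: le_trans X _.
  have l0 : 0 <= lev * eta * bseq eps n ^+ 2.
    by rewrite mulr_ge0 ?sqr_ge0 // mulr_ge0 ?(ltW eta0) //; lra.
  apply: le_trans (ler_wpM2l l0 psi2) _.
  have -> : lev * eta * bseq eps n ^+ 2 * (2 * eta * N0 ^+ 2) =
    lev * 2 * N0 ^+ 2 * (eta * bseq eps n) ^+ 2 by ring.
  rewrite [leRHS]exprMn; apply: ler_wpM2r; first exact: sqr_ge0.
  by rewrite /c1; nra.
have := Ks_ibp hK eta0 Tc Td (leqnn q); rewrite -/psi.
have -> : (fun t => psi t * T 0%N t) = (fun t => Ks K eta 0 t *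
    sint (fun x => Ks K eta 0 x * flux (cellA eps Xc) (cellrho eps Xc) wx (abar a) x t) (- eta) eta) by [].
move=> ->.
(* The interval length 2 eta and the eta in [Tb] cancel the prefactor 1 / eta^2. What remains is
   eta^-q times [bseq eps q.-1], which is c3 (c2 eps)^q. *)
have : `|sint (fun t => Ks K eta q t * T q t) (- eta) eta| <=
    Nq * (c1 * (eta * bseq eps q.-1)) * `|eta - - eta|.
  apply: sint_bound.
    by apply/lint_lbm/lbmM; apply: lbm_continuous; [exact: (Ks_cont hK)|exact: Tc].
  move=> t; rewrite min_l // max_r // -ler_norml => te; rewrite normrM.
  apply: ler_pM => //; first exact: HNq.
  by rewrite -(prednK q0); exact: Tb.
move: (sint _ _ _) => Z; have -> : `|eta - - eta| = 2 * eta.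
  by rewrite opprK gtr0_norm ?addr_gt0 //; ring.
rewrite /bseq prednK // => HZ.
rewrite normrM normrM normrX normrN !normfV (gtr0_norm eta0) (gtr0_norm (mulr_gt0 eta0 eta0)).
have ei : 0 < (eta^-1) ^+ q by rewrite exprn_gt0 // invr_gt0.
have eei : 0 <= (eta * eta)^-1 * (eta^-1) ^+ q.
  by rewrite mulr_ge0 ?invr_ge0 ?mulr_ge0 // ltW.
rewrite mulrA; apply: le_trans (ler_wpM2l eei HZ) _.
rewrite expr_div_n exprMn exprVn le_eqVlt; apply/orP; left; apply/eqP.
by field; rewrite expf_neq0 gt_eqF.
Qed.

End Coefficient.
End HMM.

(** * The discrete Helmholtz operator *)

Section Discrete.
Variable R : realType.

Lemma sum_delta (n k : nat) (G : nat -> R) :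
  \sum_(j < n) (j == k :> nat)%:R * G j = (k < n)%N%:R * G k.
Proof.
have [kn|kn] := boolP (k < n)%N; last first.
  rewrite mul0r big1 // => j _; have [E|] := eqVneq (j : nat) k; last by rewrite mul0r.
  by move: kn; rewrite -E ltn_ord.
rewrite (bigD1 (Ordinal kn)) //= eqxx big1 ?addr0 // => j jk.
have [E|] := eqVneq (j : nat) k; last by rewrite mul0r.
by move: jk; rewrite -val_eqE /= E eqxx.
Qed.

Variables (L : R) (Mx : nat).
Hypotheses (L0 : 0 < L) (Mx0 : (1 <= Mx)%N).
Notation H := (Hstep L Mx).
Notation D2 := (D2 L Mx).
Notation normH := (normH L).

Lemma Hstep_gt0 : 0 < H.
Proof. by rewrite divr_gt0 // ltr0n. Qed.

(** [F] is indexed by all grid points including the ends, so that the first and last rows obey the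
    same stencil as the others. *)
Lemma D2_mulE (F : nat -> R) (i : 'I_Mx) : F 0%N = 0 -> F Mx.+1 = 0 ->
  (D2 *m \col_(j < Mx) F j.+1) i 0 = (F i.+2 - 2 * F i.+1 + F i) / H ^+ 2.
Proof.
move=> F0 FM; rewrite mxE.
under eq_bigr => j _ do rewrite !mxE.
have -> : \sum_(j < Mx) ((j == i.+1 :> nat)%:R - 2 * (j == i)%:R + (i == j.+1 :> nat)%:R) /
    H ^+ 2 * F j.+1 = (\sum_(j < Mx) (j == i.+1 :> nat)%:R * F j.+1
    - 2 * (\sum_(j < Mx) (j == i :> nat)%:R * F j.+1)
    + \sum_(j < Mx) (i == j.+1 :> nat)%:R * F j.+1) / H ^+ 2.
  rewrite mulr_sumr -sumrB -big_split /= mulr_suml; apply: eq_bigr => j _.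
  by rewrite -val_eqE /=; ring.
rewrite (sum_delta _ i.+1 (fun j => F j.+1)) (sum_delta _ i (fun j => F j.+1)) ltn_ord mul1r.
have -> : (i.+1 < Mx)%N%:R * F i.+2 = F i.+2.
  case: ltnP => h; first by rewrite mul1r.
  by rewrite (_ : i.+2 = Mx.+1) ?FM ?mulr0 //; congr S; apply/eqP; rewrite eqn_leq h ltn_ord.
congr ((_ + _) / _); have := ltn_ord i; case: (nat_of_ord i) => [|i'] iM.
  by rewrite F0 big1 // => j _; rewrite mul0r.
under eq_bigr => j _ do rewrite eqSS eq_sym.
by rewrite (sum_delta _ i' (fun j => F j.+1)) (ltnW iM) mul1r.
Qed.

Lemma D2_sym : D2^T = D2.
Proof.
apply/matrixP => i j; rewrite !mxE; congr (_ / _).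
by rewrite eq_sym [j == i]eq_sym; ring.
Qed.

Definition freq (k : nat) : R := k.+1%:R * pi / Mx.+1%:R.
Definition eigval (k : nat) : R := (2 - 2 * cos (freq k)) / H ^+ 2.
Definition sine_mx : 'M[R]_Mx := \matrix_(i, k) sin (i.+1%:R * freq k).

Lemma sin_natpi (n : nat) : sin (n%:R * pi) = 0 :> R.
Proof.
elim: n => [|n IH]; first by rewrite mul0r sin0.
by rewrite -natr1 mulrDl mul1r sinDpi IH oppr0.
Qed.

Lemma freq_itv (k : 'I_Mx) : 0 < freq k < pi.
Proof.
have p0 := pi_gt0 R; have M0 : 0 < Mx.+1%:R :> R by rewrite ltr0n.
rewrite /freq divr_gt0 ?mulr_gt0 ?ltr0n //= ltr_pdivrMr // mulrC ltr_pM2l //.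
by rewrite ltr_nat ltnS.
Qed.

Lemma cos_freq_inj (k l : 'I_Mx) : cos (freq k) = cos (freq l) -> k = l.
Proof.
have /andP[k0 k1] := freq_itv k; have /andP[l0 l1] := freq_itv l.
move=> E; have : freq k = freq l.
  by apply: cos_inj => //; rewrite in_itv /= !ltW.
have p0 := pi_gt0 R; rewrite /freq => /(congr1 (fun z => z * Mx.+1%:R / pi)).
rewrite !divfK ?pnatr_eq0 // !mulfK ?gt_eqF // => /eqP; rewrite eqr_nat eqSS => /eqP.
exact: val_inj.
Qed.

Lemma cos_freq_lt1 (k : 'I_Mx) : cos (freq k) < 1.
Proof.
have /andP[k0 k1] := freq_itv k; have s0 : 0 < sin (freq k) by apply: sin_gt0_pi; rewrite k0.
by have := cos2Dsin2 (freq k); nra.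
Qed.

Lemma eigval_gt0 (k : 'I_Mx) : 0 < eigval k.
Proof.
rewrite divr_gt0 ?exprn_gt0 ?Hstep_gt0 //.
by have := cos_freq_lt1 k; lra.
Qed.

Lemma D2_sine : D2 *m sine_mx = sine_mx *m diag_mx (\row_k - eigval k).
Proof.
apply/matrixP => i k; rewrite mul_mx_diag !mxE.
have := @D2_mulE (fun j => sin (j%:R * freq k)) i.
rewrite mul0r sin0 => /(_ erefl).
have -> : Mx.+1%:R * freq k = k.+1%:R * pi by rewrite /freq mulrC divfK // pnatr_eq0.
rewrite sin_natpi => /(_ erefl); rewrite mxE => E.
transitivity (\sum_j D2 i j * (\col_(j < Mx) sin (j.+1%:R * freq k)) j 0).
  by apply: eq_bigr => j _; rewrite !mxE.
rewrite E /eigval.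
have -> : i.+2%:R * freq k = i.+1%:R * freq k + freq k by rewrite -[in LHS]natr1; ring.
have -> : i%:R * freq k = i.+1%:R * freq k - freq k by rewrite -[in RHS]natr1; ring.
rewrite sinD sinB; move: (i.+1%:R * freq k) (freq k) => x y.
by move: (sin x) (cos x) (sin y) (cos y) (H ^+ 2) => s1 c1 s2 c2 h; ring.
Qed.

Definition gram := sine_mx^T *m sine_mx.
Definition sqnorm (k : 'I_Mx) : R := \sum_i sine_mx i k ^+ 2.

Lemma sqnorm_gt0 k : 0 < sqnorm k.
Proof.
rewrite /sqnorm (bigD1 (Ordinal Mx0)) //=; apply: ltr_pwDl; last first.
  by apply: sumr_ge0 => i _; exact: sqr_ge0.
rewrite mxE /= mul1r exprn_gt0 //; apply: sin_gt0_pi; exact: freq_itv.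
Qed.

(** Orthogonality without trigonometric sums: by symmetry of D2 the Gram matrix commutes with the
    diagonal of eigenvalues, which are distinct because the cosine is injective on (0, pi). *)
Lemma gramE : gram = diag_mx (\row_k sqnorm k).
Proof.
have E : diag_mx (\row_k - eigval k) *m gram = gram *m diag_mx (\row_k - eigval k).
  rewrite /gram mulmxA -[RHS]mulmxA -D2_sine.
  rewrite -{1}[diag_mx _]trmxK tr_diag_mx -trmx_mul -D2_sine trmx_mul D2_sym.
  by rewrite mulmxA.
apply/matrixP => k l; have := congr1 (fun M : 'M[R]_Mx => M k l) E => /=.
rewrite mul_diag_mx mul_mx_diag !mxE; set g := \sum_j _.
have [kl|kl] := eqVneq k l.
  by move=> _; rewrite mulr1n /g /sqnorm; apply: eq_bigr => i _; rewrite !mxE kl expr2.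
rewrite mulr0n => E2; have : (eigval l - eigval k) * g = 0 by move: E2; lra.
move=> /eqP; rewrite mulf_eq0 => /orP[|/eqP//].
have Hn : H ^+ 2 != 0 by rewrite gt_eqF // exprn_gt0 // Hstep_gt0.
rewrite subr_eq0 /eigval => /eqP/(congr1 (fun z => z * H ^+ 2)); rewrite !divfK // => E3.
have : cos (freq k) = cos (freq l) by lra.
by move=> /cos_freq_inj E4; rewrite E4 eqxx in kl.
Qed.

Lemma normH_sq (v : 'cV[R]_Mx) : normH v ^+ 2 = H * \sum_i v i 0 ^+ 2.
Proof.
rewrite /Defs.normH sqr_sqrtr ?mulr_sumr //; apply: sumr_ge0 => i _.
by rewrite mulr_ge0 ?sqr_ge0 // ltW // Hstep_gt0.
Qed.

Lemma normH_ge0 (v : 'cV[R]_Mx) : 0 <= normH v.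
Proof. exact: sqrtr_ge0. Qed.

(** The diagonal Gram matrix gives a left inverse of the sine matrix; a square matrix has it as
    right inverse too, which is the completeness used here. *)
Lemma parseval (e : 'cV[R]_Mx) :
  \sum_i e i 0 ^+ 2 = \sum_k (sine_mx^T *m e) k 0 ^+ 2 / sqnorm k.
Proof.
pose Dinv := diag_mx (\row_k (sqnorm k)^-1) : 'M[R]_Mx.
have E1 : sine_mx *m Dinv *m sine_mx^T = 1%:M.
  apply: mulmx1C; rewrite mulmxA -/gram gramE mulmx_diag.
  rewrite -[RHS]diag_const_mx; congr diag_mx; apply/rowP => k; rewrite !mxE.
  by rewrite mulfV // gt_eqF // sqnorm_gt0.
have -> : \sum_i e i 0 ^+ 2 = (e^T *m e) 0 0.
  by rewrite mxE; apply: eq_bigr => i _; rewrite !mxE expr2.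
have -> : e^T *m e = (sine_mx^T *m e)^T *m Dinv *m (sine_mx^T *m e).
  have {1}-> : e^T = e^T *m (sine_mx *m Dinv *m sine_mx^T) by rewrite E1 mulmx1.
  by rewrite trmx_mul trmxK !mulmxA.
rewrite mxE; apply: eq_bigr => k _; rewrite mul_mx_diag !mxE expr2; ring.
Qed.

Lemma gap_discrete_le (c omega : R) (k : 'I_Mx) :
  gap_discrete L Mx c omega <= `|omega - Num.sqrt c * Num.sqrt (eigval k)|.
Proof.
apply: ge_inf; first by exists 0 => _ [l _ <-].
exists (Num.sqrt (eigval k)) => //; split; first by rewrite sqrtr_gt0 eigval_gt0.
apply/eigenvalueP; exists (row k sine_mx^T).
  have : sine_mx^T *m D2 = diag_mx (\row_k - eigval k) *m sine_mx^T.
    have := congr1 trmx D2_sine; rewrite !trmx_mul D2_sym tr_diag_mx => ->; by [].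
  move=> E; rewrite -row_mul E; apply/rowP => j.
  by rewrite mul_diag_mx !mxE sqr_sqrtr // ltW // eigval_gt0.
apply/eqP => E; have := sqnorm_gt0 k; rewrite /sqnorm big1 ?ltxx // => i _.
by have := congr1 (fun M : 'rV[R]_Mx => M 0 i) E; rewrite /= !mxE => ->; rewrite expr0n.
Qed.

(** On each mode omega^2 - c l^2 = (omega - sqrt(c) l)(omega + sqrt(c) l): the first factor is at
    least the gap in modulus, the second at least omega. *)
Lemma discrete_stability (c omega : R) (e : 'cV[R]_Mx) : 0 < c -> 0 < omega ->
  0 <= gap_discrete L Mx c omega ->
  omega * gap_discrete L Mx c omega * normH e <= normH (c *: (D2 *m e) + omega ^+ 2 *: e).
Proof.
move=> c0 o0 g0; set g := gap_discrete _ _ _ _ in g0 *.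
rewrite -ler_sqr ?nnegrE ?mulr_ge0 ?normH_ge0 ?(ltW o0) //.
rewrite exprMn !normH_sq mulrCA ler_wpM2l ?(ltW Hstep_gt0) //.
rewrite !parseval mulr_sumr; apply: ler_sum => k _.
have E : sine_mx^T *m D2 = diag_mx (\row_k - eigval k) *m sine_mx^T.
  by have := congr1 trmx D2_sine; rewrite !trmx_mul D2_sym tr_diag_mx.
have -> : (sine_mx^T *m (c *: (D2 *m e) + omega ^+ 2 *: e)) k 0 =
    (omega ^+ 2 - c * eigval k) * (sine_mx^T *m e) k 0.
  rewrite mulmxDr -!scalemxAr mulmxA E -mulmxA mxE [X in X + _]mxE mul_diag_mx.
  rewrite [X in _ + X]mxE; rewrite mxE [X in c * (X * _)]mxE; ring.
rewrite [((omega ^+ 2 - _) * _) ^+ 2]exprMn [leLHS]mulrA ler_wpM2r ?invr_ge0 ?(ltW (sqnorm_gt0 k)) //.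
rewrite ler_wpM2r ?sqr_ge0 //.
have l0 := eigval_gt0 k; set r := Num.sqrt c; set l := Num.sqrt (eigval k).
have r2 : r ^+ 2 = c by rewrite sqr_sqrtr // ltW.
have l2 : l ^+ 2 = eigval k by rewrite sqr_sqrtr // ltW.
have -> : omega ^+ 2 - c * eigval k = (omega - r * l) * (omega + r * l) by rewrite -r2 -l2; ring.
have rl0 : 0 <= r * l by rewrite mulr_ge0 ?sqrtr_ge0.
have gk : g <= `|omega - r * l| by exact: gap_discrete_le.
have -> : ((omega - r * l) * (omega + r * l)) ^+ 2 = (`|omega - r * l| * (omega + r * l)) ^+ 2.
  by rewrite !exprMn real_normK ?num_real.
have h : omega * g <= `|omega - r * l| * (omega + r * l).
  by rewrite mulrC; apply: ler_pM => //; [exact: ltW|lra].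
have p1 : 0 <= omega * g by rewrite mulr_ge0 // ltW.
by rewrite lerXn2r // nnegrE; exact: le_trans p1 h.
Qed.

Lemma normHD (u v : 'cV[R]_Mx) : normH (u + v) <= normH u + normH v.
Proof.
have CS : (\sum_i u i 0 * v i 0) ^+ 2 <= (\sum_i u i 0 ^+ 2) * (\sum_i v i 0 ^+ 2).
  set a := \sum_i u i 0 ^+ 2; set b := \sum_i u i 0 * v i 0; set c := \sum_i v i 0 ^+ 2.
  have P l : 0 <= a - 2 * l * b + l ^+ 2 * c.
    have : 0 <= \sum_i (u i 0 - l * v i 0) ^+ 2 by apply: sumr_ge0 => i _; exact: sqr_ge0.
    congr (_ <= _); rewrite /a /b /c !mulr_sumr -sumrB -big_split; apply: eq_bigr => i _ /=; ring.
  have c0 : 0 <= c by apply: sumr_ge0 => i _; exact: sqr_ge0.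
  have [cE|cn] := eqVneq c 0.
    have [->|bn] := eqVneq b 0; first by rewrite cE mulr0 expr0n.
    have := P ((a + 1) / (2 * b)); rewrite cE mulr0 addr0.
    have -> : a - 2 * ((a + 1) / (2 * b)) * b = -1 by field.
    lra.
  have c1 : 0 < c by rewrite lt_def cn.
  have := P (b / c).
  have -> : a - 2 * (b / c) * b + (b / c) ^+ 2 * c = (a * c - b ^+ 2) / c by field.
  by rewrite pmulr_lge0 ?invr_gt0 // subr_ge0.
have H0 := Hstep_gt0.
rewrite -ler_sqr ?nnegrE ?addr_ge0 ?normH_ge0 // sqrrD !normH_sq.
have -> : \sum_i (u + v) i 0 ^+ 2 = \sum_i u i 0 ^+ 2 + 2 * (\sum_i u i 0 * v i 0) + \sum_i v i 0 ^+ 2.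
  rewrite mulr_sumr -!big_split; apply: eq_bigr => i _ /=; rewrite mxE; ring.
have : H * (\sum_i u i 0 * v i 0) <= normH u * normH v.
  apply: le_trans (ler_norm _) _.
  have nn : 0 <= normH u * normH v by rewrite mulr_ge0 ?normH_ge0.
  rewrite -(ler_sqr (normr_ge0 _ : _ \in Num.nneg) nn) real_normK ?num_real // [leLHS]exprMn [leRHS]exprMn !normH_sq.
  by rewrite [leRHS]mulrACA -expr2 ler_wpM2l // sqr_ge0.
rewrite -mulr_natl; nra.
Qed.

Lemma normHZ (c : R) (v : 'cV[R]_Mx) : normH (c *: v) = `|c| * normH v.
Proof.
apply/eqP; rewrite -(eqrXn2 (n := 2)) ?normH_ge0 ?mulr_ge0 ?normH_ge0 //.
rewrite exprMn !normH_sq real_normK ?num_real // mulrCA; apply/eqP; congr (_ * _).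
by rewrite mulr_sumr; apply: eq_bigr => i _; rewrite mxE exprMn.
Qed.

End Discrete.

(** * The macroscopic problem *)

Section CellEstimates.
Variable R : realType.
Implicit Types (x y s t h c X H M p r nu : R) (f u F : R -> R) (n i : nat).

Definition derives f (f1 : R -> R) := forall x, is_derive x 1 f (f1 x).

Lemma derives_shift f f1 X : derives f f1 -> derives (fun s => f (X + s)) (fun s => f1 (X + s)).
Proof.
move=> D s; have H : is_derive s 1 (fun s : R => X + s) (0 + 1).
  exact: is_deriveD (is_derive_cst X s 1) (is_derive_id s 1).
have := @is_derive1_comp _ f (fun s => X + s) s _ _ (D (X + s)) H.
by rewrite add0r mulr1.
Qed.

Lemma derives_reflect f f1 X : derives f f1 ->
  derives (fun s => f (X - s)) (fun s => - f1 (X - s)).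
Proof.
move=> D s; have H : is_derive s 1 (fun s : R => X - s) (0 - 1).
  exact: is_deriveB (is_derive_cst X s 1) (is_derive_id s 1).
have := @is_derive1_comp _ f (fun s => X - s) s _ _ (D (X - s)) H.
by rewrite sub0r mulrN1.
Qed.

Lemma derivesD f f1 u u1 : derives f f1 -> derives u u1 ->
  derives (fun x => f x + u x) (fun x => f1 x + u1 x).
Proof. by move=> D E x; exact: is_deriveD (D x) (E x). Qed.

Lemma derivesZ c f f1 : derives f f1 -> derives (fun x => c * f x) (fun x => c * f1 x).
Proof. by move=> D x; exact: is_deriveZ (D x). Qed.

Lemma derives_cst c : derives (fun=> c) (fun=> 0).
Proof. by move=> x; exact: is_derive_cst. Qed.

Lemma derives_id : derives (fun x => x) (fun=> 1).
Proof. by move=> x; exact: is_derive_id. Qed.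

Lemma derivesM f f1 u u1 : derives f f1 -> derives u u1 ->
  derives (fun x => f x * u x) (fun x => f x * u1 x + f1 x * u x).
Proof.
move=> D E x; have := is_deriveM (D x) (E x).
by rewrite /GRing.scale /= [u x * f1 x]mulrC; apply.
Qed.

Lemma eq_derives f f1 u u1 : f =1 u -> f1 =1 u1 -> derives f f1 -> derives u u1.
Proof. by move=> /funext -> /funext ->. Qed.

Lemma derives_cont f f1 : derives f f1 -> continuous f.
Proof. by move=> D x; exact: is_derive_cont (D x). Qed.

Lemma derives_MVT f f1 M x y : derives f f1 -> x <= y ->
  (forall s, x <= s <= y -> `|f1 s| <= M) -> `|f y - f x| <= M * (y - x).
Proof.
move=> D; rewrite le_eqVlt => /predU1P[<- _|xy HM]; first by rewrite !subrr normr0 mulr0.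
have [c /andP[c1 c2] ->] := MVT_is_derive xy D.
by rewrite normrM [`|y - x|]ger0_norm ?subr_ge0 ?(ltW xy) // ler_wpM2r ?subr_ge0 ?(ltW xy) // HM // !ltW.
Qed.

Lemma prim_var F f x y x' y' : prim F f -> lbm f -> x' <= x -> x <= y -> y <= y' ->
  `|F y - F x| <= sint (fun s => `|f s|) x' y'.
Proof.
move=> pF fb xx xy yy; rewrite pF; have fl := lint_lbm fb.
by apply: le_trans (sint_abs fl xy) _; apply: sint_sub => //; exact: lint_abs.
Qed.

Lemma lbm_abs f : lbm f -> lbm (fun s => `|f s|).
Proof.
move=> [mf bf]; split; first exact: measurableT_comp.
by move=> B; have [M HM] := bf B; exists M => x /HM; rewrite normr_id.
Qed.

Lemma sint_abs_sq f x y : x <= y -> lbm f ->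
  sint (fun s => `|f s|) x y ^+ 2 <= (y - x) * sint (fun s => f s ^+ 2) x y.
Proof.
move=> xy fb; have := L2l_CS xy (L2l_lbm (lbm_abs fb)) (L2l_lbm (lbm_cst 1)).
rewrite (@eq_sint _ (fun s => `|f s| * 1) (fun s => `|f s|)); last by move=> s _; rewrite mulr1.
rewrite (@eq_sint _ (fun=> 1 ^+ 2) (fun=> 1)); last by move=> s _; rewrite expr1n.
rewrite (@eq_sint _ (fun s => `|f s| ^+ 2) (fun s => f s ^+ 2)); last first.
  by move=> s _; rewrite real_normK ?num_real.
by rewrite sint_cst mul1r mulrC.
Qed.

Lemma sum_sint f c h n : lint f ->
  \sum_(i < n) sint f (c + i%:R * h) (c + i.+1%:R * h) = sint f c (c + n%:R * h).
Proof.
move=> fl; elim: n => [|n IH]; first by rewrite big_ord0 mul0r addr0 sintxx.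
by rewrite big_ord_recr /= IH sint_chasles.
Qed.

(** The symmetric increment [V] of [F] has derivative F1(X + s) - F1(X - s), bounded by the
    variation of [F1]. Three successive mean value bounds, for [V], [W] and [Z], produce the factor
    H^3. *)
Lemma second_difference u u1 u2 F F1 F2 X H : 0 < H ->
  derives u u1 -> derives u1 u2 -> derives F F1 -> prim F1 F2 -> lbm F2 ->
  (forall s, X - H <= s <= X + H -> u2 s = F s) ->
  `|u (X + H) - 2 * u X + u (X - H) - H ^+ 2 * F X| <=
    H ^+ 3 * sint (fun s => `|F2 s|) (X - H) (X + H).
Proof.
move=> H0 Du Du1 DF pF1 F2b E; set nu := sint _ _ _.
have nu0 : 0 <= nu by apply: sint_ge0 => [|s _]; [lra|exact: normr_ge0].
pose V s := F (X + s) + F (X - s) + (-2 * F X).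
have DV : derives V (fun s => F1 (X + s) + - F1 (X - s) + 0).
  apply: derivesD; last exact: derives_cst.
  by apply: derivesD; [exact: derives_shift|exact: derives_reflect].
have bV s : 0 <= s -> s <= H -> `|V s| <= H * nu.
  move=> s0 sH; have := @derives_MVT _ _ nu 0 s DV s0.
  have -> : V s - V 0 = V s by rewrite /V addr0 subr0; ring.
  move=> /(_ _)/le_trans -> //; last by rewrite subr0 mulrC ler_wpM2r.
  move=> t /andP[t0 ts]; rewrite addr0; apply: (prim_var pF1 F2b); lra.
pose W s := u1 (X + s) + - u1 (X - s) + (-2 * F X) * s.
have DW : derives W (fun s => u2 (X + s) + u2 (X - s) + (-2 * F X) * 1).
  apply: derivesD; last exact/derivesZ/derives_id.
  apply: derivesD; first exact: derives_shift.
  have := derivesZ (-1) (derives_reflect X Du1).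
  by apply: eq_derives => s; ring.
have bW s : 0 <= s -> s <= H -> `|W s| <= H ^+ 2 * nu.
  move=> s0 sH; have := @derives_MVT _ _ (H * nu) 0 s DW s0.
  have -> : W s - W 0 = W s by rewrite /W addr0 subr0; ring.
  move=> /(_ _)/le_trans -> //; last first.
    by rewrite subr0 expr2 mulrAC ler_wpM2r // ler_wpM2l // ltW.
  move=> t /andP[t0 ts]; rewrite mulr1 !E; [apply: bV| |]; lra.
pose Z s := u (X + s) + u (X - s) + (- F X) * (s * s).
have DZ : derives Z W.
  have := derivesD (derivesD (derives_shift X Du) (derives_reflect X Du))
    (derivesZ (- F X) (derivesM derives_id derives_id)).
  by apply: eq_derives => s; rewrite /W /Z; ring.
have := @derives_MVT _ _ (H ^+ 2 * nu) 0 H DZ (ltW H0).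
have -> : Z H - Z 0 = u (X + H) - 2 * u X + u (X - H) - H ^+ 2 * F X.
  by rewrite /Z addr0 subr0; ring.
have -> : H ^+ 2 * nu * (H - 0) = H ^+ 3 * nu by ring.
by apply => s /andP[s0 sH]; exact: bW.
Qed.

(** Comparison with the tangent line at the midpoint, whose slope contributes nothing by symmetry;
    so only the second derivative appears in the bound. *)
Lemma midpoint_sq f f1 f2 X h : 0 < h -> derives f f1 -> prim f1 f2 -> lbm f2 ->
  2 * h * f X ^+ 2 <= 2 * sint (fun s => f s ^+ 2) (X - h) (X + h) +
    8 * h ^+ 4 * sint (fun s => f2 s ^+ 2) (X - h) (X + h).
Proof.
move=> h0 D pf f2b; pose nu := sint (fun s => `|f2 s|) (X - h) (X + h).
have hh : X - h <= X + h by lra.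
have nu0 : 0 <= nu by apply: sint_ge0 => // s _; exact: normr_ge0.
have f1b := prim_lbm pf f2b; have fb := lbm_continuous (derives_cont D).
pose g s := f s + (- f1 X) * s.
have Dg : derives g (fun s => f1 s + (- f1 X) * 1).
  by apply: derivesD D _; exact/derivesZ/derives_id.
have bg s : X - h <= s <= X + h -> `|g s - g X| <= h * nu.
  move=> /andP[s1 s2]; have [Xs|/ltW sX] := leP X s.
    have := @derives_MVT _ _ nu X s Dg Xs => /(_ _)/le_trans -> //.
      move=> t /andP[t1 t2]; rewrite mulr1; apply: (prim_var pf f2b); lra.
    by rewrite mulrC ler_wpM2r //; lra.
  rewrite distrC; have := @derives_MVT _ _ nu s X Dg sX => /(_ _)/le_trans -> //.
    move=> t /andP[t1 t2]; rewrite mulr1 distrC; apply: (prim_var pf f2b); lra.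
  by rewrite mulrC ler_wpM2r //; lra.
(* The square of the tangent line without its nonnegative quadratic term: it lies below that square,
   and its odd part integrates to zero. *)
pose q s := f X ^+ 2 + 2 * f X * f1 X * (s + - X).
have Dq : derives (fun s => f X ^+ 2 * s + f X * f1 X * ((s + - X) * (s + - X))) q.
  have Ds := derivesD derives_id (derives_cst (- X)).
  have := derivesD (derivesZ (f X ^+ 2) derives_id) (derivesZ (f X * f1 X) (derivesM Ds Ds)).
  by apply: eq_derives => s; rewrite /q; ring.
have qc : continuous q.
  have := derivesD (derives_cst (f X ^+ 2)) (derivesZ (2 * f X * f1 X)
    (derivesD derives_id (derives_cst (- X)))) => /derives_cont; exact.
have Eq : sint q (X - h) (X + h) = 2 * h * f X ^+ 2.
  by rewrite -(FTC_all qc Dq); ring.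
have pw s : X - h <= s <= X + h -> q s <= 2 * f s ^+ 2 + 2 * (h * nu) ^+ 2.
  move=> /bg; rewrite /g => B.
  have hn : 0 <= h * nu by rewrite mulr_ge0 // ltW.
  have : (f s + - f1 X * s - (f X + - f1 X * X)) ^+ 2 <= (h * nu) ^+ 2.
    by rewrite -(real_normK (num_real (_ - _))) ler_sqr // nnegrE.
  move: (h * nu) => k; rewrite /q; move: (f s) (f X) (f1 X) => A B' C HH.
  have := sqr_ge0 (C * (s - X)); have := sqr_ge0 (2 * A - B' - C * (s - X)); nra.
have L2 : lint (fun s => f s ^+ 2) by exact/lint_lbm/lbmX.
have := @le_sint _ q (fun s => 2 * f s ^+ 2 + 2 * (h * nu) ^+ 2) (X - h) (X + h).
rewrite Eq sintD; [|exact: lintZ|exact/lint_lbm/lbm_cst].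
rewrite sintZ // sint_cst => /(_ _ _ hh pw) W.
have {}W : 2 * h * f X ^+ 2 <=
    2 * sint (fun s => f s ^+ 2) (X - h) (X + h) + 2 * (h * nu) ^+ 2 * (X + h - (X - h)).
  apply: W; first exact/lint_lbm/lbm_continuous.
  by apply: lintD; [exact: lintZ|exact/lint_lbm/lbm_cst].
apply: le_trans W _; rewrite lerD2l.
have := sint_abs_sq hh f2b; rewrite -/nu.
move: (sint _ _ _) => J; have -> : X + h - (X - h) = 2 * h by ring.
move=> HJ; apply: (@le_trans _ _ (4 * h ^+ 3 * nu ^+ 2)); first by rewrite le_eqVlt; apply/orP; left; apply/eqP; ring.
have h3 : 0 <= 4 * h ^+ 3 by rewrite mulr_ge0 // exprn_ge0 // ltW.
by apply: le_trans (ler_wpM2l h3 HJ) _; rewrite le_eqVlt; apply/orP; left; apply/eqP; ring.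
Qed.

(** Subtracting the line of slope [u1 (X + s)] leaves a function whose derivative is at most the
    variation of [u1] on either side of X + s. *)
Lemma chord_dist u u1 u2 X H s : 0 <= s -> s <= H ->
  derives u u1 -> prim u1 u2 -> lbm u2 ->
  `|H * u (X + s) - ((H - s) * u X + s * u (X + H))| <=
    s * (H - s) * sint (fun t => `|u2 t|) X (X + H).
Proof.
move=> s0 sH D p u2b; set nu := sint _ _ _.
pose g t := u t + (- u1 (X + s)) * t.
have Dg : derives g (fun t => u1 t + (- u1 (X + s)) * 1).
  by apply: derivesD D _; exact/derivesZ/derives_id.
have ul := lint_abs (lint_lbm u2b).
pose nl := sint (fun t => `|u2 t|) X (X + s); pose nr := sint (fun t => `|u2 t|) (X + s) (X + H).
have nE : nl + nr = nu by exact: sint_chasles.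
have b1 : `|g (X + s) - g X| <= nl * s.
  have := @derives_MVT _ _ nl X (X + s) Dg; rewrite [X + s - X]addrAC subrr add0r.
  apply; first lra.
  move=> t /andP[t1 t2]; rewrite mulr1 distrC; apply: (prim_var p u2b); lra.
have b2 : `|g (X + H) - g (X + s)| <= nr * (H - s).
  have := @derives_MVT _ _ nr (X + s) (X + H) Dg.
  have -> : X + H - (X + s) = H - s by ring.
  apply; first lra.
  move=> t /andP[t1 t2]; rewrite mulr1; apply: (prim_var p u2b); lra.
have -> : H * u (X + s) - ((H - s) * u X + s * u (X + H)) =
    (H - s) * (g (X + s) - g X) - s * (g (X + H) - g (X + s)) by rewrite /g; ring.
apply: le_trans (ler_normB _ _) _; rewrite !normrM (ger0_norm s0) (ger0_norm (_ : 0 <= H - s)); last lra.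
rewrite -nE; have Hs : 0 <= H - s by lra.
by have := ler_wpM2l Hs b1; have := ler_wpM2l s0 b2; lra.
Qed.

End CellEstimates.

(** * Comparison of grid norms with integral norms *)

Section GridNorms.
Variable R : realType.
Implicit Types (x y s t h c X H M p q nu : R) (f u F : R -> R) (n i : nat).

(** The chord is controlled by the end values, the distance to it by u''. The split is weighted so
    that the coefficient of u'' is small: 11/300 is 11/10 times 1/30, and 11/2 comes from
    integrating 11 times the convex combination of p^2 and q^2. *)
Lemma chord_sq u (u1 u2 : R -> R) X H : 0 < H -> derives u u1 -> prim u1 u2 -> lbm u2 ->
  sint (fun t => u t ^+ 2) X (X + H) <=
    11 / 300 * H ^+ 4 * sint (fun t => u2 t ^+ 2) X (X + H) +
    11 / 2 * (H * (u X ^+ 2 + u (X + H) ^+ 2)).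
Proof.
move=> H0 D pu u2b; have ub := lbm_continuous (derives_cont D).
set nu := sint (fun t => `|u2 t|) X (X + H); set p := u X; set q := u (X + H).
have XH : X <= X + H by lra.
pose y t := t + - X; have Dy : derives y (fun=> 1 + 0).
  by apply: derivesD; [exact: derives_id|exact: derives_cst].
pose A := 11 / 10 * nu ^+ 2; pose B := 11 * H.
pose r t := A * (y t * (H + - y t)) ^+ 2 + B * ((H + - y t) * p ^+ 2 + y t * q ^+ 2).
have Dyy := derivesM Dy Dy; have Dy3 := derivesM Dy Dyy; have Dy4 := derivesM Dyy Dyy.
have Dy5 := derivesM Dy Dy4.
(* An explicit antiderivative of [r] in y = t - X; the integral of (y (H - y))^2 over the cell is
   H^5 / 30. *)
have Dr : derives (fun t => A * H ^+ 2 / 3 * (y t * (y t * y t)) +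
   - (A * H / 2) * ((y t * y t) * (y t * y t)) + A / 5 * (y t * ((y t * y t) * (y t * y t)))
   + B * H * p ^+ 2 * y t + B * (q ^+ 2 - p ^+ 2) / 2 * (y t * y t)) r.
  have := derivesD (derivesD (derivesD (derivesD (derivesZ (A * H ^+ 2 / 3) Dy3)
    (derivesZ (- (A * H / 2)) Dy4)) (derivesZ (A / 5) Dy5)) (derivesZ (B * H * p ^+ 2) Dy))
    (derivesZ (B * (q ^+ 2 - p ^+ 2) / 2) Dyy).
  by apply: eq_derives => t //; rewrite /r; field.
have rc : continuous r.
  have D1 := derivesM Dy (derivesD (derives_cst H) (derivesZ (-1) Dy)).
  have D2 := derivesD (derivesZ (p ^+ 2) (derivesD (derives_cst H) (derivesZ (-1) Dy)))
    (derivesZ (q ^+ 2) Dy).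
  have D3 := derivesD (derivesZ A (derivesM D1 D1)) (derivesZ B D2).
  apply: (@derives_cont _ r); apply: eq_derives D3 => [t|t]; last reflexivity.
  by rewrite /r; ring.
have Er : sint r X (X + H) = A * H ^+ 5 / 30 + B * H ^+ 2 * (p ^+ 2 + q ^+ 2) / 2.
  by rewrite -(FTC_all rc Dr) /y; field.
have pw t : X <= t <= X + H -> H ^+ 2 * u t ^+ 2 <= r t.
  move=> /andP[t1 t2]; have s0 : 0 <= y t by rewrite /y; lra.
  have sH : y t <= H by rewrite /y; lra.
  have := chord_dist X s0 sH D pu u2b; rewrite -/nu -/p -/q.
  rewrite {1}(_ : X + y t = t); last by rewrite /y; ring.
  rewrite /r /A /B; move: (y t) s0 sH (u t) => s s0 sH v K.
  have nu0 : 0 <= nu by apply: sint_ge0 => // z _; exact: normr_ge0.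
  have k0 : 0 <= s * (H - s) * nu by rewrite !mulr_ge0 // subr_ge0.
  set I := (H - s) * p + s * q in K.
  have K2 : (H * v - I) ^+ 2 <= (s * (H - s) * nu) ^+ 2.
    by rewrite -(real_normK (num_real (_ - _))) ler_sqr ?nnegrE.
  have I2 : I ^+ 2 <= H * ((H - s) * p ^+ 2 + s * q ^+ 2).
    have : 0 <= s * (H - s) * (p - q) ^+ 2.
      by apply: mulr_ge0; [apply: mulr_ge0; rewrite // subr_ge0|exact: sqr_ge0].
    by rewrite -[I ^+ 2 <= _]subr_ge0; congr (is_true (0 <= _)); rewrite /I; ring.
  (* Young's inequality with parameter 1/10: the factors are 1 + 1/10 and 1 + 10. *)
  have E : (H * v) ^+ 2 <= 11 / 10 * (H * v - I) ^+ 2 + 11 * I ^+ 2.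
    by clear; move: (H * v) I => w z; have := sqr_ge0 (w - z - 10 * z); nra.
  rewrite -exprMn; apply: le_trans E _.
  have -> : 11 / 10 * nu ^+ 2 * (s * (H + - s)) ^+ 2 = 11 / 10 * (s * (H - s) * nu) ^+ 2 by ring.
  have -> : 11 * H * ((H + - s) * p ^+ 2 + s * q ^+ 2) =
    11 * (H * ((H - s) * p ^+ 2 + s * q ^+ 2)) by ring.
  by have H1 := ltW H0; lra.
have ul : lint (fun t => u t ^+ 2) by exact/lint_lbm/lbmX.
have HU : H ^+ 2 * sint (fun t => u t ^+ 2) X (X + H) <=
    11 / 10 * nu ^+ 2 * H ^+ 5 / 30 + 11 * H * H ^+ 2 * (p ^+ 2 + q ^+ 2) / 2.
  rewrite -Er -sintZ //.
  exact: le_sint (lintZ (H ^+ 2) ul) (lint_lbm (lbm_continuous rc)) XH pw.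
have HJ := sint_abs_sq XH u2b; rewrite -/nu [X + H - X]addrAC subrr add0r in HJ.
move: (sint (fun t => u t ^+ 2) X _) (sint (fun t => u2 t ^+ 2) X _) (p ^+ 2) (q ^+ 2) HJ HU.
move=> U J P Q HJ HU.
have H20 : 0 < H ^+ 2 by rewrite exprn_gt0.
rewrite -(ler_pM2l H20); apply: le_trans HU _.
have H50 : 0 <= H ^+ 5 by rewrite exprn_ge0 // ltW.
have := ler_wpM2l H50 HJ; move=> W.
have -> : H ^+ 2 * (11 / 300 * H ^+ 4 * J + 11 / 2 * (H * (P + Q))) =
  11 / 300 * (H ^+ 5 * (H * J)) + 11 * H * H ^+ 2 * (P + Q) / 2 by field.
have -> : 11 / 10 * nu ^+ 2 * H ^+ 5 / 30 = 11 / 300 * (H ^+ 5 * nu ^+ 2) by field.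
have c0 : 0 <= 11 / 300 :> R by rewrite divr_ge0 ?ler0n.
by apply: lerD; [exact: ler_wpM2l c0 _ _ W|exact: lexx].
Qed.

Variables (L : R) (Mx : nat).
Hypotheses (L0 : 0 < L) (Mx0 : (1 <= Mx)%N).
Notation H := (Hstep L Mx).
Notation D2 := (D2 L Mx).
Notation normH := (normH L).
Notation gridvec := (gridvec L Mx).

Let H0 : 0 < H. Proof. exact: Hstep_gt0. Qed.

Lemma gridpt_last : gridpt L Mx Mx.+1 = L.
Proof. by rewrite /gridpt /Hstep mulrC divfK // pnatr_eq0. Qed.

Lemma gridptS i : gridpt L Mx i.+1 = gridpt L Mx i + H.
Proof. by rewrite /gridpt -natr1 mulrDl mul1r. Qed.

Lemma gridpt_itv i : (i <= Mx.+1)%N -> 0 <= gridpt L Mx i <= L.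
Proof.
move=> iM; rewrite mulr_ge0 ?ler0n ?(ltW H0) //= -[leRHS]gridpt_last.
by rewrite /gridpt ler_wpM2r ?ler_nat // ltW.
Qed.

Definition nrm f := Num.sqrt (sint (fun x => f x ^+ 2) 0 L).

Lemma nrm_ge0 f : 0 <= nrm f. Proof. exact: sqrtr_ge0. Qed.

Lemma nrm_sq f : nrm f ^+ 2 = sint (fun x => f x ^+ 2) 0 L.
Proof.
by rewrite sqr_sqrtr //; apply: sint_ge0 => [|x _]; [exact: ltW|exact: sqr_ge0].
Qed.

Lemma sum_cells f n x : lint f -> (forall s, 0 <= f s) -> 0 <= x -> x + n%:R * H <= L ->
  \sum_(i < n) sint f (x + i%:R * H) (x + i.+1%:R * H) <= sint f 0 L.
Proof.
move=> fl f0 x0 xL; rewrite sum_sint //; apply: sint_sub => //.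
by rewrite lerDl mulr_ge0 // ltW.
Qed.

Lemma consistency u (u1 u2 F1 F2 : R -> R) F :
  derives u u1 -> derives u1 u2 -> derives F F1 -> prim F1 F2 -> lbm F2 ->
  (forall x, 0 <= x <= L -> u2 x = F x) -> u 0 = 0 -> u L = 0 ->
  normH (D2 *m gridvec u - gridvec F) <= 2 * H ^+ 2 * nrm F2.
Proof.
move=> Du Du1 DF pF1 F2b E u00 uL.
have k0 : 0 <= 2 * H ^+ 2 * nrm F2 by rewrite mulr_ge0 ?nrm_ge0 // mulr_ge0 // sqr_ge0.
rewrite -(@ler_sqr R) ?nnegrE ?normH_ge0 // normH_sq //.
pose J x y := sint (fun s => F2 s ^+ 2) x y.
have F2l : lint (fun s => F2 s ^+ 2) by exact/lint_lbm/lbmX.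
(* The residual at a grid point sees the two adjacent cells; written as two shifted families of
   cells, each of the two sums is at most the full integral. *)
have pw (i : 'I_Mx) : (D2 *m gridvec u - gridvec F) i 0 ^+ 2 <=
    2 * H ^+ 3 * (J (0 + i%:R * H) (0 + i.+1%:R * H) + J (H + i%:R * H) (H + i.+1%:R * H)).
  have := @D2_mulE R L Mx (fun j => u (gridpt L Mx j)) i.
  rewrite {1}/gridpt mul0r gridpt_last => /(_ u00 uL) DE.
  rewrite mxE DE !mxE !gridptS.
  set X := gridpt L Mx i + H; have -> : gridpt L Mx i = X - H by rewrite /X addrK.
  have /andP[X1 _] := gridpt_itv (ltnW (ltnW (ltn_ord i) : (i < Mx.+1)%N)).
  have /andP[_ X2] := @gridpt_itv i.+2 (ltn_ord i).
  have Xr s : X - H <= s <= X + H -> u2 s = F s.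
    move=> /andP[s1 s2]; apply: E; apply/andP; split.
      by apply: le_trans s1; rewrite /X addrK.
    by apply: le_trans s2 _; move: X2; rewrite gridptS gridptS.
  have := second_difference H0 Du Du1 DF pF1 F2b Xr.
  have XX : X - H <= X + H by have := ltW H0; lra.
  have := sint_abs_sq XX F2b; set nu := sint _ _ _ => Hnu SD.
  have -> : (u (X + H) - 2 * u X + u (X - H)) / H ^+ 2 - F X =
      (u (X + H) - 2 * u X + u (X - H) - H ^+ 2 * F X) / H ^+ 2.
    by field; rewrite gt_eqF.
  have JE : J (0 + i%:R * H) (0 + i.+1%:R * H) + J (H + i%:R * H) (H + i.+1%:R * H) =
      J (X - H) (X + H).
    have E0 : 0 + i%:R * H = X - H by rewrite add0r /X addrK.
    have E1 : 0 + i.+1%:R * H = X by rewrite add0r /X -gridptS.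
    have E2 : H + i%:R * H = X by rewrite addrC.
    have E3 : H + i.+1%:R * H = X + H by rewrite addrC /X -gridptS.
    by rewrite E0 E1 E2 E3 /J sint_chasles.
  rewrite JE; have HX : X + H - (X - H) = 2 * H by ring.
  rewrite HX in Hnu; rewrite -/(J _ _) in Hnu; move: (J _ _) Hnu => j Hnu.
  have nu0 : 0 <= nu by apply: sint_ge0 => // s _; exact: normr_ge0.
  set Y := _ - H ^+ 2 * F X in SD *.
  have Y2 : Y ^+ 2 <= (H ^+ 3 * nu) ^+ 2.
    rewrite -(real_normK (num_real Y)) ler_sqr // nnegrE //.
    by rewrite mulr_ge0 // exprn_ge0 // ltW.
  rewrite expr_div_n -exprM /= ler_pdivrMr ?exprn_gt0 //; apply: le_trans Y2 _.
  have H6 : 0 <= H ^+ 6 by rewrite exprn_ge0 // ltW.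
  have -> : (H ^+ 3 * nu) ^+ 2 = H ^+ 6 * nu ^+ 2 by ring.
  by apply: le_trans (ler_wpM2l H6 Hnu) _; rewrite le_eqVlt; apply/orP; left; apply/eqP; ring.
apply: (@le_trans _ _ (H * \sum_(i < Mx) (2 * H ^+ 3 *
  (J (0 + i%:R * H) (0 + i.+1%:R * H) + J (H + i%:R * H) (H + i.+1%:R * H))))).
  by rewrite ler_wpM2l ?(ltW H0) //; apply: ler_sum => i _; exact: pw.
rewrite -mulr_sumr big_split /=.
have ML : H + Mx%:R * H = L by rewrite -[RHS]gridpt_last gridptS addrC.
have j0 s : 0 <= F2 s ^+ 2 by exact: sqr_ge0.
have S1 : \sum_(i < Mx) J (0 + i%:R * H) (0 + i.+1%:R * H) <= nrm F2 ^+ 2.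
  by rewrite nrm_sq; apply: sum_cells => //; rewrite add0r; have := ltW H0; lra.
have S2 : \sum_(i < Mx) J (H + i%:R * H) (H + i.+1%:R * H) <= nrm F2 ^+ 2.
  by rewrite nrm_sq; apply: sum_cells => //; [exact: ltW|rewrite ML].
have H4 : 0 <= 2 * H ^+ 4 by rewrite mulr_ge0 // exprn_ge0 // ltW.
have -> : (2 * H ^+ 2 * nrm F2) ^+ 2 = 2 * H ^+ 4 * (nrm F2 ^+ 2 + nrm F2 ^+ 2) by ring.
apply: le_trans (ler_wpM2l H4 (lerD S1 S2)).
by rewrite le_eqVlt; apply/orP; left; apply/eqP; ring.
Qed.

(** The intervals of length H centred at the grid points do not overlap, so the midpoint bounds with
    h = H / 2 add up to integrals over (0, L). *)
Lemma grid_le_nrm f (f1 f2 : R -> R) : derives f f1 -> prim f1 f2 -> lbm f2 ->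
  normH (gridvec f) <= 2 * (nrm f + H ^+ 2 * nrm f2).
Proof.
move=> D pf f2b.
have H2 : 0 <= H ^+ 2 by exact: sqr_ge0.
have k1 : 0 <= H ^+ 2 * nrm f2 by rewrite mulr_ge0 ?nrm_ge0.
have k0 : 0 <= 2 * (nrm f + H ^+ 2 * nrm f2) by rewrite mulr_ge0 ?addr_ge0 ?nrm_ge0.
rewrite -(@ler_sqr R) ?nnegrE ?normH_ge0 // normH_sq //.
have fb := lbm_continuous (derives_cont D).
have l1 : lint (fun s => f s ^+ 2) by exact/lint_lbm/lbmX.
have l2 : lint (fun s => f2 s ^+ 2) by exact/lint_lbm/lbmX.
have h0 : 0 < H / 2 by have := H0; lra.
have ML : H + Mx%:R * H = L by rewrite -[RHS]gridpt_last gridptS addrC.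
rewrite mulr_sumr; apply: (@le_trans _ _ (\sum_(i < Mx) (
  2 * sint (fun s => f s ^+ 2) (H / 2 + i%:R * H) (H / 2 + i.+1%:R * H) +
  8 * (H / 2) ^+ 4 * sint (fun s => f2 s ^+ 2) (H / 2 + i%:R * H) (H / 2 + i.+1%:R * H)))).
  apply: ler_sum => i _; have := midpoint_sq (gridpt L Mx i.+1) h0 D pf f2b.
  rewrite mxE; have -> : gridpt L Mx i.+1 - H / 2 = H / 2 + i%:R * H.
    by rewrite gridptS /gridpt; lra.
  have -> : gridpt L Mx i.+1 + H / 2 = H / 2 + i.+1%:R * H by rewrite /gridpt addrC.
  by have -> : 2 * (H / 2) = H by lra.
rewrite big_split /= -!mulr_sumr.
have HM : H / 2 + Mx%:R * H <= L by have := H0; lra.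
have S1 := sum_cells l1 (fun s => sqr_ge0 (f s)) (ltW h0) HM.
have S2 := sum_cells l2 (fun s => sqr_ge0 (f2 s)) (ltW h0) HM.
rewrite -nrm_sq in S1; rewrite -nrm_sq in S2.
have H4 : 0 <= 8 * (H / 2) ^+ 4 by rewrite mulr_ge0 // exprn_ge0 // ltW.
have := ler_wpM2l H4 S2; move: S1; move: (\sum_(i < Mx) _) => a; move: (\sum_(i < Mx) _) => b S1 S2'.
apply: le_trans (lerD (ler_wpM2l (ler0n _ 2) S1) S2') _.
have n0 := nrm_ge0 f; have -> : 8 * (H / 2) ^+ 4 * nrm f2 ^+ 2 = 2^-1 * (H ^+ 2 * nrm f2) ^+ 2 by field.
by move: (H ^+ 2 * nrm f2) k1 (nrm f) n0 => w w0 v v0; nra.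
Qed.

(** Summing [chord_sq], the u'' term is at most 11/300 * 25 = 11/12 of the left side and is
    absorbed; this is what the 5 is for. Each interior grid value occurs in two cells, so the other
    term is 11 times the squared grid norm, and 12 * 11 = 132. *)
Lemma nrm_le_grid u (u1 u2 : R -> R) : derives u u1 -> prim u1 u2 -> lbm u2 ->
  u 0 = 0 -> u L = 0 -> H ^+ 2 * nrm u2 <= 5 * nrm u ->
  nrm u ^+ 2 <= 132 * normH (gridvec u) ^+ 2.
Proof.
move=> D pu u2b u00 uL; have ub := lbm_continuous (derives_cont D).
have l1 : lint (fun s => u s ^+ 2) by exact/lint_lbm/lbmX.
have l2 : lint (fun s => u2 s ^+ 2) by exact/lint_lbm/lbmX.
have k1 : 0 <= H ^+ 2 * nrm u2 by rewrite mulr_ge0 ?nrm_ge0 // sqr_ge0.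
move=> W; have {}W : (H ^+ 2 * nrm u2) ^+ 2 <= (5 * nrm u) ^+ 2.
  by rewrite ler_sqr // nnegrE mulr_ge0 ?nrm_ge0.
have {}W : H ^+ 4 * sint (fun s => u2 s ^+ 2) 0 L <= 25 * sint (fun s => u s ^+ 2) 0 L.
  by rewrite -!nrm_sq; move: W; congr (is_true (_ <= _)); ring.
pose g (i : nat) := u (gridpt L Mx i) ^+ 2.
have ML : 0 + Mx.+1%:R * H = L by rewrite add0r -[RHS]gridpt_last.
have E : sint (fun s => u s ^+ 2) 0 L <= 11 / 300 * H ^+ 4 * sint (fun s => u2 s ^+ 2) 0 L +
    11 / 2 * (H * \sum_(i < Mx.+1) (g i + g i.+1)).
  have := sum_sint 0 H Mx.+1 l1; rewrite ML => <-.
  have := sum_sint 0 H Mx.+1 l2; rewrite ML => <-.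
  rewrite !mulr_sumr -big_split /=; apply: ler_sum => i _.
  have := chord_sq (gridpt L Mx i) H0 D pu u2b.
  by rewrite -gridptS /gridpt !add0r -/(gridpt _ _ _).
have S1 : \sum_(i < Mx.+1) g i = \sum_(i < Mx) gridvec u i 0 ^+ 2.
  rewrite big_ord_recl {1}/g /gridpt mul0r u00 expr0n add0r; apply: eq_bigr => i _.
  by rewrite mxE /g.
have S2 : \sum_(i < Mx.+1) g i.+1 = \sum_(i < Mx) gridvec u i 0 ^+ 2.
  rewrite big_ord_recr /= {2}/g gridpt_last uL expr0n addr0; apply: eq_bigr => i _.
  by rewrite mxE /g.
rewrite big_split /= S1 S2 -mulrA in E.
rewrite normH_sq // nrm_sq; move: (\sum_(i < Mx) _) E W => S.
move: (sint (fun s => u s ^+ 2) 0 L) (sint _ _ _) => U J.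
by rewrite [H * (S + S)]mulrDr; move: (H ^+ 4 * J) (H * S) => w z; lra.
Qed.

End GridNorms.

(** * Lower bounds for the sine *)

Section SineLowerBound.
Variable R : realType.
Implicit Types (x y d : R) (n : nat).

Lemma sin_le_id x : 0 <= x -> sin x <= x.
Proof.
rewrite le_eqVlt => /predU1P[<-|x0]; first by rewrite sin0.
have [c _] := MVT_is_derive x0 (fun x => is_derive_sin x).
rewrite sin0 !subr0 => ->; have := cos_le1 c; nra.
Qed.

Lemma cos_ge_half x : 0 <= x -> x <= 1 -> 1 / 2 <= cos x.
Proof.
move=> x0 x1; have h0 : 0 <= x / 2 by lra.
have s1 := sin_le_id h0; have s0 : 0 <= sin (x / 2).
  by apply: sin_ge0_pi; have := pi_ge2 R; rewrite h0 /=; lra.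
have -> : x = x / 2 + x / 2 by lra.
have := cos2Dsin2 (x / 2); rewrite cosD; move: s0 s1.
by move: (sin (x / 2)) (cos (x / 2)) => s c; nra.
Qed.

(** Up to 1 the derivative is at least 1/2; beyond 1, sin x > sin 1 >= 1/2 while x <= pi / 2 < 2. *)
Lemma sin_ge_quarter x : 0 <= x -> x <= pi / 2 -> x / 4 <= sin x.
Proof.
move=> x0 xp; have small (z : R) : 0 <= z -> z <= 1 -> z / 2 <= sin z.
  rewrite le_eqVlt => /predU1P[<-|z0 z1]; first by rewrite sin0 mul0r.
  have [c /andP[c0 cz]] := MVT_is_derive z0 (fun x => is_derive_sin x).
  rewrite sin0 !subr0 => ->; have := @cos_ge_half c; nra.
have [x1|x1] := leP x 1; first by have := small _ x0 x1; lra.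
have p2 := pihalf_lt2 R.
have : sin 1 < sin x by rewrite ltr_sin // in_itv /=; apply/andP; split; lra.
by have := small 1 ler01 (lexx _); lra.
Qed.

Lemma sin_addnpi x n : `|sin (x + n%:R * pi)| = `|sin x|.
Proof.
elim: n => [|n IH]; first by rewrite mul0r addr0.
by rewrite -natr1 mulrDl mul1r addrA sinDpi normrN.
Qed.

(** After reduction modulo pi, d is at most the distance to both neighbouring multiples; the right
    half of the period is reflected onto the left one. *)
Lemma sin_ge_dist y d : 0 <= y -> (forall n, d <= `|y - n%:R * pi|) -> d / 4 <= `|sin y|.
Proof.
move=> y0 H; have p0 := pi_gt0 R.
have q0 : 0 <= y / pi by rewrite divr_ge0 // ltW.
set n := Num.truncn (y / pi).
have h1 : n%:R * pi <= y by rewrite -ler_pdivlMr //; by rewrite truncn_le.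
have h2 : y < n%:R * pi + pi.
  have := truncnS_gt (y / pi); rewrite -/n ltr_pdivrMr // -natr1; lra.
have d1 := H n; have d2 := H n.+1; rewrite -natr1 mulrDl mul1r in d2.
have -> : y = (y - n%:R * pi) + n%:R * pi by rewrite subrK.
rewrite sin_addnpi.
rewrite ger0_norm in d1; last lra.
rewrite ler0_norm in d2; last lra.
move: (n%:R * pi) h1 h2 d1 d2 => m h1 h2 d1 d2.
have [z|z] := leP (y - m) (pi / 2).
  have z0 : 0 <= y - m by lra.
  by have := sin_ge_quarter z0 z; have := ler_norm (sin (y - m)); lra.
have := @sin_ge_quarter (pi - (y - m)); rewrite sinB sinpi cospi mul0r mulN1r sub0r opprK.
by have := ler_norm (sin (y - m)) => ? /(_ ltac:(lra) ltac:(lra)); lra.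
Qed.

End SineLowerBound.

(** * Stability of the continuous Helmholtz problem *)

Section Stability.
Variable R : realType.
Implicit Types (x y c k s : R) (f g u b : R -> R).

Variables (L : R).
Hypothesis L0 : 0 < L.
Notation nrm := (nrm L).

Lemma nrm_CS f g : lbm f -> lbm g -> `|sint (fun x => f x * g x) 0 L| <= nrm f * nrm g.
Proof.
move=> fb gb; apply: le_of_sqr; first by rewrite mulr_ge0 ?nrm_ge0.
by rewrite exprMn !nrm_sq //; apply: L2l_CS; [exact: ltW|exact: L2l_lbm|exact: L2l_lbm].
Qed.

Lemma nrmZ c f : lbm f -> nrm (fun x => c * f x) = `|c| * nrm f.
Proof.
move=> fb; rewrite -sqrtr_sqr -sqrtrM ?sqr_ge0 //; congr Num.sqrt.
rewrite -sintZ; last exact/lint_lbm/lbmX.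
by apply: eq_sint => x _; rewrite exprMn.
Qed.

Lemma nrmD f g : lbm f -> lbm g -> nrm (fun x => f x + g x) <= nrm f + nrm g.
Proof.
move=> fb gb; apply: le_trans (ler_norm _) _; apply: le_of_sqr.
  by rewrite addr_ge0 ?nrm_ge0.
have i1 := lint_lbm (lbmX 2 fb); have i2 := lint_lbm (lbmX 2 gb).
have i3 := lint_lbm (lbmM fb gb).
rewrite nrm_sq //; have -> : sint (fun x => (f x + g x) ^+ 2) 0 L =
    sint (fun x => f x ^+ 2) 0 L + 2 * sint (fun x => f x * g x) 0 L + sint (fun x => g x ^+ 2) 0 L.
  rewrite -sintZ // -sintD //; last exact: lintZ.
  rewrite -sintD //; last by apply: lintD => //; exact: lintZ.
  by apply: eq_sint => x _; ring.
rewrite -!nrm_sq //; have := nrm_CS fb gb; move/(le_trans (ler_norm _)).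
by move: (sint _ _ _) => m; nra.
Qed.

Lemma eq_nrm f g : (forall x, 0 <= x <= L -> f x = g x) -> nrm f = nrm g.
Proof.
move=> E; apply: (congr1 Num.sqrt); apply: eq_sint => x.
by rewrite min_l ?max_r ?(ltW L0) // => /E ->.
Qed.

Lemma derives_sin k c : derives (fun x => sin (k * (x + - c))) (fun x => k * cos (k * (x + - c))).
Proof.
move=> x; have D := derivesZ k (derivesD (@derives_id R) (derives_cst (- c))).
have := @is_derive1_comp _ sin (fun x => k * (x + - c)) x _ _ (is_derive_sin _) (D x).
by rewrite addr0 mulr1 mulrC; apply.
Qed.

Lemma derives_cos k c : derives (fun x => cos (k * (x + - c))) (fun x => - (k * sin (k * (x + - c)))).
Proof.
move=> x; have D := derivesZ k (derivesD (@derives_id R) (derives_cst (- c))).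
have := @is_derive1_comp _ cos (fun x => k * (x + - c)) x _ _ (is_derive_cos _) (D x).
by rewrite addr0 mulr1 mulNr mulrC; apply.
Qed.

Variables (ab omega : R) (b u u1 u2 : R -> R).
Hypotheses (ab0 : 0 < ab) (om0 : 0 < omega) (bc : continuous b) (u2c : continuous u2).
Hypotheses (Du : derives u u1) (Du1 : derives u1 u2) (u00 : u 0 = 0) (uL : u L = 0).
Hypothesis eqn : forall x, 0 <= x <= L -> ab * u2 x + omega ^+ 2 * u x = b x.

Let k := omega / Num.sqrt ab.

Let k0 : 0 < k. Proof. by rewrite divr_gt0 // sqrtr_gt0. Qed.

Let k2 : k ^+ 2 * ab = omega ^+ 2.
Proof. by rewrite /k expr_div_n sqr_sqrtr ?(ltW ab0) // divfK // gt_eqF. Qed.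

Lemma wronskian_sine x y c : 0 <= x -> x <= y -> y <= L ->
  let P x := u1 x * sin (k * (x + - c)) - k * u x * cos (k * (x + - c)) in
  ab * `|P y - P x| <= sint (fun s => `|b s|) x y.
Proof.
move=> x0 xy yL; cbv zeta; set P := fun x : R => _; pose r s := (u2 s + k ^+ 2 * u s) * sin (k * (s + - c)).
have DP : derives P r.
  have := derivesD (derivesM Du1 (derives_sin k c))
    (derivesZ (- k) (derivesM Du (derives_cos k c))).
  by apply: eq_derives => s; rewrite /P /r; ring.
have sc := derives_cont (derives_sin k c); have uc := derives_cont Du.
have rc : continuous r.
  move=> s; apply: cvgM; last exact: sc.
  by apply: cvgD; [exact: u2c|apply: cvgM; [exact: cvg_cst|exact: uc]].
have rl := lint_lbm (lbm_continuous rc).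
rewrite (FTC_all rc DP); apply: le_trans (ler_wpM2l (ltW ab0) (sint_abs rl xy)) _.
rewrite -sintZ; last exact: lint_abs.
apply: le_sint => //; first exact/lintZ/lint_abs.
  exact/lint_abs/lint_lbm/lbm_continuous.
move=> s /andP[s1 s2]; rewrite -{1}(gtr0_norm ab0) -normrM mulrA.
have -> : ab * (u2 s + k ^+ 2 * u s) = b s.
  rewrite -eqn; last by apply/andP; split; lra.
  by rewrite -k2; ring.
by rewrite normrM ler_piMr // sin_max.
Qed.

(** The Wronskian with c = 0 vanishes at 0 and the one with c = L vanishes at L, so the unknown end
    slopes drop out. Eliminating u'(x) between their values at x leaves k u(x) sin(k L) by the
    addition formula. *)
Lemma helmholtz_sup x : 0 <= x <= L ->
  `|u x| * (k * ab * `|sin (k * L)|) <= sint (fun s => `|b s|) 0 L.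
Proof.
move=> /andP[x0 xL].
have W1 := @wronskian_sine 0 x 0 (lexx 0) x0 xL.
have W2 := @wronskian_sine x L L x0 xL (lexx L).
rewrite /= u00 subrr !mulr0 sin0 mulr0 mul0r !subr0 in W1.
rewrite /= uL subrr !mulr0 sin0 mulr0 mul0r !subr0 sub0r normrN in W2.
have bl : lint (fun s => `|b s|) by exact/lint_abs/lint_lbm/lbm_continuous.
rewrite -(@sint_chasles _ _ 0 x L) //; apply: le_trans (lerD W1 W2).
have s1 : `|sin (k * x)| <= 1 by exact: sin_max.
have s2 : `|sin (k * (x - L))| <= 1 by exact: sin_max.
have -> : `|u x| * (k * ab * `|sin (k * L)|) = ab * `|u x * k * sin (k * L)|.
  by rewrite normrM [`|u x * k|]normrM (gtr0_norm k0); ring.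
rewrite -mulrDr ler_pM2l //.
have -> : u x * k * sin (k * L) =
  (u1 x * sin (k * x) - k * u x * cos (k * x)) * sin (k * (x - L)) -
  (u1 x * sin (k * (x - L)) - k * u x * cos (k * (x - L))) * sin (k * x).
  have -> : sin (k * L) = sin (k * x - k * (x - L)) by congr sin; ring.
  by rewrite sinB; ring.
apply: le_trans (ler_normB _ _) _; rewrite !normrM.
by apply: lerD; rewrite ler_piMr.
Qed.

(** The gap makes |sin(k L)| at least d L / (4 sqrt(ab)). Integrating the sup bound over (0, L) and
    applying Cauchy-Schwarz to b gives one factor L on each side, which cancels. *)
Lemma helmholtz_stability d : d <= omega -> 0 < d ->
  (forall j : nat, (0 < j)%N -> d <= `|omega - Num.sqrt ab * (pi * j%:R / L)|) ->
  omega * d * nrm u <= 4 * nrm b.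
Proof.
move=> dom d0 dj; have ub := lbm_continuous (derives_cont Du); have bb := lbm_continuous bc.
have q0 : 0 < Num.sqrt ab by rewrite sqrtr_gt0.
have q2 : Num.sqrt ab ^+ 2 = ab by rewrite sqr_sqrtr // ltW.
pose m := k * ab * `|sin (k * L)|.
have S : d * L / Num.sqrt ab / 4 <= `|sin (k * L)|.
  apply: sin_ge_dist; first by rewrite mulr_ge0 ?(ltW k0) ?(ltW L0).
  case=> [|j].
    (* The multiple 0 of pi is not among the resonances j >= 1; here the bound d <= omega takes
       over. *)
    rewrite mul0r subr0 gtr0_norm; last exact: mulr_gt0.
    have -> : k * L = omega * L / Num.sqrt ab by rewrite /k mulrAC.
    by rewrite ler_pM2r ?invr_gt0 // ler_pM2r.
  have -> : k * L - j.+1%:R * pi =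
      (omega - Num.sqrt ab * (pi * j.+1%:R / L)) * (L / Num.sqrt ab).
    by rewrite /k; move: (j.+1%:R) (pi) => w z; field; rewrite !gt_eqF.
  rewrite normrM (gtr0_norm (_ : 0 < L / Num.sqrt ab)) ?divr_gt0 // -mulrA.
  by rewrite ler_pM2r ?divr_gt0 // dj.
have mS : omega * d * L / 4 <= m.
  have kab : 0 < k * ab by rewrite mulr_gt0.
  apply: le_trans (ler_wpM2l (ltW kab) S); rewrite /k -{2}q2 le_eqVlt; apply/orP; left.
  by apply/eqP; field; rewrite gt_eqF.
have m0 : 0 <= m by rewrite mulr_ge0 // mulr_ge0 ?(ltW k0) ?(ltW ab0).
have B0 : 0 <= sint (fun s => `|b s|) 0 L.
  by apply: sint_ge0 => [|s _]; [exact: ltW|exact: normr_ge0].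
have H1 : (m * nrm u) ^+ 2 <= (L * nrm b) ^+ 2.
  have := sint_abs_sq (ltW L0) bb; rewrite subr0 -nrm_sq // => HB.
  apply: (@le_trans _ _ (L * sint (fun s => `|b s|) 0 L ^+ 2)); last first.
    rewrite exprMn [L ^+ 2]expr2 -mulrA ler_pM2l //.
  have ul : lint (fun x => u x ^+ 2) by exact/lint_lbm/lbmX.
  rewrite exprMn nrm_sq // -sintZ // [leRHS]mulrC -[X in _ * X](subr0 L) -sint_cst.
  apply: le_sint; [exact: lintZ|exact/lint_lbm/lbm_cst|exact: ltW|].
  move=> x /helmholtz_sup; rewrite -/m => Hx.
  rewrite -exprMn -(real_normK (num_real (m * u x))) ler_sqr ?nnegrE //.
  by rewrite normrM (ger0_norm m0) mulrC.
have {}H1 : m * nrm u <= L * nrm b.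
  by apply: le_trans (ler_norm _) (le_of_sqr _ H1); rewrite mulr_ge0 ?nrm_ge0 // ltW.
have := le_trans (ler_wpM2r (nrm_ge0 L u) mS) H1.
have -> : omega * d * L / 4 * nrm u = L * (omega * d * nrm u / 4) by ring.
by rewrite ler_pM2l //; lra.
Qed.

(** The integrals of u b'' and u'' b agree, because both u and b vanish at the ends; the equation
    then expresses |b|^2 through pairings with u. *)
Lemma helmholtz_inverse_bound (b1 b2 : R -> R) : prim b b1 -> prim b1 b2 -> lbm b2 ->
  b 0 = 0 -> b L = 0 -> nrm b ^+ 2 <= nrm u * (omega ^+ 2 * nrm b + ab * nrm b2).
Proof.
move=> pb pb1 b2b b00 bL; have ub := lbm_continuous (derives_cont Du).
have bb := lbm_continuous bc; have b1b := prim_lbm pb1 b2b.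
have u1b := lbm_continuous (derives_cont Du1); have u2b := lbm_continuous u2c.
have pu := FTC_all (derives_cont Du1) Du; have pu1 := FTC_all u2c Du1.
have E1 := prim_mul pu pb1 u1b b2b 0 L; have E2 := prim_mul pu1 pb u2b b1b 0 L.
rewrite u00 uL !mul0r subrr in E1; rewrite b00 bL !mulr0 subrr in E2.
have i1 : lint (fun x => u1 x * b1 x) by exact/lint_lbm/lbmM.
have i2 : lint (fun x => u x * b2 x) by exact/lint_lbm/lbmM.
have i3 : lint (fun x => u2 x * b x) by exact/lint_lbm/lbmM.
have i4 : lint (fun x => u x * b x) by exact/lint_lbm/lbmM.
rewrite sintD // in E1; rewrite sintD // in E2.
have E3 : ab * sint (fun x => u2 x * b x) 0 L =
    nrm b ^+ 2 - omega ^+ 2 * sint (fun x => u x * b x) 0 L.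
  rewrite nrm_sq // -!sintZ // -sintB //; [|exact/lint_lbm/lbmX|exact: lintZ].
  apply: eq_sint => x; rewrite min_l ?max_r ?(ltW L0) // => /eqn E.
  by rewrite -E; ring.
have -> : nrm b ^+ 2 = omega ^+ 2 * sint (fun x => u x * b x) 0 L +
    ab * sint (fun x => u x * b2 x) 0 L.
  have -> : sint (fun x => u x * b2 x) 0 L = sint (fun x => u2 x * b x) 0 L by lra.
  by rewrite E3; ring.
have := le_trans (ler_norm _) (nrm_CS ub bb); have := le_trans (ler_norm _) (nrm_CS ub b2b).
move: (sint _ _ _) (sint _ _ _) => p q Hp Hq.
have w0 : 0 <= omega ^+ 2 by exact: sqr_ge0.
have := ler_wpM2l w0 Hq; have := ler_wpM2l (ltW ab0) Hp.
rewrite mulrDr [nrm u * (omega ^+ 2 * _)]mulrCA [nrm u * (ab * _)]mulrCA; lra.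
Qed.

End Stability.

(** * Extension of source and solution to the whole line *)

Section Extension.
Variable R : realType.
Implicit Types (x y c d e s L M ab omega : R) (f g h b u : R -> R).
Notation mu := (@lebesgue_measure R).

Lemma cst_oo L f x y : (forall z, 0 < z < L -> is_derive z 1 f 0) ->
  0 < x < L -> 0 < y < L -> f x = f y.
Proof.
move=> D; wlog : x y / x < y => [W xL yL|xy /andP[x0 xL] /andP[y0 yL]].
  by have [/W->|/W->|->] := ltgtP x y.
have [||c _] := @MVT R f (fun=> 0) x y xy.
- by move=> z; rewrite in_itv /= => /andP[z1 z2]; apply: D; apply/andP; split; lra.
- apply: derivable_within_continuous => z; rewrite in_itv /= => /andP[z1 z2].
  by have [|] := D z; first by apply/andP; split; lra.
by rewrite mul0r => /eqP; rewrite subr_eq0 => /eqP.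
Qed.

Lemma restrict_lbm L h M : (forall x, 0 < x < L -> {for x, continuous h}) ->
  (forall x, 0 < x < L -> `|h x| <= M) -> lbm (h \_ `]0, L[).
Proof.
move=> hc hM; have hr x : (h \_ `]0, L[) x = if 0 < x < L then h x else 0.
  by rewrite /patch mem_setE /= in_itv /=.
split.
  apply/(@measurable_restrictT _ _ _ _ `]0, L[ h (measurable_itv _)).
  apply: open_continuous_measurable_fun; first exact: interval_open.
  by move=> x /[!inE]/=; rewrite in_itv /=; exact: hc.
move=> B; exists `|M| => x _; rewrite hr; case: ifP => [/hM/le_trans|_]; last by rewrite normr0.
by apply; exact: ler_norm.
Qed.

Lemma restrict_cont L h x : 0 < x < L -> {for x, continuous h} -> {for x, continuous (h \_ `]0, L[)}.
Proof.
move=> xL /cont_epsP hc; apply/cont_epsP => e /hc[d d0 Hd].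
have hr y : (h \_ `]0, L[) y = if 0 < y < L then h y else 0.
  by rewrite /patch mem_setE /= in_itv /=.
have /andP[x0 xl] := xL.
exists (Num.min d (Num.min x (L - x))); first by rewrite !lt_min d0 x0 subr_gt0.
move=> y; rewrite !lt_min => /and3P[yd]; rewrite !ltr_norml => /andP[y1 _] /andP[_ y2].
rewrite !hr xL (_ : 0 < y < L); last by apply/andP; split; lra.
exact: Hd.
Qed.

(** Nothing is known at the ends or outside, so the second derivative [h] is integrated twice from
    the midpoint; the result agrees with [f] inside since the differences are constant there. *)
Lemma C2_extension L f h : 0 < L ->
  (forall x, 0 < x < L -> derivable f x 1) ->
  (forall x, 0 < x < L -> derivable f^`() x 1) ->
  lbm h -> (forall x, 0 < x < L -> {for x, continuous h}) ->
  (forall x, 0 < x < L -> h x = f^`(2) x) ->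
  exists g (g1 : R -> R), [/\ derives g g1, prim g1 h & forall x, 0 < x < L -> g x = f x].
Proof.
move=> L0 df df1 hb hc hE; have hl := lint_lbm hb.
pose m := L / 2; have mL : 0 < m < L by rewrite /m; apply/andP; split; lra.
pose g1 x := derive1 f m + sint h m x.
have g1p : prim g1 h by move=> x y; rewrite /g1 -(@sint_chasles _ h m x y) //; ring.
have g1E x : 0 < x < L -> g1 x = derive1 f x.
  move=> xL; apply/eqP; rewrite -subr_eq0; apply/eqP.
  have -> : 0 = g1 m - derive1 f m by rewrite /g1 sintxx addr0 subrr.
  apply: (@cst_oo L (fun z => g1 z - derive1 f z)) => // z zL.
  have D1 := is_deriveD (is_derive_cst (derive1 f m) z 1) (sint_is_derive m hl (hc z zL)).
  have D2 := derivableP (df1 z zL); rewrite -derive1E in D2.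
  have := is_deriveB D1 D2; rewrite add0r hE // subrr; apply.
have g1c := prim_cont g1p hb.
pose g x := f m + sint g1 m x.
have Dg : derives g g1.
  move=> x; have := is_deriveD (is_derive_cst (f m) x 1)
    (sint_is_derive m (lint_lbm (lbm_continuous g1c)) (g1c x)).
  by rewrite add0r; apply.
exists g, g1; split => // x xL.
apply/eqP; rewrite -subr_eq0; apply/eqP.
have -> : 0 = g m - f m by rewrite /g sintxx addr0 subrr.
apply: (@cst_oo L (fun z => g z - f z)) => // z zL.
have D2 := derivableP (df z zL); rewrite -derive1E in D2.
by have := is_deriveB (Dg z) D2; rewrite g1E // subrr; apply.
Qed.

(** The projection onto [0, L]; composing with it turns continuity within [0, L] into continuity on
    the line. *)
Definition clamp L x := Num.max 0 (Num.min x L).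

Lemma clamp_itv L x : 0 < L -> 0 <= clamp L x <= L.
Proof. by move=> L0; rewrite /clamp le_max lexx ge_max (ltW L0) ge_min lexx orbT. Qed.

Lemma clamp_id L x : 0 <= x <= L -> clamp L x = x.
Proof. by move=> /andP[x0 xL]; rewrite /clamp min_l // max_r. Qed.

Lemma clamp_lip L x y : 0 < L -> `|clamp L y - clamp L x| <= `|y - x|.
Proof.
move=> L0; wlog xy : x y / x <= y => [W|].
  by have [/W//|/ltW/W] := leP x y; rewrite distrC [`|x - y|]distrC.
have : Num.min x L <= Num.min y L by case: (leP x L); case: (leP y L); lra.
have : Num.min y L <= Num.min x L + (y - x) by case: (leP x L); case: (leP y L); lra.
rewrite /clamp [`|y - x|]ger0_norm ?subr_ge0 // ler_norml.
move: (Num.min x L) (Num.min y L) => p q h1 h2.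
by case: (leP 0 p); case: (leP 0 q) => *; apply/andP; split; lra.
Qed.

Lemma clamp_cont L u : 0 < L -> {within `[0, L], continuous u} ->
  continuous (fun x => u (clamp L x)).
Proof.
move=> L0 /subspace_continuousP uc x; apply/cont_epsP => e e0.
have cL : (`[0, L] : set R) (clamp L x) by rewrite /= in_itv /= clamp_itv.
have /cvgrPdist_le/(_ e e0) := uc _ cL; rewrite /within /=; case=> d /= d0 Hd.
exists d => // y yx; rewrite distrC; apply: Hd.
  by rewrite /ball_ /= distrC; apply: le_lt_trans (clamp_lip x y L0) yx.
by rewrite /= in_itv /= clamp_itv.
Qed.

Lemma eq_cont_ends L f g : 0 < L -> continuous f -> continuous g ->
  (forall x, 0 < x < L -> f x = g x) -> forall x, 0 <= x <= L -> f x = g x.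
Proof.
move=> L0 fc gc E x /andP[x0 xL]; apply/eqP; rewrite -subr_eq0 -normr_le0.
apply/ler_addgt0Pr => e e0; rewrite add0r; have e2 : 0 < e / 2 by lra.
have /cont_epsP/(_ _ e2)[d1 d10 H1] := fc x; have /cont_epsP/(_ _ e2)[d2 d20 H2] := gc x.
suff [y yx yL] : exists2 y, `|y - x| < Num.min d1 d2 & 0 < y < L.
  move: yx; rewrite lt_min => /andP[/H1 Y1 /H2 Y2]; rewrite E // in Y1.
  rewrite (_ : f x - g x = (g y - g x) - (g y - f x)); last by ring.
  by apply: le_trans (ler_normB _ _) _; lra.
have dd : 0 < Num.min d1 d2 by rewrite lt_min d10.
move: (Num.min d1 d2) dd => d d0.
have r0 : 0 < Num.min d L by rewrite lt_min d0.
have r1 : Num.min d L <= d by rewrite ge_min lexx.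
have r2 : Num.min d L <= L by rewrite ge_min lexx orbT.
move: (Num.min d L) r0 r1 r2 => r r0 r1 r2.
have [xh|xh] := leP x (L / 2).
  by exists (x + r / 4); [rewrite addrAC subrr add0r gtr0_norm; lra|apply/andP; split; lra].
by exists (x - r / 4); [rewrite addrAC subrr add0r normrN gtr0_norm; lra|apply/andP; split; lra].
Qed.

Lemma normL2E L f g : 0 < L -> lbm g -> (forall x, 0 < x < L -> f x = g x) ->
  normL2 L f = nrm L g.
Proof.
move=> L0 gb E; rewrite /normL2 /nrm; congr Num.sqrt.
rewrite (@eq_Rintegral _ _ _ mu `]0, L[ (fun x => g x ^+ 2)); last first.
  by move=> x /[!inE]/=; rewrite in_itv /= => xL; rewrite E.
have mg : measurable_fun `]0, L[ (EFin \o (fun x => g x ^+ 2)).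
  by apply/measurable_EFinP; apply: measurable_funTS; case: (lbmX 2 gb).
by rewrite sint_le ?(ltW L0) // /Rintegral [in RHS]integral_itv_bndoo.
Qed.

(** b'' is bounded but may have no limit at the ends, so it is continued by zero; this is why second
    derivatives of sources enter only through primitives. *)
Lemma source_extension L b : 0 < L -> Cb2 L b -> exists g (g1 g2 : R -> R),
  [/\ derives g g1, prim g1 g2, lbm g2, forall x, 0 < x < L -> g x = b x &
      forall x, 0 < x < L -> g2 x = b^`(2) x].
Proof.
move=> L0 [db db1 cb [M HM]].
have hb : lbm (b^`(2) \_ `]0, L[) by apply: restrict_lbm cb (fun x xL => (HM x xL).2).
have hE x : 0 < x < L -> (b^`(2) \_ `]0, L[) x = b^`(2) x.
  by move=> xL; rewrite /patch mem_setE /= in_itv /= xL.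
have hc x (xL : 0 < x < L) := restrict_cont xL (cb x xL).
have [g [g1 [Dg pg E]]] := C2_extension L0 db db1 hb hc hE.
by exists g, g1, (b^`(2) \_ `]0, L[).
Qed.

(** The second derivative is read off the equation, whose terms are continuous up to the ends; hence
    the extension is C2, and the equation holds on the closed interval. *)
Lemma solution_extension ab omega L b u g : 0 < L -> 0 < ab -> continuous g ->
  (forall x, 0 < x < L -> g x = b x) -> helmholtz_solution ab omega L b u ->
  exists v (v1 v2 : R -> R), [/\ [/\ derives v v1, derives v1 v2 & continuous v2],
    v 0 = 0, v L = 0, forall x, 0 <= x <= L -> ab * v2 x + omega ^+ 2 * v x = g x &
    forall x, 0 <= x <= L -> v x = u x].
Proof.
move=> L0 ab0 gc gE [uc du du1 eqn [u0 uL]].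
have cc := clamp_cont L0 uc.
pose h x := ab^-1 * (g x - omega ^+ 2 * u (clamp L x)).
have hc : continuous h.
  move=> x; apply: cvgM; first exact: cvg_cst.
  apply: cvgB; first exact: gc.
  by apply: cvgM; [exact: cvg_cst|exact: cc].
have hE x : 0 < x < L -> h x = u^`(2) x.
  move=> xL; have /andP[x0 xl] := xL; rewrite /h clamp_id ?(ltW x0) ?(ltW xl) // gE // -eqn //.
  by rewrite addrK mulKf // gt_eqF.
have [v [v1 [Dv pv E]]] := C2_extension L0 du du1 (lbm_continuous hc) (fun x _ => hc x) hE.
have Ec : forall x, 0 <= x <= L -> v x = u x.
  move=> x xL; rewrite -[in RHS](clamp_id xL).
  apply: (eq_cont_ends L0 (derives_cont Dv) cc) xL => y yL.
  by have /andP[y0 yl] := yL; rewrite clamp_id ?(ltW y0) ?(ltW yl) // E.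
exists v, v1, h; split => //.
- split => // x; have hl := lint_lbm (lbm_continuous hc).
  have -> : v1 = (fun x => v1 0 + sint h 0 x).
    by apply/funext => z; rewrite -pv; ring.
  by have := is_deriveD (is_derive_cst (v1 0) x 1) (sint_is_derive 0 hl (hc x));
     rewrite add0r; apply.
- by rewrite Ec ?u0 // lexx ltW.
- by rewrite Ec ?uL // lexx ltW.
- by move=> x xL; rewrite Ec // /h clamp_id // mulVKf ?gt_eqF // subrK.
Qed.

End Extension.

(** * Error bounds for the fixed point *)

Section MacroError.
Variable R : realType.
Implicit Types (x y c d : R).

Lemma nrm_gt0 (L x : R) (b : R -> R) : continuous b -> 0 < x < L -> b x != 0 -> 0 < nrm L b.
Proof.
move=> bc /andP[x0 xL] bx; have L0 : 0 < L by exact: lt_trans xL.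
pose c := `|b x| / 2; have c0 : 0 < c by rewrite divr_gt0 // normr_gt0.
have /cont_epsP/(_ c c0)[d d0 Hd] := bc x.
pose r := Num.min (d / 2) (Num.min x (L - x)).
have r0 : 0 < r by rewrite !lt_min x0 subr_gt0 xL divr_gt0.
have : r <= r by []. rewrite {2}/r !le_min => /and3P[rd rx rL].
rewrite sqrtr_gt0; apply: (@lt_le_trans _ _ (c ^+ 2 * (x + r - (x - r)))).
  by rewrite mulr_gt0 ?exprn_gt0 //; lra.
have bl : lint (fun s => b s ^+ 2) by exact/lint_lbm/lbmX/lbm_continuous.
apply: (@le_trans _ _ (sint (fun s => b s ^+ 2) (x - r) (x + r))); last first.
  by apply: sint_sub => // [s|||]; [exact: sqr_ge0|lra|lra|lra].
rewrite -sint_cst; apply: le_sint => //; [exact/lint_lbm/lbm_cst|lra|].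
move=> s /andP[s1 s2]; have : `|s - x| < d by rewrite ltr_norml; apply/andP; split; lra.
move=> /Hd; rewrite -(real_normK (num_real (b s))) distrC => H.
rewrite ler_sqr ?nnegrE ?(ltW c0) //.
have := ler_normD (b x - b s) (b s); rewrite subrK.
by move: H; rewrite /c; lra.
Qed.

Variables (L ab alpha omega del : R) (Mx : nat) (b b1 b2 u u1 u2 : R -> R) (vh : 'cV[R]_Mx).
Hypotheses (L0 : 0 < L) (Mx0 : (1 <= Mx)%N) (ab0 : 0 < ab) (al0 : 0 < alpha) (om1 : 1 <= omega).
Hypotheses (del0 : 0 < del) (del_om : del <= omega).
Hypothesis del_al : del <= gap_discrete L Mx alpha omega.
Hypothesis del_ab : forall j : nat, (0 < j)%N ->
  del <= `|omega - Num.sqrt ab * (pi * j%:R / L)|.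
Notation H := (Hstep L Mx).
Notation nrm := (nrm L).
Notation normH := (normH L).
Notation gridvec := (gridvec L Mx).
Hypothesis Hom : H * omega <= Num.sqrt ab.
Hypotheses (Db : derives b b1) (pb1 : prim b1 b2) (b2b : lbm b2).
Hypotheses (Du : derives u u1) (Du1 : derives u1 u2) (u2c : continuous u2).
Hypotheses (u00 : u 0 = 0) (uL : u L = 0).
Hypothesis eqn : forall x, 0 <= x <= L -> ab * u2 x + omega ^+ 2 * u x = b x.
Hypothesis vhE : alpha *: (D2 L Mx *m vh) + omega ^+ 2 *: vh = gridvec b.

Let om0 : 0 < omega. Proof. exact: lt_le_trans om1. Qed.
Let kap := omega / Num.sqrt ab.
Let B := Num.sqrt (nrm b ^+ 2 + kap ^- 4 * nrm b2 ^+ 2).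
Let Q := B + omega ^+ 2 * nrm u.

Let kap0 : 0 < kap. Proof. by rewrite divr_gt0 // sqrtr_gt0. Qed.

Let kap2 : kap ^+ 2 = omega ^+ 2 / ab.
Proof. by rewrite /kap expr_div_n sqr_sqrtr // ltW. Qed.

Let B0 : 0 <= B. Proof. exact: sqrtr_ge0. Qed.

Let B2 : B ^+ 2 = nrm b ^+ 2 + kap ^- 4 * nrm b2 ^+ 2.
Proof. by rewrite sqr_sqrtr // addr_ge0 ?sqr_ge0 // mulr_ge0 ?sqr_ge0 // invr_ge0 exprn_ge0 // ltW. Qed.

Let Q0 : 0 <= Q.
Proof. by apply: addr_ge0 => //; apply: mulr_ge0; [exact: sqr_ge0|exact: nrm_ge0]. Qed.

Let Hom2 : H ^+ 2 * omega ^+ 2 <= ab.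
Proof.
rewrite -exprMn -[leRHS](sqr_sqrtr (ltW ab0)) ler_sqr ?nnegrE ?sqrtr_ge0 //.
by rewrite mulr_ge0 ?(ltW om0) // ltW // Hstep_gt0.
Qed.

Lemma source_le : nrm b <= B.
Proof.
apply: le_trans (ler_norm _) (le_of_sqr B0 _); rewrite B2 lerDl.
by rewrite mulr_ge0 ?sqr_ge0 // invr_ge0 exprn_ge0 // ltW.
Qed.

Lemma source2_le : nrm b2 <= omega ^+ 2 / ab * B.
Proof.
have k0 : 0 <= kap ^+ 2 * B by rewrite mulr_ge0 // sqr_ge0.
rewrite -kap2; apply: le_trans (ler_norm _) (le_of_sqr k0 _).
have k4 : 0 < kap ^+ 4 by rewrite exprn_gt0.
have -> : (kap ^+ 2 * B) ^+ 2 = kap ^+ 4 * B ^+ 2 by ring.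
rewrite B2 mulrDr mulVKf ?gt_eqF // lerDr.
by rewrite mulr_ge0 ?sqr_ge0 // ltW.
Qed.

(** The right side of the equation solved for u''. It can be differentiated twice more, which its
    counterpart [u2] is not known to allow outside [0, L]. *)
Let F x := ab^-1 * (b x - omega ^+ 2 * u x).
Let F1 x := ab^-1 * (b1 x - omega ^+ 2 * u1 x).
Let F2 x := ab^-1 * (b2 x - omega ^+ 2 * u2 x).

Let bb : lbm b. Proof. exact: lbm_continuous (derives_cont Db). Qed.
Let ub : lbm u. Proof. exact: lbm_continuous (derives_cont Du). Qed.
Let u2b : lbm u2. Proof. exact: lbm_continuous. Qed.

Let DF : derives F F1.
Proof.
have := derivesZ ab^-1 (derivesD Db (derivesZ (- omega ^+ 2) Du)).
by apply: eq_derives => x; rewrite mulNr.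
Qed.

Let pF1 : prim F1 F2.
Proof.
move=> x y; have pu1 := FTC_all u2c Du1.
rewrite /F2 sintZ; last by apply: lintB; [exact: lint_lbm|apply: lintZ; exact: lint_lbm].
rewrite sintB; [|exact: lint_lbm|by apply: lintZ; exact: lint_lbm].
by rewrite sintZ; [rewrite -pb1 -pu1 /F1; ring|exact: lint_lbm].
Qed.

Let F2b : lbm F2.
Proof.
apply: lbmM; first exact: lbm_cst.
by apply: lbmB => //; apply: lbmM => //; exact: lbm_cst.
Qed.

Let u2F x : 0 <= x <= L -> u2 x = F x.
Proof. by move=> /eqn E; rewrite /F -E addrK mulKf // gt_eqF. Qed.

Let nrm_resid (f g : R -> R) : lbm f -> lbm g ->
  nrm (fun x => ab^-1 * (f x - omega ^+ 2 * g x)) <= (nrm f + omega ^+ 2 * nrm g) / ab.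
Proof.
move=> fb gb; have gb' : lbm (fun x => - omega ^+ 2 * g x) by apply: lbmM => //; exact: lbm_cst.
rewrite (@eq_nrm _ L L0 _ (fun x => ab^-1 * (f x + - omega ^+ 2 * g x))); last first.
  by move=> x _; rewrite mulNr.
rewrite nrmZ //; last exact: lbmD.
rewrite gtr0_norm ?invr_gt0 // mulrC ler_pM2r ?invr_gt0 //.
apply: le_trans (nrmD L0 fb gb') _.
by rewrite nrmZ // normrN ger0_norm ?sqr_ge0.
Qed.

Lemma laplacian_le : nrm u2 <= Q / ab.
Proof.
rewrite (eq_nrm L0 u2F); apply: le_trans (nrm_resid bb ub) _.
by rewrite ler_pM2r ?invr_gt0 // lerD2r source_le.
Qed.

Let bilaplacian_le : H ^+ 2 * nrm F2 <= 2 * (H ^+ 2 * omega ^+ 2) * (Q / ab) / ab.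
Proof.
have h2 : 0 <= H ^+ 2 by exact: sqr_ge0.
have w2 : 0 <= omega ^+ 2 by exact: sqr_ge0.
have -> : 2 * (H ^+ 2 * omega ^+ 2) * (Q / ab) / ab =
    H ^+ 2 * ((omega ^+ 2 / ab * Q + omega ^+ 2 * (Q / ab)) / ab) by ring.
apply: ler_wpM2l => //; apply: le_trans (nrm_resid b2b u2b) _.
rewrite ler_pM2r ?invr_gt0 //; apply: lerD; last by rewrite ler_wpM2l // laplacian_le.
apply: le_trans source2_le _; rewrite ler_wpM2l // ?divr_ge0 ?(ltW ab0) //.
by rewrite /Q lerDl mulr_ge0 // nrm_ge0.
Qed.

(** Since H^2 omega^2 <= ab, the consistency error is at most 4 Q / ab and the grid norm of u'' at
    most 6 Q / ab; together they bound the discrete Laplacian by 10 Q / ab. *)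
Lemma error_bound :
  omega * del * normH (gridvec u - vh) <=
    10 / ab * (`|ab - alpha| + H ^+ 2 * omega ^+ 2) * Q.
Proof.
set e := gridvec u - vh.
have g0 : 0 <= gap_discrete L Mx alpha omega by apply: le_trans del_al; exact: ltW.
have := discrete_stability L0 Mx0 e al0 om0 g0.
have e0 := normH_ge0 L e.
have S1 : omega * del * normH e <= omega * gap_discrete L Mx alpha omega * normH e.
  by rewrite ler_wpM2r // ler_wpM2l // ltW.
move=> /(le_trans S1) {S1} S.
have EE : alpha *: (D2 L Mx *m e) + omega ^+ 2 *: e =
    (alpha - ab) *: (D2 L Mx *m gridvec u) + ab *: (D2 L Mx *m gridvec u - gridvec F).
  have FE : ab *: gridvec F = gridvec b - omega ^+ 2 *: gridvec u.
    by apply/matrixP => i j; rewrite !mxE /F mulVKf // gt_eqF.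
  rewrite [ab *: (_ - _)]scalerBr FE /e mulmxBr [alpha *: (_ - _)]scalerBr.
  rewrite [_ *: (gridvec u - vh)]scalerBr -vhE scalerBl.
  move: (alpha *: (_ *m gridvec u)) (alpha *: (_ *m vh)) (ab *: _) (omega ^+ 2 *: vh) (omega ^+ 2 *: _).
  by move=> p q r s t; apply/matrixP => i j; rewrite !mxE; ring.
rewrite EE in S.
have C1 := consistency Mx L0 Du Du1 DF pF1 F2b u2F u00 uL.
have C2 := grid_le_nrm Mx L0 DF pF1 F2b.
have := bilaplacian_le.
have HQ : 2 * (H ^+ 2 * omega ^+ 2) * (Q / ab) / ab <= 2 * (Q / ab).
  have q0 : 0 <= Q / ab by exact: divr_ge0 Q0 (ltW ab0).
  rewrite ler_pdivrMr //; move: (Q / ab) q0 => q q0.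
  have -> : 2 * (H ^+ 2 * omega ^+ 2) * q = 2 * q * (H ^+ 2 * omega ^+ 2) by ring.
  by rewrite ler_wpM2l // mulr_ge0.
have FQ : nrm F <= Q / ab by rewrite -(eq_nrm L0 u2F) laplacian_le.
have N1 := normHD L0 (D2 L Mx *m gridvec u - gridvec F) (gridvec F); rewrite subrK in N1.
have := normHD L0 ((alpha - ab) *: (D2 L Mx *m gridvec u)) (ab *: (D2 L Mx *m gridvec u - gridvec F)).
rewrite !(normHZ L0) (gtr0_norm ab0) [`|alpha - ab|]distrC => /(le_trans S) {}S W.
apply: le_trans S _.
move: C1 C2 N1 W; move: (normH (D2 L Mx *m gridvec u)) (normH (_ - gridvec F)) (normH (gridvec F)).
move=> A E G; rewrite -mulrA; move: (H ^+ 2 * nrm F2) => z C1 C2 N1 W.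
have A10 : A <= 10 * (Q / ab) by lra.
have E2 : ab * E <= 4 * (H ^+ 2 * omega ^+ 2) * (Q / ab).
  apply: (@le_trans _ _ (ab * (2 * (2 * (H ^+ 2 * omega ^+ 2) * (Q / ab) / ab)))).
    by rewrite ler_pM2l //; lra.
  by rewrite le_eqVlt; apply/orP; left; apply/eqP; field; rewrite gt_eqF.
have q0 : 0 <= H ^+ 2 * omega ^+ 2 * (Q / ab).
  by apply: mulr_ge0; [apply: mulr_ge0; exact: sqr_ge0|exact: divr_ge0 Q0 (ltW ab0)].
have -> : 10 / ab * (`|ab - alpha| + H ^+ 2 * omega ^+ 2) * Q =
  `|ab - alpha| * (10 * (Q / ab)) + 10 * (H ^+ 2 * omega ^+ 2 * (Q / ab)) by ring.
apply: lerD; first by rewrite ler_wpM2l.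
by apply: le_trans E2 _; rewrite -mulrA; lra.
Qed.

(** Stability of the continuous problem gives del Q <= (1 + 4) omega B, whence 50 = 10 * 5 and the
    second power of the gap. *)
Lemma absolute_bound :
  normH (gridvec u - vh) <= 50 / ab * (`|ab - alpha| + H ^+ 2 * omega ^+ 2) / del ^+ 2 * B.
Proof.
have S := helmholtz_stability L0 ab0 om0 (derives_cont Db) u2c Du Du1 u00 uL eqn del_om del0 del_ab.
have Q5 : del * Q <= 5 * omega * B.
  rewrite /Q mulrDr.
  have h1 : del * B <= omega * B by rewrite ler_wpM2r.
  have h2 : del * (omega ^+ 2 * nrm u) <= omega * (4 * B).
    have -> : del * (omega ^+ 2 * nrm u) = omega * (omega * del * nrm u) by ring.
    by rewrite ler_wpM2l ?(ltW om0) //; apply: le_trans S _; rewrite ler_wpM2l // source_le.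
  lra.
have := error_bound; set X := `|ab - alpha| + _ => E.
have X0 : 0 <= 10 / ab * X.
  by rewrite mulr_ge0 ?divr_ge0 ?(ltW ab0) // addr_ge0 // mulr_ge0 // sqr_ge0.
have wd : 0 < omega * del ^+ 2 by rewrite mulr_gt0 // exprn_gt0.
rewrite -(ler_pM2l wd).
have -> : omega * del ^+ 2 * (50 / ab * X / del ^+ 2 * B) = 10 / ab * X * (5 * omega * B).
  by field; rewrite !gt_eqF.
apply: le_trans (ler_wpM2l X0 Q5).
have -> : omega * del ^+ 2 * normH (gridvec u - vh) = del * (omega * del * normH (gridvec u - vh)) by ring.
have -> : 10 / ab * X * (del * Q) = del * (10 / ab * X * Q) by ring.
by rewrite ler_wpM2l // ltW.
Qed.

(** Here Q is at most (D + 1) omega^2 |u|, so no second power of the gap is lost. The condition on H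
    is the one that allows [nrm_le_grid]; as 132 <= 12^2, the constant is 120 = 10 * 12. *)
Lemma relative_bound D : 0 < B -> B <= D * omega ^+ 2 * nrm u ->
  (D + 1) * (H ^+ 2 * omega ^+ 2) <= 5 * ab ->
  0 < normH (gridvec u) /\ normH (gridvec u - vh) / normH (gridvec u) <=
    120 * (D + 1) / ab * (`|ab - alpha| + H ^+ 2 * omega ^+ 2) * omega / del.
Proof.
move=> Bp BD HD.
have w2 : 0 < omega ^+ 2 by rewrite exprn_gt0.
have Dp : 0 < D * nrm u.
  have := lt_le_trans Bp BD; rewrite mulrAC pmulr_lgt0 //.
have un : 0 < nrm u.
  by rewrite lt_neqAle nrm_ge0 andbT eq_sym; apply/eqP => z; rewrite z mulr0 ltxx in Dp.
have D0 : 0 < D by rewrite pmulr_lgt0 in Dp.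
have QD : Q <= (D + 1) * omega ^+ 2 * nrm u.
  by rewrite /Q mulrDl mulrDl mul1r lerD2r.
have h5 : H ^+ 2 * nrm u2 <= 5 * nrm u.
  apply: (@le_trans _ _ (H ^+ 2 * ((D + 1) * omega ^+ 2 * nrm u / ab))).
    rewrite ler_wpM2l ?sqr_ge0 //; apply: le_trans laplacian_le _.
    by rewrite ler_pM2r ?invr_gt0.
  have -> : H ^+ 2 * ((D + 1) * omega ^+ 2 * nrm u / ab) =
    (D + 1) * (H ^+ 2 * omega ^+ 2) / ab * nrm u by ring.
  by rewrite ler_pM2r // ler_pdivrMr.
have G := nrm_le_grid L0 Du (FTC_all u2c Du1) u2b u00 uL h5.
have n0 := normH_ge0 L (gridvec u).
have n12 : nrm u <= 12 * normH (gridvec u).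
  apply: le_trans (ler_norm _) (le_of_sqr _ _); first by rewrite mulr_ge0.
  by apply: le_trans G _; rewrite exprMn ler_wpM2r ?sqr_ge0 // -natrX ler_nat.
have np : 0 < normH (gridvec u) by lra.
split=> //; rewrite ler_pdivrMr //.
have := error_bound; set X := `|ab - alpha| + _ => E.
have X0 : 0 <= 10 / ab * X.
  by rewrite mulr_ge0 ?divr_ge0 ?(ltW ab0) // addr_ge0 // mulr_ge0 // sqr_ge0.
have wd : 0 < omega * del by rewrite mulr_gt0.
rewrite -(ler_pM2l wd); apply: le_trans E _.
have Dw : 0 <= (D + 1) * omega ^+ 2 by rewrite mulr_ge0 ?(ltW w2) //; lra.
apply: le_trans (ler_wpM2l X0 (le_trans QD (ler_wpM2l Dw n12))) _.
by rewrite le_eqVlt; apply/orP; left; apply/eqP; field; rewrite !gt_eqF.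
Qed.

(** Once b'' is dominated, the inverse bound gives |b| <= 2 omega^2 |u|, and the weighted norm B is
    at most 2 |b|. *)
Lemma high_frequency_bound : b 0 = 0 -> b L = 0 -> 0 < nrm b ->
  ab * nrm b2 <= omega * nrm b -> B <= 4 * omega ^+ 2 * nrm u.
Proof.
move=> b00 bL bp hb.
have pb : prim b b1 by exact: FTC_all (prim_cont pb1 b2b) Db.
have := helmholtz_inverse_bound L0 ab0 (derives_cont Db) u2c Du Du1 u00 uL eqn pb pb1 b2b b00 bL.
have n0 := nrm_ge0 L u.
have hb2 : ab * nrm b2 <= omega ^+ 2 * nrm b.
  by apply: le_trans hb _; rewrite ler_pM2r // expr2 ler_pMr.
move=> I; have {}I : nrm b <= 2 * omega ^+ 2 * nrm u.
  rewrite -(ler_pM2l bp) -expr2; apply: le_trans I _.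
  have -> : nrm b * (2 * omega ^+ 2 * nrm u) = nrm u * (omega ^+ 2 * nrm b + omega ^+ 2 * nrm b) by ring.
  by rewrite ler_wpM2l // lerD2l.
suff : B <= 2 * nrm b by lra.
have k0 : 0 <= 2 * nrm b by rewrite mulr_ge0 // ltW.
apply: le_trans (ler_norm _) (le_of_sqr k0 _); rewrite B2.
suff : kap ^- 4 * nrm b2 ^+ 2 <= nrm b ^+ 2 by rewrite exprMn; have := sqr_ge0 (nrm b); lra.
have k4 : 0 < kap ^+ 4 by rewrite exprn_gt0.
rewrite mulrC ler_pdivrMr //.
have -> : kap ^+ 4 = (omega ^+ 2 / ab) ^+ 2 by rewrite -kap2; ring.
have w0 : 0 <= omega ^+ 2 / ab by exact: divr_ge0 (sqr_ge0 _) (ltW ab0).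
rewrite -exprMn ler_sqr ?nnegrE ?nrm_ge0 //; last by rewrite mulr_ge0 ?nrm_ge0.
have -> : nrm b * (omega ^+ 2 / ab) = omega ^+ 2 * nrm b / ab by ring.
by rewrite ler_pdivlMr // mulrC.
Qed.

End MacroError.

(** * Assembly of the three estimates *)

Lemma gap_bounds (R : realType) (L ab alpha omega : R) (Mx : nat) :
  [/\ gap L Mx ab alpha omega <= gap_discrete L Mx alpha omega &
      forall j, (0 < j)%N -> gap L Mx ab alpha omega <= `|omega - Num.sqrt ab * (pi * j%:R / L)|].
Proof.
rewrite /gap; split; first by rewrite !ge_min lexx !orbT.
move=> j j0; rewrite !ge_min; apply/orP; right; apply/orP; right.
apply: ge_inf; first by exists 0 => _ [k _ <-].
by exists j.
Qed.

Lemma gridvec_eq (R : realType) (L : R) (Mx : nat) (f g : R -> R) : 0 < L ->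
  (forall x, 0 < x < L -> f x = g x) -> gridvec L Mx f = gridvec L Mx g.
Proof.
move=> L0 E; apply/matrixP => i j; rewrite !mxE; apply: E.
have H0 := Hstep_gt0 Mx L0.
rewrite mulr_gt0 ?ltr0n //= -[ltRHS](gridpt_last L Mx) /gridpt ltr_pM2r // ltr_nat.
by rewrite ltnS ltn_ord.
Qed.

Theorem theorem3p3 (R : realType) (a : R -> R) (ha : admissible_coef a)
    (p q : nat) (K : R -> R) (hK : kernel_class p q K) :
  (* (i) *)
  (exists Cabs : R,
    forall (L omega : R) (Mx Mt j : nat) (eps eta tau alpha : R)
      (b ubar : R -> R) (vh : 'cV[R]_Mx),
    whmm_setting a K L omega Mt j eps eta tau alpha b ubar vh ->
    normH L (gridvec L Mx ubar - vh) <=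
      Cabs * (((eps / eta) ^+ q + Hstep L Mx ^+ 2 * omega ^+ 2)
               / gap L Mx (abar a) alpha omega ^+ 2)
        * normH2 (kappa a omega) L b)
  /\
  (* (ii) *)
  (exists Crel : R, 0 < Crel /\
    forall (L : R) (b : R -> R),
    0 < L -> Cb2 L b -> C0 L b -> (exists x, 0 < x < L /\ b x != 0) ->
    exists omega0 : R,
    forall (omega : R) (Mx Mt j : nat) (eps eta tau alpha : R)
      (ubar : R -> R) (vh : 'cV[R]_Mx),
    omega0 <= omega ->
    whmm_setting a K L omega Mt j eps eta tau alpha b ubar vh ->
    Num.min (Hstep L Mx ^+ 2 * omega ^+ 3) (omega * (eps / eta) ^+ q)
      <= gap L Mx (abar a) alpha omega ->
    relative_estimate a q Crel L omega eps eta alpha ubar vh)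
  /\
  (* (iii) *)
  (forall (L : R) (g : R -> R) (Dg : R),
    0 < L -> C3 g -> (exists x, g x != 0) ->
    closure [set x | g x != 0] `<=` [set x | -1 < x < 1] ->
    inverse_stability_const a L g Dg ->
    exists Crel : R, 0 < Crel /\
    forall (omega : R) (Mx Mt j : nat) (eps eta tau alpha : R)
      (ubar : R -> R) (vh : 'cV[R]_Mx),
    1 <= omega ->
    whmm_setting a K L omega Mt j eps eta tau alpha
      (scaled_source g L omega) ubar vh ->
    Num.min (Hstep L Mx ^+ 2 * omega ^+ 3) (omega * (eps / eta) ^+ q)
      <= gap L Mx (abar a) alpha omega ->
    Hstep L Mx * omega <= Num.sqrt (abar a) * Num.sqrt (5 / (Dg + 1)) ->
    relative_estimate a q Crel L omega eps eta alpha ubar vh).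
Proof.
have ab0 := abar_gt0 ha; set ab := abar a in ab0 *.
have p120 : 0 < 120 :> R by rewrite ltr0n.
have [C1 C10 HC1] : exists2 C, 0 < C & forall (L omega : R) (Mx Mt j : nat)
    (eps eta tau alpha : R) (b u : R -> R) (vh : 'cV[R]_Mx),
    whmm_setting a K L omega Mt j eps eta tau alpha b u vh ->
    `|ab - alpha| <= C * (eps / eta) ^+ q.
  (* For q = 0 there is no integration by parts to perform, and the assumed closeness of alpha to
     abar already is the bound. *)
  case: (posnP q) => [q0|q0].
    exists ab => // L omega Mx Mt j eps eta tau alpha b u vh S.
    have := set_close S; rewrite -/ab ler_pdivrMr // q0 expr0 mulr1; lra.
  have [C C0 HC] := hmm_estimate ha hK q0; exists C => //.
  move=> L omega Mx Mt j eps eta tau alpha b u vh S.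
  have := set_alpha S; rewrite -(set_etatau S).
  exact: HC (set_eps S) (set_eta S).
have al0 (L omega : R) (Mx Mt j : nat) (eps eta tau alpha : R) (b u : R -> R) (vh : 'cV[R]_Mx) :
    whmm_setting a K L omega Mt j eps eta tau alpha b u vh -> 0 < alpha.
  move=> S; have := set_close S; rewrite -/ab ler_pdivrMr // => /ler_normlP[_ h].
  by have := ab0; lra.
pose C2 := C1 + 1; have C20 : 0 < C2 by rewrite /C2; lra.
have HX (L omega : R) (Mx Mt j : nat) (eps eta tau alpha : R) (b u : R -> R) (vh : 'cV[R]_Mx) :
    whmm_setting a K L omega Mt j eps eta tau alpha b u vh ->
    `|ab - alpha| + Hstep L Mx ^+ 2 * omega ^+ 2 <=
    C2 * ((eps / eta) ^+ q + Hstep L Mx ^+ 2 * omega ^+ 2).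
  move=> S; have := HC1 _ _ _ _ _ _ _ _ _ _ _ _ S.
  have x0 : 0 <= (eps / eta) ^+ q.
    by rewrite exprn_ge0 // divr_ge0 // ltW //; [exact: (set_eps S)|exact: (set_eta S)].
  have y0 : 0 <= Hstep L Mx ^+ 2 * omega ^+ 2 by rewrite mulr_ge0 // sqr_ge0.
  have z0 : 0 <= C1 * (Hstep L Mx ^+ 2 * omega ^+ 2) by rewrite mulr_ge0 // ltW.
  by rewrite /C2 mulrDl mul1r mulrDr; lra.
(* The common core of (ii) and (iii), which differ only in how the inverse stability constant D is
   obtained. *)
have rel (D L omega : R) (Mx Mt j : nat) (eps eta tau alpha : R) (b u : R -> R) (vh : 'cV[R]_Mx)
    (g g1 g2 : R -> R) :
    whmm_setting a K L omega Mt j eps eta tau alpha b u vh ->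
    derives g g1 -> prim g1 g2 -> lbm g2 -> (forall x, 0 < x < L -> g x = b x) ->
    (forall x, 0 < x < L -> g2 x = b^`(2) x) -> 0 < nrm L g -> 0 < D + 1 ->
    normH2 (kappa a omega) L b <= D * omega ^+ 2 * normL2 L u ->
    (D + 1) * (Hstep L Mx ^+ 2 * omega ^+ 2) <= 5 * ab ->
    relative_estimate a q (120 * (D + 1) / ab * C2) L omega eps eta alpha u vh.
  move=> S Dg pg g2b gE g2E gp D1 BD HD; have L0 := set_L S.
  have gc := derives_cont Dg.
  have [v [v1 [v2 [[Dv Dv1 v2c] v0 vL veq vE]]]] :=
    solution_extension L0 ab0 gc gE (set_ubar S).
  have /andP[d0 dom] := set_gap S; have [da dk] := gap_bounds L ab alpha omega Mx.
  have uE : gridvec L Mx u = gridvec L Mx v.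
    by apply: gridvec_eq => // x /andP[x0 xL]; rewrite vE // !ltW.
  have bE : alpha *: (D2 L Mx *m vh) + omega ^+ 2 *: vh = gridvec L Mx g.
    by rewrite (set_vh S).2; apply: gridvec_eq => // x xL; rewrite gE.
  have NB : normH2 (kappa a omega) L b =
      Num.sqrt (nrm L g ^+ 2 + (omega / Num.sqrt ab) ^- 4 * nrm L g2 ^+ 2).
    rewrite /normH2 (@normL2E _ L b g) //; last 2 first.
    - exact: lbm_continuous.
    - by move=> x xL; rewrite gE.
    by rewrite (@normL2E _ L b^`(2) g2) // => x xL; rewrite g2E.
  have NU : normL2 L u = nrm L v.
    apply: normL2E => //; first exact: lbm_continuous (derives_cont Dv).
    by move=> x /andP[x0 xL]; rewrite vE // !ltW.
  rewrite NB NU in BD.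
  have Bp : 0 < Num.sqrt (nrm L g ^+ 2 + (omega / Num.sqrt ab) ^- 4 * nrm L g2 ^+ 2).
    rewrite sqrtr_gt0; apply: ltr_pwDl; first by rewrite exprn_gt0.
    have om0 : 0 < omega by apply: lt_le_trans (set_omega S).
    by rewrite mulr_ge0 ?sqr_ge0 // invr_ge0 exprn_ge0 // divr_ge0 ?sqrtr_ge0 // ltW.
  have [n0 E] := relative_bound L0 (set_Mx S) ab0 (al0 _ _ _ _ _ _ _ _ _ _ _ _ S) (set_omega S)
    d0 da (set_Homega S) Dg pg g2b Dv Dv1 v2c v0 vL veq bE Bp BD HD.
  rewrite /relative_estimate -/ab uE; split => //; apply: le_trans E _.
  have om0 : 0 < omega by apply: lt_le_trans (set_omega S).
  have k0 : 0 <= 120 * (D + 1) / ab by exact: divr_ge0 (mulr_ge0 (ltW p120) (ltW D1)) (ltW ab0).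
  have -> : 120 * (D + 1) / ab * C2 * ((omega * (eps / eta) ^+ q + Hstep L Mx ^+ 2 * omega ^+ 3) /
      gap L Mx ab alpha omega) =
    120 * (D + 1) / ab * (C2 * ((eps / eta) ^+ q + Hstep L Mx ^+ 2 * omega ^+ 2)) * omega /
      gap L Mx ab alpha omega by ring.
  rewrite ler_pM2r ?invr_gt0 // ler_pM2r // ler_wpM2l //; exact: HX S.
split; last split.
- exists (50 / ab * C2) => L omega Mx Mt j eps eta tau alpha b u vh S; have L0 := set_L S.
  have [g [g1 [g2 [Dg pg g2b gE g2E]]]] := source_extension L0 (set_b S).
  have [v [v1 [v2 [[Dv Dv1 v2c] v0 vL veq vE]]]] :=
    solution_extension L0 ab0 (derives_cont Dg) gE (set_ubar S).
  have /andP[d0 dom] := set_gap S; have [da dk] := gap_bounds L ab alpha omega Mx.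
  have -> : gridvec L Mx u = gridvec L Mx v.
    by apply: gridvec_eq => // x /andP[x0 xL]; rewrite vE // !ltW.
  have bE : alpha *: (D2 L Mx *m vh) + omega ^+ 2 *: vh = gridvec L Mx g.
    by rewrite (set_vh S).2; apply: gridvec_eq => // x xL; rewrite gE.
  have -> : normH2 (kappa a omega) L b =
      Num.sqrt (nrm L g ^+ 2 + (omega / Num.sqrt ab) ^- 4 * nrm L g2 ^+ 2).
    rewrite /normH2 (@normL2E _ L b g) //; last 2 first.
    - exact: lbm_continuous (derives_cont Dg).
    - by move=> x xL; rewrite gE.
    by rewrite (@normL2E _ L b^`(2) g2) // => x xL; rewrite g2E.
  apply: le_trans (absolute_bound L0 (set_Mx S) ab0 (al0 _ _ _ _ _ _ _ _ _ _ _ _ S) (set_omega S)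
    d0 dom da dk (set_Homega S) Dg pg g2b Dv Dv1 v2c v0 vL veq bE) _.
  rewrite ler_wpM2r ?sqrtr_ge0 // -[50 / ab * C2 * _]mulrA mulrA.
  rewrite [leRHS](_ : _ = 50 / ab * (C2 * ((eps / eta) ^+ q + Hstep L Mx ^+ 2 * omega ^+ 2)) /
    gap L Mx ab alpha omega ^+ 2); last by ring.
  rewrite ler_pM2r ?invr_gt0 ?exprn_gt0 // ler_wpM2l ?divr_ge0 ?(ltW ab0) //; exact: HX S.
- exists (120 * (4 + 1) / ab * C2); split.
    have p5 : 0 < 4 + 1 :> R by rewrite addr_gt0 // ltr0n.
    exact: mulr_gt0 (divr_gt0 (mulr_gt0 p120 p5) ab0) C20.
  move=> L b L0 Cb [bcont b00 bL] [x [xL bx]].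
  have [g [g1 [g2 [Dg pg g2b gE g2E]]]] := source_extension L0 Cb.
  have gc := derives_cont Dg.
  have gEc y : 0 <= y <= L -> g y = b y.
    move=> yL; rewrite -[in RHS](clamp_id yL).
    apply: (eq_cont_ends L0 gc (clamp_cont L0 bcont)) yL => z zL.
    by have /andP[z0 zl] := zL; rewrite clamp_id ?(ltW z0) ?(ltW zl) // gE.
  have g00 : g 0 = 0 by rewrite gEc ?b00 // lexx ltW.
  have gL : g L = 0 by rewrite gEc ?bL // lexx ltW.
  have gp : 0 < nrm L g by apply: (nrm_gt0 gc xL); rewrite gE.
  (* The threshold is the frequency beyond which abar |b''| <= omega |b|. *)
  exists (ab * nrm L g2 / nrm L g) => omega Mx Mt j eps eta tau alpha u vh om S _.
  have [v [v1 [v2 [[Dv Dv1 v2c] v0 vL veq vE]]]] :=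
    solution_extension L0 ab0 gc gE (set_ubar S).
  have hb : ab * nrm L g2 <= omega * nrm L g by rewrite -ler_pdivrMr.
  (* With D = 4 the smallness condition reads 5 H^2 omega^2 <= 5 abar, which is the standing
     assumption on H omega squared. *)
  apply: (rel 4 _ _ _ _ _ _ _ _ _ _ _ _ _ _ _ S Dg pg g2b gE g2E gp) => //.
    rewrite /normH2 (@normL2E _ L b g) //; last 2 first.
    - exact: lbm_continuous.
    - by move=> y yL; rewrite gE.
    rewrite (@normL2E _ L b^`(2) g2) //; last by move=> y yL; rewrite g2E.
    rewrite (@normL2E _ L u v) //; last 2 first.
    - exact: lbm_continuous (derives_cont Dv).
    - by move=> y /andP[y0 yL]; rewrite vE // !ltW.
    exact: (high_frequency_bound L0 ab0 (set_omega S) Dg pg g2b Dv Dv1 v2c v0 vL veq g00 gL gp hb).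
  have -> : 4 + 1 = 5 :> R by ring.
  rewrite ler_pM2l // -exprMn -[leRHS](sqr_sqrtr (ltW ab0)) ler_sqr ?nnegrE ?sqrtr_ge0 //.
    exact: set_Homega S.
  have om0 : 0 < omega by apply: lt_le_trans (set_omega S).
  by rewrite mulr_ge0 ?(ltW om0) // ltW // Hstep_gt0.
- move=> L g0 Dg L0 _ [y gy] supp inv.
  (* The maximum keeps the constant positive before any solution is given; [Dg] is seen to be
     positive only once a setting exists. *)
  exists (120 * (Num.max 0 Dg + 1) / ab * C2); split.
    have Dp : 0 < Num.max 0 Dg + 1 by apply: ltr_pwDr => //; rewrite le_max lexx.
    exact: mulr_gt0 (divr_gt0 (mulr_gt0 p120 Dp) ab0) C20.
  move=> omega Mx Mt j eps eta tau alpha u vh om1 S _ HDg.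
  have om0 : 0 < omega by exact: lt_le_trans om1.
  have [g [g1 [g2 [Dgg pg g2b gE g2E]]]] := source_extension L0 (set_b S).
  have yI : -1 < y < 1 by apply: (supp y); exact: subset_closure.
  have gp : 0 < nrm L g.
    (* The preimage of y under the scaling; it lies inside (0, L) because |y| < 1 <= omega. *)
    have xL : 0 < L * (y / omega + 1) / 2 < L.
      have /andP[y1 y2] := yI; have z1 : -1 < y / omega by rewrite ltr_pdivlMr //; lra.
      have z2 : y / omega < 1 by rewrite ltr_pdivrMr //; lra.
      by move: (y / omega) z1 z2 => z z1 z2; apply/andP; split; nra.
    apply: (nrm_gt0 (derives_cont Dgg) xL); rewrite gE // /scaled_source.
    rewrite (_ : (_ - 1) * omega = y) //; field; by rewrite !gt_eqF.
  have BD := inv omega Mx alpha u om1 (set_Mx S) (set_close S) (set_gap S) (set_ubar S).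
  (* The source norm on the left of the stability inequality is positive, which excludes Dg <= 0. *)
  have Dp : 0 < Dg.
    rewrite ltNge; apply/negP => D0.
    have : normH2 (kappa a omega) L (scaled_source g0 L omega) <= 0.
      by apply: le_trans BD _; rewrite -mulrA mulr_le0_ge0 // mulr_ge0 ?sqr_ge0 // sqrtr_ge0.
    rewrite leNgt => /negP; apply; rewrite sqrtr_gt0; apply: ltr_pwDl.
      rewrite (@normL2E _ L _ g) ?exprn_gt0 //; first exact: lbm_continuous (derives_cont Dgg).
      by move=> z zL; rewrite gE.
    by rewrite mulr_ge0 ?sqr_ge0 // invr_ge0 exprn_ge0 // divr_ge0 ?sqrtr_ge0 // ltW.
  rewrite (max_r (ltW Dp)).
  have D1 : 0 < Dg + 1 by rewrite addr_gt0.
  apply: (rel Dg _ _ _ _ _ _ _ _ _ _ _ _ _ _ _ S Dgg pg g2b gE g2E gp D1 BD).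
  have s0 : 0 <= 5 / (Dg + 1) by rewrite divr_ge0 // ltW.
  have -> : 5 * ab = (Dg + 1) * (ab * (5 / (Dg + 1))) by field; rewrite gt_eqF.
  rewrite ler_pM2l // -exprMn -[ab * _](sqr_sqrtr (mulr_ge0 (ltW ab0) s0)) sqrtrM ?(ltW ab0) //.
  rewrite ler_sqr ?nnegrE ?mulr_ge0 ?sqrtr_ge0 ?(ltW om0) //.
  by rewrite ltW // Hstep_gt0.
Qed.
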